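(* Let $X(t)$, $t\in\mathbb{R}_+$, be a zero-mean stationary Gaussian, measurable, separable stochastic process with variance $\sigma_X^2\in(0,\infty)$, such that for some constants $C>0$, $\alpha>0$ $$\mathrm{Corr}(X(t),X(t+\tau))\le C\tau^{-\alpha}$$ for all sufficiently large $\tau$, and, for some $a_0>0$, $$1-\mathrm{Corr}(X(t),X(t+\tau))\le C|\tau|^{a_0}$$ for all sufficiently small $\tau$. Let $\Lambda(t)=\exp\{X(t)-\tfrac12\sigma_X^2\}$ and let $\Lambda^{(j)}$, $j=0,1,2,\dots$, be independent copies of $\Lambda$. Assume that $$b>\exp\{q^*\sigma_X^2/2\},$$ where $q^*\ge2$ is a fixed integer. Then the stochastic processes $$A_n(t)=\int_0^t\prod_{j=0}^n\Lambda^{(j)}(sb^j)\,ds,\qquad t\in[0,1],$$ converge in $\mathcal{L}_q$, $0<q\le q^*$, to a stochastic process $A(t)$, $t\in[0,1]$, as $n\to\infty$, such that $$\mathrm{E}A(t)^q\sim t^{\varsigma(q)},\qquad q\in[0,q^*],$$ where the scaling function is given by $$\varsigma(q)=-aq^2+(a+1)q,\quad q\in[0,q^*],\qquad a=\frac{\sigma_X^2}{2\log b}.$$ Moreover, if $$\mathrm{Corr}(X(t),X(t+\tau))=\frac{L(\tau)}{|\tau|^\alpha},\qquad \alpha>0,$$ where $L$ is a function slowly varying at infinity and bounded on every bounded interval, then for $t\in(0,1]$ $$\mathrm{Var}\,A(t)\ge t^{2-\alpha}\sigma_X^2\int_0^1\!\!\int_0^1\frac{L(t|u-w|)}{|u-w|^\alpha}\,du\,dw\quad\text{if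 }0<\alpha<1,$$ and $$\mathrm{Var}\,A(t)\ge 2t\sigma_X^2\int_0^t\Bigl(1-\frac ut\Bigr)\frac{L(u)}{|u|^\alpha}\,du\quad\text{if }\alpha\ge1.$$
   Context: Convergence in $\mathcal{L}_q$ means $\mathrm{E}|A_n(t)-A(t)|^q\to0$ for each fixed $t\in[0,1]$. Notation: $\mathrm{E}A(t)^q\sim t^{p}$ means that there are constants $0<\underline{C}\le\overline{C}<\infty$ (possibly depending on $q$ but not on $t$) with $\underline{C}\,t^{p}\le\mathrm{E}A(t)^q\le\overline{C}\,t^{p}$ for all $t\in[0,1]$ (with $0^0=1$). $\log$ is the natural logarithm. *)

(* Defs.v *)
From HB Require Import structures.
From mathcomp Require Import all_boot all_order all_algebra.
From mathcomp Require Import all_classical all_reals all_analysis.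

Set Implicit Arguments.
Unset Strict Implicit.
Unset Printing Implicit Defensive.

Import Order.TTheory GRing.Theory Num.Theory.
Import numFieldNormedType.Exports.

Local Open Scope classical_set_scope.
Local Open Scope ring_scope.

(** A real-valued process on R_+ is a function [X : R -> Omega -> R]; only its
    values at times [0 <= t] are ever constrained or used. *)

Section processes.
Context {d : measure_display} {Omega : measurableType d} {R : realType}.
Variable P : probability Omega R.
Implicit Types X : R -> Omega -> R.

(** Joint measurability in (time, outcome). *)
Definition measurable_process X :=
  measurable_fun ((`[0, +oo[%classic : set R) `*` [set: Omega])
    (fun p : R * Omega => X p.1 p.2).

(** Separability in the sense of Doob (relative to closed sets). *)
Definition separable_process X :=
  exists (S : set R) (N : set Omega),
    [/\ countable S, S `<=` `[0, +oo[, `[0, +oo[ `<=` closure S,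
        P.-negligible N &
        forall (u v : R) (F : set R), closed F ->
        forall w : Omega, ~ N w ->
          (forall s, S s -> u < s < v -> F (X s w)) ->
          forall t, 0 <= t -> u < t < v -> F (X t w)].

(** Degenerate (constant) variables count as Gaussian; they are treated apart
    because [normal_prob m 0] is not the Dirac mass at [m] in the library. *)
Definition gaussian_rv (Y : Omega -> R) :=
  measurable_fun [set: Omega] Y /\
  exists m s : R, forall B : set R, measurable B ->
    P (Y @^-1` B) = if s == 0 then dirac m B else normal_prob m s B.

Definition gaussian_process X :=
  forall (n : nat) (t : n.-tuple R) (c : 'I_n -> R),
    (forall i, 0 <= tnth t i) ->
    gaussian_rv (fun w => \sum_(i < n) c i * X (tnth t i) w).

Definition zero_mean_process X := forall t : R, 0 <= t -> ('E_P[X t] = 0)%E.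

Definition correlation (Y Z : Omega -> R) : R :=
  fine (covariance P Y Z) / Num.sqrt (fine 'V_P[Y]%E * fine 'V_P[Z]%E).

Definition process_sigma X : set (set Omega) :=
  <<s \bigcup_(t in `[0, +oo[) preimage_set_system setT (X t) measurable >>.

Definition independent_processes (X_ : nat -> R -> Omega -> R) :=
  forall (J : seq nat) (E : nat -> set Omega), uniq J ->
    (forall j, j \in J -> process_sigma (X_ j) (E j)) ->
    P (\bigcap_(j in [set` J]) E j) = (\prod_(j <- J) P (E j))%E.

End processes.

(** Equality of all finite-dimensional distributions; the two processes may live
    on different probability spaces. *)
Definition same_fdd {d d' : measure_display} {Omega : measurableType d}
    {Omega' : measurableType d'} {R : realType}
    (P : probability Omega R) (X : R -> Omega -> R)
    (P' : probability Omega' R) (Y : R -> Omega' -> R) :=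
  forall (n : nat) (t : n.-tuple R), (forall i, 0 <= tnth t i) ->
  forall B : set (n.-tuple R), measurable B ->
    P [set w | B [tuple X (tnth t i) w | i < n]] =
    P' [set w | B [tuple Y (tnth t i) w | i < n]].

Definition stationary_process {d : measure_display} {Omega : measurableType d}
    {R : realType} (P : probability Omega R) (X : R -> Omega -> R) :=
  forall h : R, 0 <= h -> same_fdd P X P (fun t => X (t + h)).

(** [Y] is a copy of [X] as a measurable separable process. *)
Definition process_copy {d d' : measure_display} {Omega : measurableType d}
    {Omega' : measurableType d'} {R : realType}
    (P : probability Omega R) (X : R -> Omega -> R)
    (P' : probability Omega' R) (Y : R -> Omega' -> R) :=
  [/\ measurable_process Y, separable_process P' Y & same_fdd P X P' Y].

Definition slowly_varying {R : realType} (L : R -> R) :=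
  (exists x0 : R, measurable_fun `[x0, +oo[ L /\ forall x, x0 <= x -> 0 < L x) /\
  (forall lam : R, 0 < lam -> (fun x => L (lam * x) / L x) @ +oo --> (1 : R)).

(** Partial integrated products
    [A_n(t) = int_0^t prod_(0 <= j <= n) Lam_j (s b^j) ds]. *)
Definition multifractal_product {T : Type} {R : realType}
    (Lam : nat -> R -> T -> R) (b : R) (n : nat) (t : R) (w : T) : R :=
  \int[lebesgue_measure]_(s in `[0, t]) \prod_(j < n.+1) Lam j (s * b ^+ j) w.

Definition scaling {R : realType} (a q : R) : R := - a * q ^+ 2 + (a + 1) * q.

(* Main.v *)
(** Write [A_n(t)] for the integral over [0, t] of the product of the first [n + 1]
    layers, [k] for [qstar], [v] for the variance of [X] and [rho] for its correlation.
    Joint moments of the layers are explicit exponentials of correlations.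

    Convergence. As the layers are independent of mean 1,
    [E (A_n' A_n^l) = E A_n^(l+1)] for [n <= n'], and the convexity inequality
    [|y - x|^k <= y^k - x^k - k x^(k-1) (y - x)] gives
    [E |A_n' - A_n|^k <= E A_n'^k - E A_n^k]. So the [k]-th moments increase, and
    convergence in [L_k] follows once they are bounded.

    Scaling. For [t] of order [b^-m] put [G = prod_(j < m) Lam_j(0)], whose moments are
    [E G^q = exp(m v (q^2 - q) / 2)], so that [t^q E G^q] is of order
    [t^(scaling a q)]. The condition on [rho] near 0 says that the first [m]
    layers are nearly constant on [0, t], and one gets
    [E (G^(q-p) A_n^p) <= C t^p E G^q] for [1 <= p <= k] and
    [E (G^(q-1) A_n) >= c t E G^q]. Truncating [A_n] at multiples of [t G] turns these
    into two-sided bounds on [E A_n^q] for real [q]. In the upper bound, AM-GM reduces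
    the [p]-fold integral of an exponential of pair correlations to one-dimensional
    integrals, which are finite because [b > exp(k v / 2)].

    Variance. [Var A(t) >= Var A_0(t)] is the integral of [exp(v rho) - 1] over
    the square [0, t]^2, hence at least [v] times the integral of [rho], which is rewritten by
    affine changes of variables. *)

Require Import Defs.
From HB Require Import structures.
From mathcomp Require Import all_boot all_order all_algebra.
From mathcomp Require Import all_classical all_reals all_analysis.
From mathcomp Require Import measurable_realfun ring lra.

Set Implicit Arguments.
Unset Strict Implicit.
Unset Printing Implicit Defensive.

Import Order.TTheory GRing.Theory Num.Theory.
Import numFieldNormedType.Exports.

Local Open Scope classical_set_scope.
Local Open Scope ring_scope.

(** * Elementary inequalities and Tonelli's theorem on rectangles *)

(** Only integer powers of an integral expand into joint moments, whereas [q] is real. Hence the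
    weight G^(q-p) is carried through every expansion. In the two-sided bounds only [p = 1], [p = 2]
    and [p = k] occur: [p = k] caps the moment from above, and [p = 1] against [p = 2] is a
    Paley-Zygmund argument from below. For [p = 1] every level beyond [m] holds a single factor of
    mean one, so the lower estimate sees only the coarse levels.

    The threshold on [b] comes from the fine levels, where a correlation is bounded only by 1 until
    the rescaled distance exceeds 1. When a product over pairs of [p] points is averaged over stars,
    each pair in a star carries the exponent [p v / 2]. Two points that stay close during [i] levels
    cost exp(i p v / 2), and the points that close to a given one form a set of length of order
    b^-(m+i). The geometric series has ratio exp(p v / 2) / b.

    The Gaussian law and the independence of the layers reach the cascade only through
    [lognormal_family], an identity between joint moments. Limits are built directly in L_k from
    moment differences, without conditional expectations. *)

Section real_inequalities.
Context {R : realType}.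
Implicit Types (x y q : R) (k : nat).

(** Induction on [k] from equality at [k = 2]: the gap on the right satisfies gap(k+1) = y gap(k) +
    k x^(k-1) (y - x)^2. For [x <= y] the first term is enough because [y - x <= y]; for [y < x] the
    second is, because [x - y <= x]. *)
Lemma convex_expr_gap k x y : (2 <= k)%N -> 0 <= x -> 0 <= y ->
  `|y - x| ^+ k <= y ^+ k - x ^+ k - k%:R * x ^+ k.-1 * (y - x).
Proof.
move=> k2 x0 y0; elim: k k2 => // k IH.
rewrite leq_eqVlt => /orP[/eqP <-|k2].
  by rewrite real_normK ?num_real//; lra.
have {}IH := IH k2.
have -> : y ^+ k.+1 - x ^+ k.+1 - k.+1%:R * x ^+ k * (y - x) =
    y * (y ^+ k - x ^+ k - k%:R * x ^+ k.-1 * (y - x)) +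
    k%:R * x ^+ k.-1 * (y - x) ^+ 2.
  by case: k k2 {IH} => // k _ /=; rewrite -!natr1 !exprS; ring.
set D := (X in _ <= y * X + _); have D0 : 0 <= D by exact: le_trans IH.
have [xy|xy] := leP x y.
  have d0 : 0 <= y - x by rewrite subr_ge0.
  rewrite exprS -[leLHS]addr0; apply: lerD.
    by apply: ler_pM; rewrite ?exprn_ge0// ger0_norm//; lra.
  by apply: mulr_ge0; [apply: mulr_ge0|]; rewrite ?exprn_ge0 ?sqr_ge0.
have d0 : 0 <= x - y by rewrite subr_ge0 ltW.
rewrite -[leLHS]add0r; apply: lerD; first exact: mulr_ge0.
rewrite distrC ger0_norm//.
have -> : (y - x) ^+ 2 = (x - y) ^+ 2 by ring.
case: k k2 {IH D D0} => // k k2 /=; rewrite -[k.+2]addn2 exprD ler_wpM2r ?sqr_ge0//.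
rewrite -[leLHS]mul1r; apply: ler_pM; rewrite ?exprn_ge0 ?ler1n// lerXn2r ?nnegrE//; lra.
Qed.

(** Reduces a moment of real order to the integer order [k], with a free truncation level [x]: above
    [x], the factor y^(q-k) is at most x^(q-k). *)
Lemma powR_le_truncated q k x y : 0 <= q <= k%:R -> 0 < x -> 0 <= y ->
  y `^ q <= x `^ q + x `^ (q - k%:R) * y ^+ k.
Proof.
move=> /andP[q0 qk] x0 y0; have [yx|xy] := leP y x.
  rewrite -[leLHS]addr0 lerD ?mulr_ge0 ?powR_ge0 ?exprn_ge0//.
  by rewrite ge0_ler_powR ?nnegrE// ltW.
have y0' : 0 < y by exact: lt_trans xy.
rewrite -[leLHS]add0r lerD ?powR_ge0// -powR_mulrn//.
have -> : y `^ q = y `^ (q - k%:R) * y `^ k%:R.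
  by rewrite -powRD ?subrK// (gt_eqF y0') implybT.
rewrite ler_wpM2r ?powR_ge0// -(opprB k%:R q) !powRN lef_pV2 ?posrE ?powR_gt0//.
by rewrite ge0_ler_powR ?nnegrE ?subr_ge0// ltW.
Qed.

(** Turns a lower bound on a first moment and an upper bound on a second into a lower bound on the
    moment of order [q]. The three terms cover [x <= e], [x >= y] and the range between; there
    x^(1-q) is monotone in [x], so it is bounded by its value at one end, the sign of [1 - q]
    deciding which. *)
Lemma le_powR_truncated q x y e : 0 <= q -> 0 < e -> 0 < y -> 0 <= x ->
  x <= e + x ^+ 2 / y + (e `^ (1 - q) + y `^ (1 - q)) * x `^ q.
Proof.
move=> q0 e0 y0 x0; have c0 : 0 <= (e `^ (1 - q) + y `^ (1 - q)) * x `^ q.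
  by apply: mulr_ge0; rewrite ?addr_ge0 ?powR_ge0.
have d0 : 0 <= x ^+ 2 / y by apply: mulr_ge0; rewrite ?exprn_ge0// invr_ge0 ltW.
have [xe|ex] := leP x e.
  by rewrite -addrA -[leLHS]addr0; apply: lerD => //; exact: addr_ge0.
have x0' : 0 < x by exact: lt_trans ex.
have [yx|xy] := leP y x.
  apply: le_trans (_ : x ^+ 2 / y <= _); last first.
    by rewrite addrAC -[leLHS]add0r lerD// addr_ge0// ltW.
  by rewrite ler_pdivlMr// expr2 ler_wpM2l// ltW.
rewrite -[leLHS]add0r; apply: lerD; first by rewrite addr_ge0// ltW.
rewrite -[leLHS](_ : x `^ (1 - q) * x `^ q = x); last first.
  by rewrite -powRD ?subrK ?powRr1// (gt_eqF x0') implybT.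
rewrite ler_wpM2r ?powR_ge0//; have [q1|q1] := leP q 1.
  rewrite -[leLHS]add0r lerD ?powR_ge0// ge0_ler_powR ?nnegrE ?subr_ge0// ltW//.
rewrite -[leLHS]addr0 lerD ?powR_ge0// -(opprB q 1) !powRN lef_pV2 ?posrE ?powR_gt0//.
by rewrite ge0_ler_powR ?nnegrE ?subr_ge0// ltW.
Qed.

(** Either [y <= 2 x] or [|x - y| >= y / 2]. This substitute for Minkowski's inequality also serves
    orders below one. *)
Lemma powR_le_double q x y : 0 <= q -> 0 <= x -> 0 <= y ->
  y `^ q <= 2 `^ q * (x `^ q + `|x - y| `^ q).
Proof.
move=> q0 x0 y0.
rewrite mulrDr -!powRM//.
have [h|h] := leP y (2 * x).
  rewrite -[leLHS]addr0 lerD ?powR_ge0// ge0_ler_powR ?nnegrE// mulr_ge0//.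
rewrite -[leLHS]add0r lerD ?powR_ge0// ge0_ler_powR ?nnegrE ?mulr_ge0//.
by rewrite distrC ger0_norm; lra.
Qed.

(** The exponential lies above its tangent at the mean [m], and the linear terms cancel in the
    sum. *)
Lemma expR_mean_le n (a : 'I_n.+1 -> R) :
  expR ((\sum_i a i) / n.+1%:R) <= (\sum_i expR (a i)) / n.+1%:R.
Proof.
set m := _ / _; have n0 : (n.+1%:R : R) != 0 by rewrite pnatr_eq0.
rewrite ler_pdivlMr ?ltr0n//.
have -> : expR m * n.+1%:R = \sum_i expR m * (1 + (a i - m)).
  rewrite -mulr_sumr big_split/= sumrB !sumr_const card_ord -mulr_natr mul1r.
  by rewrite -[m *+ _]mulr_natr divfK// subrr addr0.
apply: ler_sum => i _; rewrite -[in leRHS](subrK m (a i)) expRD mulrC.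
by rewrite ler_wpM2r ?expR_ge0// expR_ge1Dx.
Qed.

End real_inequalities.

Section nonneg_integrals.
Local Open Scope ereal_scope.
Context d (T : measurableType d) (R : realType).

(** Monotonicity needs no measurability: the integral of a nonnegative function
    is a supremum over the simple functions below it. *)
Lemma ge0_le_int (mu : {measure set T -> \bar R}) (D : set T) (f g : T -> \bar R) :
  (forall x, D x -> 0 <= f x) -> (forall x, D x -> f x <= g x) ->
  \int[mu]_(x in D) f x <= \int[mu]_(x in D) g x.
Proof.
move=> f0 fg; rewrite !ge0_integralE//; last first.
  by move=> x Dx; apply: le_trans (f0 x Dx) (fg x Dx).
apply: le_ereal_sup => _ [h/= hf <-]; exists h => // x.
apply: le_trans (hf x) _; rewrite !patchE; case: ifPn => // xD.
by apply: fg; rewrite inE in xD.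
Qed.

Context d' (T' : measurableType d').
Variables (m1 : {sigma_finite_measure set T -> \bar R}).
Variables (m2 : {sigma_finite_measure set T' -> \bar R}).
Variables (D : set T) (D' : set T').
Hypotheses (mD : measurable D) (mD' : measurable D').
Variable f : T * T' -> \bar R.
Hypotheses (mf : measurable_fun setT f).
Hypotheses (f0 : forall x y, D x -> D' y -> 0 <= f (x, y)).

Let h (p : T * T') : \bar R := (f \_ (D `*` D')) p.

Let mh : measurable_fun setT h.
Proof.
apply/(measurable_restrictT _ _).1 => //; first exact: measurableX.
exact: measurable_funTS.
Qed.

Let h0 p : 0 <= h p.
Proof.
by apply: erestrict_ge0 => -[x y] [/= Dx Dy]; exact: f0.
Qed.

Let h1E x : D x -> \int[m2]_(y in D') f (x, y) = \int[m2]_y h (x, y).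
Proof.
move=> Dx; rewrite integral_mkcond; apply: eq_integral => y _.
rewrite /h !patchE/= in_setX/= [x \in D]mem_set//=.
Qed.

Let h2E y : D' y -> \int[m1]_(x in D) f (x, y) = \int[m1]_x h (x, y).
Proof.
move=> Dy; rewrite integral_mkcond; apply: eq_integral => x _.
by rewrite /h !patchE/= in_setX/= [y \in D']mem_set// andbT.
Qed.

(** Both sides are integrals over whole spaces of [h], the extension by zero, which is nonnegative
    everywhere while [f] is so on the rectangle. *)
Lemma tonelli_in : \int[m1]_(x in D) \int[m2]_(y in D') f (x, y) =
  \int[m2]_(y in D') \int[m1]_(x in D) f (x, y).
Proof.
transitivity (\int[m1]_x \int[m2]_y h (x, y)).
  rewrite integral_mkcond; apply: eq_integral => x _; rewrite patchE.
  case: ifPn => [/[!inE] xD|xD]; first exact: h1E.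
  rewrite integral0_eq// => y _; rewrite /h patchE in_setX/= (negbTE xD)//.
rewrite fubini_tonelli//; rewrite [RHS]integral_mkcond.
apply: eq_integral => y _; rewrite patchE.
case: ifPn => [/[!inE] yD|yD]; first by rewrite h2E.
by rewrite integral0_eq// => x _; rewrite /h patchE in_setX/= (negbTE yD) andbF.
Qed.

Lemma measurable_int1 : measurable_fun D (fun x => \int[m2]_(y in D') f (x, y)).
Proof.
apply: (@eq_measurable_fun _ _ _ _ D (fun x => \int[m2]_y h (x, y))).
  by move=> x /[!inE] Dx; rewrite h1E.
by apply: measurable_funTS; exact: (measurable_fun_fubini_tonelli_F h).
Qed.

Lemma measurable_int2 : measurable_fun D' (fun y => \int[m1]_(x in D) f (x, y)).
Proof.
apply: (@eq_measurable_fun _ _ _ _ D' (fun y => \int[m1]_x h (x, y))).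
  by move=> y /[!inE] Dy; rewrite h2E.
by apply: measurable_funTS; exact: (measurable_fun_fubini_tonelli_G h).
Qed.

End nonneg_integrals.

(** * Moments of an integrated process *)

Section power_of_integral.
Local Open Scope ereal_scope.
Context d (Omega : measurableType d) (R : realType) (P : probability Omega R).
Variables (D : set R) (mD : measurable D).
Variable M : R -> Omega -> R.
Hypothesis mM : measurable_fun setT (fun p : R * Omega => M p.1 p.2).
Hypothesis M0 : forall s w, (0 <= M s w)%R.

Let mu := @lebesgue_measure R.
Let I w := \int[mu]_(s in D) (M s w)%:E.

Let mMe : measurable_fun setT (fun p : R * Omega => (M p.1 p.2)%:E).
Proof. exact/measurable_EFinP. Qed.

Let mMs s : measurable_fun setT (M s).
Proof. exact: (measurable_fun_pair2 (f := fun p : R * Omega => M p.1 p.2)). Qed.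

Let mMw w : measurable_fun setT (M ^~ w).
Proof. exact: (measurable_fun_pair1 (f := fun p : R * Omega => M p.1 p.2)). Qed.

Lemma measurable_process_integral : measurable_fun setT I.
Proof.
have M0e s w : D s -> setT w -> 0 <= (fun p => (M p.1 p.2)%:E) (s, w).
  by move=> _ _; rewrite lee_fin.
exact: (measurable_int2 mu mD measurableT mMe M0e).
Qed.
Let mI := measurable_process_integral.

Let I0 w : 0 <= I w.
Proof. by apply: integral_ge0 => s _; rewrite lee_fin. Qed.

Let mIX l : measurable_fun setT (fun w => I w ^+ l).
Proof.
elim: l => [|l IH]; first exact: measurable_cst.
by under eq_fun do rewrite expeS; exact: emeasurable_funM.
Qed.

Lemma expectation_mul_process_integral (W : Omega -> \bar R) :
  measurable_fun setT W -> (forall w, 0 <= W w) ->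
  \int[P]_w (I w * W w) = \int[mu]_(s in D) \int[P]_w ((M s w)%:E * W w).
Proof.
move=> mW W0.
pose h (p : R * Omega) := (M p.1 p.2)%:E * W p.2.
have mh : measurable_fun setT h.
  by apply: emeasurable_funM => //; apply: (measurableT_comp mW); exact: measurable_snd.
have h0 x y : D x -> setT y -> 0 <= h (x, y).
  by move=> _ _; rewrite /h/= mule_ge0 ?lee_fin.
rewrite [RHS](tonelli_in mu P mD measurableT mh h0).
apply: eq_integral => w _; rewrite /h; cbn [fst snd].
rewrite ge0_integralZr//.
- by apply/measurable_EFinP/measurable_funTS; exact: mMw.
- by move=> s _; rewrite lee_fin.
Qed.

(** One factor of the power is written as an integral and its integrand is absorbed into the weight.
    An arbitrary weight [Z] lets this be iterated until only joint moments of [M] remain. *)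
Lemma moment_succ (Z : Omega -> R) l : measurable_fun setT Z ->
  (forall w, 0 <= Z w)%R ->
  \int[P]_w ((Z w)%:E * I w ^+ l.+1) =
  \int[mu]_(s in D) \int[P]_w ((Z w * M s w)%:E * I w ^+ l).
Proof.
move=> mZ Z0.
pose W w := (Z w)%:E * I w ^+ l.
have mW : measurable_fun setT W.
  by apply: emeasurable_funM => //; apply/measurable_EFinP.
have W0 w : 0 <= W w by rewrite mule_ge0 ?expe_ge0 ?lee_fin.
transitivity (\int[P]_w (I w * W w)).
  by apply: eq_integral => w _; rewrite expeS /W muleCA.
rewrite (expectation_mul_process_integral mW W0); apply: eq_integral => s _.
by apply: eq_integral => w _; rewrite /W muleA -EFinM mulrC.
Qed.

Lemma moment_eq (Z Z' : Omega -> R) l :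
  measurable_fun setT Z -> (forall w, 0 <= Z w)%R ->
  measurable_fun setT Z' -> (forall w, 0 <= Z' w)%R ->
  (forall ss : seq R, size ss = l -> (forall s, s \in ss -> D s) ->
    \int[P]_w (Z w * \prod_(s <- ss) M s w)%:E =
    \int[P]_w (Z' w * \prod_(s <- ss) M s w)%:E) ->
  \int[P]_w ((Z w)%:E * I w ^+ l) = \int[P]_w ((Z' w)%:E * I w ^+ l).
Proof.
elim: l Z Z' => [|l IH] Z Z' mZ Z0 mZ' Z'0 ZZ'.
  have h (Y : Omega -> R) : (fun w => (Y w)%:E * I w ^+ 0) =
      (fun w => (Y w * \prod_(s <- [::]) M s w)%:E).
    by apply/funext => w; rewrite big_nil mulr1 mule1.
  by rewrite !h; apply: ZZ'.
rewrite (moment_succ l mZ Z0) (moment_succ l mZ' Z'0); apply: eq_integral => s /[!inE] Ds; apply: IH.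
- exact: measurable_funM.
- by move=> w; rewrite mulr_ge0.
- exact: measurable_funM.
- by move=> w; rewrite mulr_ge0.
move=> ss sl sD.
have h (Y : Omega -> R) : (fun w => (Y w * M s w * \prod_(u <- ss) M u w)%:E) =
    (fun w => (Y w * \prod_(u <- s :: ss) M u w)%:E).
  by apply/funext => w; rewrite big_cons mulrA.
rewrite !h; apply: ZZ'; first by rewrite /= sl.
by move=> u; rewrite in_cons => /predU1P[->//|]; exact: sD.
Qed.

Section star.
Variables (f : R -> R -> R) (C : R).
Hypothesis mf : measurable_fun setT (fun p : R * R => f p.1 p.2).
Hypothesis f0 : forall x y, (0 <= f x y)%R.
Hypothesis C0 : (0 <= C)%R.
Hypothesis fC : forall x, D x -> \int[mu]_(y in D) (f x y)%:E <= C%:E.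

Let F x (ss : seq R) : R := (\prod_(u <- ss) f x u)%R.

(** AM-GM bounds a product over all pairs of points by the mean over [i] of such
    stars; in a star every point but the [i]-th occurs in one factor only, so the
    variables can be integrated out one at a time. *)
Definition star (ss : seq R) (i : 'I_(size ss)) : R :=
  (\prod_(l < size ss | l != i) f (nth 0%R ss i) (nth 0%R ss l))%R.

Definition star_sum (ss : seq R) : R := (\sum_(i < size ss) star i)%R.

Let star0 ss i : (0 <= @star ss i)%R.
Proof. exact: prodr_ge0. Qed.

Let F0 x ss : (0 <= F x ss)%R.
Proof. exact: prodr_ge0. Qed.

(** The new point is the centre of one new star and the end of one new arm in each old star. *)
Let star_sum_cons s ss : star_sum (s :: ss) =
  (F s ss + \sum_(i < size ss) f (nth 0 ss i) s * star i)%R.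
Proof.
rewrite /star_sum big_ord_recl; congr +%R.
  rewrite /star big_mkcond big_ord_recl/= mul1r.
  by rewrite /F (big_nth 0%R) big_mkord; apply: eq_bigr => i _.
apply: eq_bigr => i _; rewrite /star big_mkcond big_ord_recl/=.
congr *%R; rewrite [RHS]big_mkcond; apply: eq_bigr => l _.
by rewrite (inj_eq lift_inj).
Qed.

Let mfr x : measurable_fun setT (f x).
Proof. exact: (measurable_fun_pair2 (f := fun p : R * R => f p.1 p.2)). Qed.

Let mfl y : measurable_fun setT (f ^~ y).
Proof. exact: (measurable_fun_pair1 (f := fun p : R * R => f p.1 p.2)). Qed.

Let mF ss : measurable_fun setT (F ^~ ss).
Proof. by apply: measurable_prod => u _. Qed.

Let mS ss : measurable_fun setT (fun s => star_sum (s :: ss)).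
Proof.
under eq_fun do rewrite star_sum_cons.
apply: measurable_funD => //; apply: measurable_sum => i.
by apply: measurable_funM => //; exact: mfr.
Qed.

Let Fc ss (p : R * R) := (F p.1 (p.2 :: ss))%:E.

Let mFc ss : measurable_fun setT (Fc ss).
Proof.
apply/measurable_EFinP; rewrite /F.
under eq_fun do rewrite big_cons.
apply: measurable_funM; first exact: mf.
by apply: (measurableT_comp (mF ss)); exact: measurable_fst.
Qed.

Let Fc0 ss p : 0 <= Fc ss p.
Proof. by rewrite lee_fin. Qed.

Let mint_F ss :
  measurable_fun setT (fun s => \int[mu]_(x in D) (F x (s :: ss))%:E).
Proof.
exact: (measurable_int2 mu mD measurableT (mFc ss) (fun x y _ _ => Fc0 ss (x, y))).
Qed.

(** [fC] controls the integral over the second argument of [f], the end of an arm, so the order is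
    exchanged to integrate the end [s] with the centre [x] fixed. *)
Let int_F_le ss : \int[mu]_(s in D) \int[mu]_(x in D) (F x (s :: ss))%:E <=
  C%:E * \int[mu]_(x in D) (F x ss)%:E.
Proof.
rewrite -(tonelli_in mu mu mD mD (mFc ss) (fun x y _ _ => Fc0 ss (x, y)))/=.
rewrite -ge0_integralZl//.
- apply: ge0_le_int => x Dx.
    by apply: integral_ge0 => s _; exact: Fc0.
  rewrite /Fc/=; under eq_integral do rewrite /F big_cons EFinM.
  rewrite ge0_integralZr//; last 3 first.
  + by apply/measurable_EFinP/measurable_funTS; exact: mfr.
  + by move=> s _; rewrite lee_fin.
  + by rewrite lee_fin; exact: F0.
  by rewrite lee_wpmul2r ?fC// lee_fin; exact: F0.
- by apply/measurable_EFinP/measurable_funTS; exact: mF.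
- by move=> x _; rewrite lee_fin; exact: F0.
Qed.

Let star_sum0 ss : (0 <= star_sum ss)%R.
Proof. exact: sumr_ge0. Qed.

Let int_star_le ss : (forall s, s \in ss -> D s) ->
  \int[mu]_(s in D) (star_sum (s :: ss))%:E <=
  \int[mu]_(s in D) (F s ss)%:E + C%:E * (star_sum ss)%:E.
Proof.
move=> sD; under eq_integral do rewrite star_sum_cons EFinD -sumEFin.
rewrite ge0_integralD//; first last.
- apply: emeasurable_sum => i.
  by apply/measurable_EFinP/measurable_funTS/measurable_funM => //; exact: mfr.
- by move=> s _; apply: sume_ge0 => i _; rewrite lee_fin mulr_ge0.
- by apply/measurable_EFinP/measurable_funTS; exact: mF.
- by move=> s _; rewrite lee_fin; exact: F0.
rewrite leeD2l// ge0_integral_sum//; first last.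
- by move=> i s _; rewrite lee_fin mulr_ge0.
- move=> i.
  by apply/measurable_EFinP/measurable_funTS/measurable_funM => //; exact: mfr.
rewrite /star_sum -sumEFin ge0_sume_distrr; last by move=> i _; rewrite lee_fin.
apply: lee_sum => i _.
under eq_integral do rewrite EFinM.
rewrite ge0_integralZr//; first last.
- by rewrite lee_fin.
- by move=> s _; rewrite lee_fin.
- by apply/measurable_EFinP/measurable_funTS; exact: mfr.
by rewrite lee_wpmul2r ?lee_fin// fC//; apply/sD/mem_nth.
Qed.

(** Each star costs a factor [C] for each of its [p - 1] arms and [mu D] for its centre, and the [p]
    stars share the weight [K] equally. *)
Lemma moment_star_le (Z : Omega -> R) p (K : R) : (0 < p)%N -> (0 <= K)%R ->
  measurable_fun setT Z -> (forall w, 0 <= Z w)%R ->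
  (forall ss : seq R, size ss = p -> (forall s, s \in ss -> D s) ->
    \int[P]_w (Z w * \prod_(s <- ss) M s w)%:E <=
    (K / p%:R * star_sum ss)%:E) ->
  \int[P]_w ((Z w)%:E * I w ^+ p) <= (K * C ^+ p.-1)%:E * mu D.
Proof.
move=> p0 K0 mZ Z0 base.
(* Integrating out one more variable multiplies each star by [C], except the one
   centred at that variable, which is integrated against all the others: this
   gives the recursions for the coefficients [k] and [k']. *)
pose k l : R := (K / p%:R * C ^+ l)%R.
have kS l : (k l.+1 = k l * C)%R by rewrite /k exprSr mulrA.
have k0 l : (0 <= k l)%R by rewrite /k mulr_ge0 ?exprn_ge0// divr_ge0.
pose k' l : R := (K / p%:R * (l%:R * C ^+ l.-1))%R.
have k'S l : (k' l.+1 = k l + k' l * C)%R.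
  rewrite /k' /k/=; case: l => [|l]; first by rewrite !mul0r !mulr0 mul0r addr0 mul1r.
  rewrite /= -[l.+2%:R]natr1 exprSr; ring.
have k'0 l : (0 <= k' l)%R.
  by rewrite /k' !mulr_ge0 ?exprn_ge0// invr_ge0.
(* Here [l] variables are integrated out and [ss] lists the others. The first term gathers the stars
   centred in [ss]; the second gathers the [l] stars whose centre [x] is an integrated variable and
   whose remaining arms lead to [ss]. *)
have claim l : (l <= p)%N -> forall ss, size ss = (p - l)%N ->
    (forall s, s \in ss -> D s) ->
    \int[P]_w ((Z w * \prod_(s <- ss) M s w)%:E * I w ^+ l) <=
    (k l)%:E * (star_sum ss)%:E + (k' l)%:E * \int[mu]_(x in D) (F x ss)%:E.
  elim: l => [|l IH] lp ss sz sD.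
    under eq_integral do rewrite mule1.
    rewrite /k' mul0r mulr0 mul0e adde0 /k expr0 mulr1 -EFinM.
    by apply: base; rewrite // sz subn0.
  have mZM : measurable_fun setT (fun w => Z w * \prod_(s <- ss) M s w)%R.
    by apply: measurable_funM => //; apply: measurable_prod => s _.
  have ZM0 w : (0 <= Z w * \prod_(s <- ss) M s w)%R.
    by rewrite mulr_ge0// prodr_ge0.
  rewrite (moment_succ l mZM ZM0).
  apply: le_trans (_ : \int[mu]_(s in D) ((k l)%:E * (star_sum (s :: ss))%:E +
      (k' l)%:E * \int[mu]_(x in D) (F x (s :: ss))%:E) <= _).
    apply: ge0_le_int => s Ds.
      apply: integral_ge0 => w _; rewrite mule_ge0 ?expe_ge0// lee_fin.
      by rewrite !mulr_ge0// prodr_ge0.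
    rewrite (_ : (fun w => _) = (fun w => (Z w * \prod_(u <- s :: ss) M u w)%:E * I w ^+ l)).
      apply: IH; [exact: ltnW|by rewrite /= sz subnSK|].
      by move=> u; rewrite in_cons => /predU1P[->//|]; exact: sD.
    by apply/funext => w; rewrite big_cons mulrAC -mulrA.
  have FI0 s' : 0 <= \int[mu]_(x in D) (F x s')%:E.
    by apply: integral_ge0 => x _; rewrite lee_fin; exact: F0.
  rewrite ge0_integralD//; first last.
  - by apply: emeasurable_funM => //; apply: measurable_funTS; exact: mint_F.
  - by move=> s _; rewrite mule_ge0// lee_fin//; exact: star_sum0.
  - apply: emeasurable_funM => //.
    by apply/measurable_EFinP/measurable_funTS; exact: mS.
  - by move=> s _; rewrite mule_ge0// lee_fin//; exact: star_sum0.
  rewrite !ge0_integralZl ?lee_fin//; first last.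
  - by move=> s _; rewrite lee_fin; exact: star_sum0.
  - by apply/measurable_EFinP/measurable_funTS; exact: mS.
  - by apply: measurable_funTS; exact: mint_F.
  apply: le_trans (leeD (lee_wpmul2l _ (int_star_le sD)) (lee_wpmul2l _ (int_F_le ss))) _.
  - by rewrite lee_fin.
  - by rewrite lee_fin.
  rewrite ge0_muleDr ?mule_ge0 ?lee_fin// muleA -EFinM -kS.
  rewrite [X in X + _]addeC -addeA muleA -EFinM -ge0_muleDl ?lee_fin//; last exact: mulr_ge0.
  by rewrite -EFinD -k'S.
have := claim p (leqnn p) [::]; rewrite subnn => /(_ erefl).
under eq_integral do rewrite big_nil mulr1.
move=> /(_ _) h; apply: le_trans (h _) _ => [s|]; first by rewrite in_nil.
rewrite /star_sum big_ord0 mule0 add0e.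
under eq_integral do rewrite /F big_nil.
rewrite integral_cst// mul1e /k' mulrA divfK ?pnatr_eq0 ?lt0n_neq0//.
Qed.

End star.
End power_of_integral.

(** * Sums of correlations over the levels *)

Section geometric_bounds.
Context {R : realType}.

Lemma sum_seq_le (T : eqType) (ss : seq T) (f : T -> R) (c : R) :
  (forall s, s \in ss -> f s <= c) -> \sum_(s <- ss) f s <= c * (size ss)%:R.
Proof.
move=> fc; rewrite mulr_natr -[X in c *+ X](count_predT ss) -iter_addr_0.
rewrite -big_const_seq big_seq [leRHS]big_seq; exact: ler_sum.
Qed.

Lemma geometric_sum_le (x : R) N : 0 <= x < 1 ->
  \sum_(i < N) x ^+ i <= (1 - x)^-1.
Proof.
move=> /andP[x0 x1]; have x1' : 0 < 1 - x by rewrite subr_gt0.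
rewrite -[leRHS]mul1r ler_pdivlMr// mulrC.
have := subrX1 x N; rewrite -[x ^+ N - 1]opprB -[x - 1]opprB mulNr.
by move=> /oppr_inj <-; rewrite gerBl exprn_ge0.
Qed.

Lemma geometric_sum_rev_le (x : R) m : 0 <= x < 1 ->
  \sum_(j < m) x ^+ (m - j) <= (1 - x)^-1.
Proof.
move=> x01; apply: le_trans (geometric_sum_le m x01).
rewrite (reindex_inj rev_ord_inj)/=; apply: ler_sum => i _.
have /andP[x0 x1] := x01.
by rewrite subKn// exprS ler_piMl ?exprn_ge0// ltW.
Qed.

End geometric_bounds.

Section level_counting.
Context {R : realType}.
Variables (b al Cl : R) (rho : R -> R -> R).
Hypotheses (b1 : 1 < b) (al0 : 0 < al) (Cl0 : 0 <= Cl).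
Hypothesis rho1 : forall s u, 0 <= s -> 0 <= u -> rho s u <= 1.
Hypothesis rho_large : forall s u, 0 <= s -> 0 <= u -> s != u ->
  rho s u <= Cl * `|s - u| `^ (- al).

Let b0 : 0 < b. Proof. exact: lt_trans b1. Qed.

(** At the levels where the rescaled points are less than 1 apart the
    correlation is only bounded by 1; the remaining levels contribute a convergent
    geometric series. *)
Lemma correlation_sum_le m N s u : 0 <= s -> 0 <= u -> `|s - u| * b ^+ m <= 1 ->
  exists2 i0, (i0 <= N)%N & `|s - u| * b ^+ (m + i0) <= b /\
  \sum_(i < N) rho (s * b ^+ (m + i)) (u * b ^+ (m + i)) <=
    i0%:R + Cl * (1 - b `^ (- al))^-1.
Proof.
move=> s0 u0 tau1; set tau := _ * _ in tau1.
(* The alternative [N <= i] makes the least such index exist also when the points coincide and are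
   never far apart. *)
pose far i := (N <= i)%N || (1 < tau * b ^+ i).
have exfar : exists i, far i by exists N; rewrite /far leqnn.
have [i0 far0 min0] := ex_minnP exfar.
have i0N : (i0 <= N)%N by apply: min0; rewrite /far leqnn.
have y01 : 0 <= b `^ (- al) < 1.
  rewrite powR_ge0/= powRN invf_lt1 ?powR_gt0//.
  have := gt0_ltr_powR al0 _ _ b1; rewrite !nnegrE powR1; apply=> //; exact: ltW.
exists i0 => //; split.
  (* Minimality of [i0] says that the points are within distance 1 one level earlier, hence within
     [b] at level [i0]; for [i0 = 0] the assumption [tau1] is used instead. *)
  rewrite exprD mulrA -/tau; case: i0 far0 min0 i0N => [|i] _ min0 _.
    by rewrite expr0 mulr1 (le_trans tau1)// ltW.
  have : ~~ far i by apply/negP => /min0; rewrite ltnn.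
  rewrite /far negb_or => /andP[_]; rewrite -leNgt => h.
  by rewrite exprSr mulrA ler_piMl// ltW.
rewrite -(big_mkord xpredT (fun i => rho (s * b ^+ (m + i)) (u * b ^+ (m + i)))).
rewrite (big_cat_nat (leq0n i0) i0N)/=; apply: lerD.
  rewrite big_mkord -[X in _ <= X%:R](card_ord i0) -sumr_const.
  by apply: ler_sum => i _; rewrite rho1// mulr_ge0 ?exprn_ge0// ltW.
apply: (@le_trans _ _ (Cl * \sum_(i < N - i0) (b `^ (- al)) ^+ i)); last first.
  by rewrite ler_wpM2l// geometric_sum_le.
rewrite -{1}(add0n i0) big_addn big_mkord mulr_sumr; apply: ler_sum => i _.
(* The index [i] ranges below [N - i0], so [i0 < N] and [far0] can only hold through the
   distance. *)
have {far0} : 1 < tau * b ^+ i0.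
  move: far0; rewrite /far => /orP[Ni|//].
  have := ltn_ord i; rewrite [X in (_ < X)%N](_ : _ = 0)%N//.
  by apply/eqP; rewrite subn_eq0.
move=> far0.
have d : `|s * b ^+ (m + (i + i0)) - u * b ^+ (m + (i + i0))| = tau * b ^+ i0 * b ^+ i.
  rewrite -mulrBl normrM [`|b ^+ _|]ger0_norm ?exprn_ge0 ?ltW// /tau.
  by rewrite !exprD; ring.
have bi : 0 < b ^+ i by rewrite exprn_gt0.
have tb : 0 < tau * b ^+ i0 by exact: lt_trans far0.
have su : s * b ^+ (m + (i + i0)) != u * b ^+ (m + (i + i0)).
  by rewrite -subr_eq0 -normr_eq0 d gt_eqF// mulr_gt0.
apply: le_trans (rho_large _ _ su) _; rewrite ?mulr_ge0 ?exprn_ge0 ?(ltW b0)//.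
have -> : (b `^ (- al)) ^+ i = (b ^+ i) `^ (- al).
  by rewrite -powR_mulrn ?powR_ge0// -powRrM mulrC powRrM powR_mulrn// ltW.
have dgt0 := mulr_gt0 tb bi.
rewrite ler_wpM2l// d !powRN lef_pV2 ?posrE ?powR_gt0//.
apply: ge0_ler_powR; rewrite ?nnegrE ?(ltW al0) ?(ltW bi)//.
  by rewrite mulr_ge0 ?(ltW tb) ?(ltW bi).
by rewrite ler_peMl ?(ltW bi)// ltW.
Qed.

(** Of order [lam ^+ i] at distance [b ^- (m + i)]: the size of the exponential of a
    sum of [i] correlations, when each of them is only bounded by 1. *)
Definition level_kernel (lam : R) m N (x y : R) : R :=
  \sum_(i < N.+1) lam ^+ i * \1_[set z : R | `|x - z| * b ^+ (m + i) <= b] y.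

Lemma level_kernel_ge0 lam m N x y : 0 <= lam -> 0 <= level_kernel lam m N x y.
Proof. by move=> l0; apply: sumr_ge0 => i _; rewrite mulr_ge0 ?exprn_ge0. Qed.

(** Only the summand of index [i0] from [correlation_sum_le] is kept. Since [i0 = N] may occur, the
    kernel has [N + 1] summands. *)
Lemma level_kernel_ge kap m N s u : 0 <= kap -> 0 <= s -> 0 <= u ->
  `|s - u| * b ^+ m <= 1 ->
  expR (kap * \sum_(i < N) rho (s * b ^+ (m + i)) (u * b ^+ (m + i))) <=
  expR (kap * (Cl * (1 - b `^ (- al))^-1)) * level_kernel (expR kap) m N s u.
Proof.
move=> kap0 s0 u0 tau1.
have [i0 i0N [h1 h2]] := correlation_sum_le N s0 u0 tau1.
apply: (@le_trans _ _ (expR (kap * (i0%:R + Cl * (1 - b `^ (- al))^-1)))).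
  by rewrite ler_expR ler_wpM2l.
rewrite mulrDr expRD mulrC ler_wpM2l ?expR_ge0//.
have i0N' : (i0 < N.+1)%N by [].
rewrite /level_kernel (bigD1 (Ordinal i0N'))//= indicE mem_set// mulr1.
rewrite mulrC expRM_natl -[leLHS]addr0 lerD// sumr_ge0//.
Qed.

Lemma measurable_level_kernel lam m N :
  measurable_fun setT (fun p : R * R => level_kernel lam m N p.1 p.2).
Proof.
apply: measurable_sum => i; apply: measurable_funM => //.
pose A := [set p : R * R | `|p.1 - p.2| * b ^+ (m + i) <= b].
rewrite (_ : (fun _ => _) = \1_A); last by apply/funext => -[x y].
apply: measurable_indic.
have /(_ measurableT [set true]) : measurable_fun setT
    (fun p : R * R => `|p.1 - p.2| * b ^+ (m + i) <= b).
  apply: measurable_fun_ler => //; apply: measurable_funM => //.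
  by apply: measurableT_comp => //; apply: measurable_funB.
by rewrite setTI; exact.
Qed.

(** The set at index [i] is an interval of length 2 b / b^(m+i), so the sum is dominated by a
    geometric series of ratio [lam / b]. In the application [lam] is exp(p v / 2), and [lam < b] is
    the assumed lower bound on [b]. *)
Lemma integral_level_kernel_le lam m N x (D : set R) : measurable D ->
  0 <= lam < b ->
  (\int[lebesgue_measure]_(y in D) (level_kernel lam m N x y)%:E <=
  (2 * b * (1 - lam / b)^-1 * (b ^+ m)^-1)%:E)%E.
Proof.
move=> mD /andP[lam0 lamb].
have lb : 0 <= lam / b < 1.
  by rewrite divr_ge0 ?(ltW b0)//= ltr_pdivrMr// mul1r.
have mA i : measurable [set z : R | `|x - z| * b ^+ (m + i) <= b].
  have /(_ measurableT [set true]) : measurable_fun setT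
      (fun z : R => `|x - z| * b ^+ (m + i) <= b).
    apply: measurable_fun_ler => //; apply: measurable_funM => //.
    by apply: measurableT_comp => //; apply: measurable_funB.
  by rewrite setTI; exact.
have mi i : measurable_fun D
    (fun z => (\1_[set z : R | `|x - z| * b ^+ (m + i) <= b] z : R)%:E).
  by apply/measurable_EFinP/measurable_funTS/measurable_indic.
under eq_integral do rewrite -sumEFin.
rewrite ge0_integral_sum//; last 2 first.
- move=> i; under eq_fun do rewrite EFinM.
  by apply: emeasurable_funM => //; exact: mi.
- by move=> i y _; rewrite lee_fin mulr_ge0 ?exprn_ge0.
apply: (@le_trans _ _
    (\sum_(i < N.+1) (2 * b * (b ^+ m)^-1 * (lam / b) ^+ i)%:E)%E).
  apply: lee_sum => i _; under eq_integral do rewrite EFinM.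
  rewrite ge0_integralZl ?lee_fin ?exprn_ge0//; last first.
    exact: mi.
  rewrite integral_indic//; last exact: mA.
  have bmi : 0 < b ^+ (m + i) by rewrite exprn_gt0.
  pose r := b / b ^+ (m + i).
  have r0 : 0 <= r by rewrite divr_ge0 ?ltW.
  apply: (@le_trans _ _ ((lam ^+ i)%:E * (2 * r)%:E)%E).
    rewrite lee_wpmul2l ?lee_fin ?exprn_ge0//.
    apply: (@le_trans _ _ (lebesgue_measure (`[x - r, x + r] : set R))).
      apply: le_measure; [rewrite inE; apply: measurableI => //; exact: mA|exact: mem_set|].
      move=> y [yA _]; have : `|x - y| * b ^+ (m + i) <= b := yA.
      rewrite -(ler_pdivlMr _ _ bmi) -/r /= in_itv/= ler_norml.
      by move=> /andP[? ?]; apply/andP; split; lra.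
    rewrite lebesgue_measure_itv/=; case: ifPn => _; rewrite -?EFinB lee_fin; lra.
  rewrite -EFinM lee_fin /r exprD expr_div_n le_eqVlt; apply/orP; left; apply/eqP.
  by field; rewrite ?expf_neq0 ?gt_eqF.
rewrite sumEFin lee_fin -mulr_sumr [leRHS]mulrAC; apply: ler_wpM2l.
  by rewrite !mulr_ge0 ?invr_ge0 ?exprn_ge0 ?(ltW b0).
exact: geometric_sum_le.
Qed.

End level_counting.

(** * Joint moments of lognormal layers *)

Section lognormal_products.
Context d (Omega : measurableType d) (R : realType) (P : probability Omega R).
Implicit Types (L : seq (R * R)).

Definition power_product (Y : R -> Omega -> R) L (w : Omega) : R :=
  \prod_(x <- L) Y x.1 w `^ x.2.

(** Log-expectation of [prod_(x <- L) exp(X x.1 - v / 2) ^ x.2] for a centered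
    Gaussian [X] of variance [v] and correlation [rho]. *)
Definition lognormal_exponent (rho : R -> R -> R) (v : R) L : R :=
  v / 2 * (\sum_(x <- L) \sum_(y <- L) x.2 * y.2 * rho x.1 y.1 -
           \sum_(x <- L) x.2).

(** The exponent encodes the lognormal law inside a layer and the product over [j] the independence
    between layers. A layer with an empty list contributes the factor 1, so levels can be left out
    freely. *)
Definition lognormal_family (Y : nat -> R -> Omega -> R) rho v :=
  forall n (L : nat -> seq (R * R)), (forall j x, x \in L j -> 0 <= x.1) ->
  (\int[P]_w (\prod_(j < n) power_product (Y j) (L j) w)%:E =
   (\prod_(j < n) expR (lognormal_exponent rho v (L j)))%:E)%E.

End lognormal_products.

(** * Completeness of L_k along sequences with controlled increments *)

Section power_completeness.
Context d (Omega : measurableType d) (R : realType) (P : probability Omega R).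
Variables (f : nat -> Omega -> R) (k N : nat) (e : nat -> R) (B : R).
Hypothesis k1 : (1 <= k)%N.
Hypothesis mf : forall n, measurable_fun setT (f n).
Hypothesis f0 : forall n w, 0 <= f n w.
Hypothesis f_gap : forall n n', (N <= n)%N -> (n <= n')%N ->
  (\int[P]_w (`|f n' w - f n w| ^+ k)%:E <= (e n' - e n)%:E)%E.
Hypothesis e_bound : forall n, (N <= n)%N -> e n <= B.

(* Since [e] is nondecreasing and bounded the sequence is Cauchy in [L^k]; the limit
   is taken along an a.s. convergent subsequence, and Fatou's lemma gives the rate. *)
Let e_homo n n' : (N <= n)%N -> (n <= n')%N -> e n <= e n'.
Proof.
move=> Nn nn'; rewrite -subr_ge0 -lee_fin; apply: le_trans (f_gap Nn nn').
by apply: integral_ge0 => w _; rewrite lee_fin exprn_ge0.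
Qed.

Let e_cauchy eps : 0 < eps -> exists n0, (N <= n0)%N /\
  forall n n', (n0 <= n)%N -> (n <= n')%N -> e n' - e n <= eps.
Proof.
move=> eps0; pose S := [set e n | n in [set n | (N <= n)%N]].
have hS : has_sup S.
  split; first by exists (e N), N => /=.
  by exists B => _ [n /= Nn <-]; exact: e_bound.
have [_ [n0 /= Nn0 <-] en0] := sup_adherent eps0 hS.
exists n0; split=> // n n' n0n nn'.
have h1 : e n' <= sup S.
  by apply: ub_le_sup; [case: hS|exists n' => //=; exact: leq_trans (leq_trans Nn0 n0n) nn'].
have h2 := e_homo Nn0 n0n.
lra.
Qed.

Let half i : R := 2^-1 ^+ i.
Let half0 i : 0 < half i. Proof. by rewrite exprn_gt0// invr_gt0. Qed.

Let idx_spec : {idx : nat -> nat | forall i, (N + i <= idx i)%N /\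
  forall n n', (idx i <= n)%N -> (n <= n')%N -> e n' - e n <= half i ^+ k}.
Proof.
have /choice[idx H] : forall i, exists n0, (N + i <= n0)%N /\
    forall n n', (n0 <= n)%N -> (n <= n')%N -> e n' - e n <= half i ^+ k.
  move=> i; have [|n0 [Nn0 h]] := @e_cauchy (half i ^+ k); first by rewrite exprn_gt0.
  exists (n0 + i)%N; split=> [|n n' n0n]; first by rewrite leq_add2r.
  by apply: h; exact: leq_trans (leq_addr _ _) n0n.
by exists idx.
Qed.

Let idx := sval idx_spec.
(** The chosen indices need not be ordered; their running maxima are, as [f_gap] requires of its two
    indices. *)
Let m i := (\max_(j < i.+1) idx j)%N.

Let idx_m i : (idx i <= m i)%N.
Proof. exact: (leq_bigmax (ord_max : 'I_i.+1)). Qed.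

Let m_homo i : (m i <= m i.+1)%N.
Proof. by rewrite /m [leqRHS]big_ord_recr/= leq_maxl. Qed.

Let Ni_m i : (N + i <= m i)%N.
Proof. by apply: leq_trans (idx_m i); case: (svalP idx_spec i). Qed.

Let N_m i : (N <= m i)%N.
Proof. exact: leq_trans (leq_addr _ _) (Ni_m i). Qed.

Let gap_m i n n' : (m i <= n)%N -> (n <= n')%N -> e n' - e n <= half i ^+ k.
Proof.
move=> mn nn'; have [_ h] := svalP idx_spec i.
by apply: h => //; exact: leq_trans mn; exact: idx_m.
Qed.

Let g i := f (m i).
Let D i w : R := g i.+1 w - g i w.

Let mD i : measurable_fun setT (D i).
Proof. by apply: measurable_funB; exact: mf. Qed.

(** With h = [half i], the pointwise bound |D| <= h + h^(1-k) |D|^k replaces Hölder's inequality;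
    each term contributes at most h because the k-th moment of [D i] is at most h^k. *)
Let intD i : (\int[P]_w (`|D i w|)%:E <= (2 * half i)%:E)%E.
Proof.
have hi : half i ^+ k.-1 != 0 by rewrite expf_neq0// gt_eqF.
have hi0 : 0 < half i ^+ k.-1 by rewrite exprn_gt0.
apply: (@le_trans _ _ (\int[P]_w ((half i)%:E +
    ((half i ^+ k.-1)^-1)%:E * (`|D i w| ^+ k)%:E))%E).
  apply: ge0_le_int => w _; rewrite ?lee_fin//.
  have [h|h] := leP `|D i w| (half i).
    by rewrite -[leLHS]addr0 lerD// mulr_ge0 ?invr_ge0 ?exprn_ge0// ltW.
  rewrite -[leLHS]add0r lerD ?(ltW (half0 i))// mulrC ler_pdivlMr//.
  have -> : `|D i w| ^+ k = `|D i w| * `|D i w| ^+ k.-1 by rewrite -exprS prednK.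
  rewrite ler_wpM2l// lerXn2r ?nnegrE ?(ltW h)//.
  exact: ltW.
have mk : measurable_fun setT (fun w => (`|D i w| ^+ k)%:E).
  by apply/measurable_EFinP; apply: measurable_funX; apply: measurableT_comp.
have k0 w : setT w -> (0 <= (`|D i w| ^+ k)%:E)%E.
  by move=> _; rewrite lee_fin exprn_ge0.
have c0 : (0 <= ((half i ^+ k.-1)^-1)%:E)%E by rewrite lee_fin invr_ge0 ltW.
rewrite ge0_integralD//; last 3 first.
- by move=> w _; rewrite lee_fin ltW.
- by move=> w _; rewrite mule_ge0 ?k0.
- exact: emeasurable_funM.
rewrite ge0_integralZl// integral_cst//= probability_setT mule1.
rewrite mulr_natl mulr2n EFinD leeD2l//.
apply: (@le_trans _ _ (((half i ^+ k.-1)^-1)%:E * (half i ^+ k)%:E)%E).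
  rewrite lee_wpmul2l ?lee_fin ?invr_ge0 ?exprn_ge0 ?(ltW (half0 _))//.
  apply: le_trans (f_gap (N_m i) (m_homo i)) _; rewrite lee_fin; exact: gap_m.
have -> : half i ^+ k = half i * half i ^+ k.-1 by rewrite -exprS prednK.
by rewrite -EFinM mulrCA mulVf// mulr1.
Qed.

Let S w : \bar R := (\sum_(i <oo) (`|D i w|)%:E)%E.

Let mnD i : measurable_fun setT (fun w => (`|D i w|)%:E).
Proof. by apply/measurable_EFinP; apply: measurableT_comp. Qed.

Let mS : measurable_fun setT S.
Proof. by apply: ge0_emeasurable_sum => // i w _ _; rewrite lee_fin. Qed.

Let S0 w : (0 <= S w)%E.
Proof. by apply: nneseries_ge0 => i _ _; rewrite lee_fin. Qed.

Let intS : (\int[P]_w S w < +oo)%E.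
Proof.
rewrite /S integral_nneseries//.
apply: (@le_lt_trans _ _ (\sum_(i <oo) (2 * half i)%:E)%E).
  by apply: lee_nneseries => [i _ _|i _]; [apply: integral_ge0 => w _; rewrite lee_fin|exact: intD].
apply: (@le_lt_trans _ _ 4%:E); last exact: ltry.
apply: lime_le; first by apply: is_cvg_nneseries => i _ _; rewrite lee_fin mulr_ge0// ltW.
apply: nearW => n; rewrite sumEFin lee_fin big_mkord -mulr_sumr.
have -> : 4 = 2 * (1 - 2^-1)^-1 :> R by field.
by rewrite ler_wpM2l// geometric_sum_le//; apply/andP; split; lra.
Qed.

Let Cv : set Omega := S @^-1` [set x | x \is a fin_num].

Let mCv : measurable Cv.
Proof.
by have := emeasurable_fin_num measurableT mS; rewrite setTI.
Qed.

Let CvC0 : P (~` Cv) = 0%E.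
Proof.
have : P.-integrable setT S.
  apply/integrableP; split=> //; under eq_integral do rewrite gee0_abs//.
  exact: intS.
move=> /integrable_ae -/(_ measurableT) [N' [mN' PN' h]].
apply/eqP; rewrite eq_le measure_ge0 andbT -PN' le_measure ?inE//.
  exact: measurableC.
by move=> w nw; apply: h => /= H; apply: nw; exact: H.
Qed.

(** The upper limit always exists and is measurable; [fine] and the absolute value make it a
    nonnegative real also off the convergence set, so no modification on a null set is required. *)
Definition power_limit w : R := `|fine (limn_esup (fun i => (g i w)%:E))|.

Lemma measurable_power_limit : measurable_fun setT power_limit.
Proof.
apply: measurableT_comp => //; apply: measurableT_comp; first exact: fine_measurable.
by apply: measurable_fun_limn_esup => i; apply/measurable_EFinP; exact: mf.
Qed.

Let cvg_g w : Cv w -> g i w @[i --> \oo] --> power_limit w.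
Proof.
move=> Cw.
have cn : cvgn (series (fun i => `|D i w|)).
  apply: nondecreasing_is_cvgn.
    by apply: nondecreasing_series => i _.
  exists (fine (S w)) => _ [n _ <-].
  rewrite -lee_fin fineK// /series/= -sumEFin /S.
  by apply: nneseries_lim_ge => i _ _; rewrite lee_fin.
have cs : cvgn (series (fun i => D i w)) by exact: normed_cvg.
have cg : cvgn (fun i => g i w).
  have -> : (fun i => g i w) = (fun i => g 0%N w + series (fun i => D i w) i).
    by apply/funext => i; rewrite (eq_sum_telescope (fun i => g i w) i).
  by apply: is_cvgD => //; exact: is_cvg_cst.
have l0 : 0 <= limn (fun i => g i w) by apply: limr_ge => //; apply: nearW => i; exact: f0.
suff -> : power_limit w = limn (fun i => g i w) by [].
have ce : (g i w)%:E @[i --> \oo] --> (limn (fun i => g i w))%:E by apply: cvg_EFin => //; exact: nearW.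
by rewrite /power_limit (cvg_limn_einf_sup ce).2/= ger0_norm.
Qed.

Lemma power_limit_cvg eps : 0 < eps -> exists n0, forall n, (n0 <= n)%N ->
  (\int[P]_w (`|f n w - power_limit w| ^+ k)%:E <= eps%:E)%E.
Proof.
move=> eps0; have [n0 [Nn0 h]] := e_cauchy eps0.
exists n0 => n n0n.
have Nn : (N <= n)%N by exact: leq_trans n0n.
have mfA : measurable_fun setT (fun w => (`|f n w - power_limit w| ^+ k)%:E).
  apply/measurable_EFinP; apply: measurable_funX; apply: measurableT_comp => //.
  by apply: measurable_funB => //; exact: measurable_power_limit.
rewrite (@ge0_negligible_integral _ _ _ P setT (~` Cv))//; first last.
- exact: measurableC.
rewrite setTD setCK.
(* The shift by [n] ensures [n <= m (i + n)], so that the gap estimate applies to every term of the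
   sequence given to Fatou's lemma. *)
pose u i w : \bar R := (`|f n w - g (i + n) w| ^+ k)%:E.
have mu i : measurable_fun Cv (u i).
  apply/measurable_EFinP; apply: measurable_funTS; apply: measurable_funX.
  by apply: measurableT_comp => //; apply: measurable_funB; exact: mf.
have u0 i w : Cv w -> (0 <= u i w)%E by move=> _; rewrite lee_fin exprn_ge0.
apply: le_trans (le_trans (fatou P mCv mu u0) _).
  apply: ge0_le_int => w Cw; first by rewrite lee_fin exprn_ge0.
  have cu : u i w @[i --> \oo] --> (`|f n w - power_limit w| ^+ k)%:E.
    apply: cvg_EFin; first exact: nearW.
    apply: (cvg_comp _ (fun x : R => x ^+ k)); last exact: exprn_continuous.
    apply: cvg_norm; apply: cvgB; first exact: cvg_cst.
    by have := cvg_g Cw; rewrite -(cvg_shiftn n).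
  by rewrite (cvg_limn_einf_sup cu).1.
rewrite limn_einf_lim; apply: lime_le; first exact: is_cvg_einfs.
apply: nearW => i; apply: (@le_trans _ _ (\int[P]_(w in Cv) u i w)%E).
  by apply: ereal_inf_lbound; exists i => /=.
apply: (@le_trans _ _ (\int[P]_w u i w)%E).
  apply: ge0_subset_integral => //.
  - apply/measurable_EFinP; apply: measurable_funX.
    by apply: measurableT_comp => //; apply: measurable_funB; exact: mf.
  - by move=> w _; rewrite lee_fin exprn_ge0.
have nm : (n <= m (i + n))%N.
  by apply: leq_trans (Ni_m _); rewrite addnA leq_addl.
rewrite /u; under eq_integral do rewrite distrC.
by apply: le_trans (f_gap Nn nm) _; rewrite lee_fin h.
Qed.

End power_completeness.

Section nonneg_real_integrals.
Context d (T : measurableType d) (R : realType) (m : {measure set T -> \bar R}).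
Implicit Types f g : T -> R.

Lemma ge0_int_le f g : (forall w, 0 <= f w <= g w) ->
  (\int[m]_w (f w)%:E <= \int[m]_w (g w)%:E)%E.
Proof. by move=> fg; apply: ge0_le_int => w _; rewrite lee_fin; case/andP: (fg w). Qed.

Lemma ge0_int_add f g : measurable_fun setT f -> (forall w, 0 <= f w) ->
  measurable_fun setT g -> (forall w, 0 <= g w) ->
  (\int[m]_w (f w + g w)%:E = \int[m]_w (f w)%:E + \int[m]_w (g w)%:E)%E.
Proof.
move=> mf f0 mg g0; under eq_integral do rewrite EFinD.
by apply: ge0_integralD => //; [move=> w _; rewrite lee_fin|exact/measurable_EFinP|
  move=> w _; rewrite lee_fin|exact/measurable_EFinP].
Qed.

Lemma ge0_int_scale c f : 0 <= c -> measurable_fun setT f -> (forall w, 0 <= f w) ->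
  (\int[m]_w (c * f w)%:E = c%:E * \int[m]_w (f w)%:E)%E.
Proof.
move=> c0 mf f0; under eq_integral do rewrite EFinM.
have f0' w : setT w -> (0 <= (f w)%:E)%E by rewrite lee_fin.
have mf' : measurable_fun setT (fun w => (f w)%:E) by exact/measurable_EFinP.
by rewrite ge0_integralZl.
Qed.

End nonneg_real_integrals.

(** * Lognormal cascades *)

Section cascade_moments.
Context d (Omega : measurableType d) (R : realType) (P : probability Omega R).
Variables (Y : nat -> R -> Omega -> R) (rho : R -> R -> R).
Variables (v b al Cl a0 Cs : R) (k : nat).
Hypothesis mY : forall j, measurable_fun setT (fun p : R * Omega => Y j p.1 p.2).
Hypothesis Y_gt0 : forall j s w, 0 < Y j s w.
Hypothesis Y_lognormal : lognormal_family P Y rho v.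
Hypotheses (v0 : 0 < v) (b1 : 1 < b) (al0 : 0 < al) (a00 : 0 < a0).
Hypotheses (Cl0 : 0 <= Cl) (Cs0 : 0 <= Cs).
Hypothesis b_large : expR (k%:R * v / 2) < b.
Hypothesis rho1 : forall s u, 0 <= s -> 0 <= u -> rho s u <= 1.
Hypothesis rho_refl : forall s, 0 <= s -> rho s s = 1.
Hypothesis rho_sym : forall s u, rho s u = rho u s.
Hypothesis rho_small : forall s, 0 <= s <= 1 -> 1 - rho 0 s <= Cs * s `^ a0.
Hypothesis rho_large : forall s u, 0 <= s -> 0 <= u -> s != u ->
  rho s u <= Cl * `|s - u| `^ (- al).

Implicit Types (s t r q : R) (w : Omega) (ss : seq R) (n m j : nat).

Let mu := @lebesgue_measure R.
Let b0 : 0 < b. Proof. exact: lt_trans b1. Qed.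
Let bX j : 0 < b ^+ j. Proof. by rewrite exprn_gt0. Qed.

Definition cascade n s w : R := \prod_(j < n.+1) Y j (s * b ^+ j) w.
Definition coarse_power (r : R) m w : R := \prod_(j < m) Y j 0 w `^ r.
Definition cascade_integral n t w : \bar R :=
  (\int[mu]_(s in `[0%R, t]) (cascade n s w)%:E)%E.

Lemma measurable_cascade n :
  measurable_fun setT (fun p : R * Omega => cascade n p.1 p.2).
Proof.
apply: measurable_prod => j _.
pose g (p : R * Omega) : R * Omega := (p.1 * b ^+ j, p.2).
have mg : measurable_fun setT g.
  by apply: measurable_fun_pair => //; apply: measurable_funM.
exact: (measurableT_comp (mY j) mg).
Qed.

Lemma measurable_process_at j s : measurable_fun setT (Y j s).
Proof. exact: (measurable_fun_pair2 (f := fun p : R * Omega => Y j p.1 p.2)). Qed.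

Lemma measurable_cascade_at n s : measurable_fun setT (cascade n s).
Proof.
by apply: measurable_prod => j _; exact: measurable_process_at.
Qed.

Lemma cascade_gt0 n s w : 0 < cascade n s w.
Proof. exact: prodr_gt0. Qed.

Let cascade_ge0 n s w : 0 <= cascade n s w.
Proof. exact/ltW/cascade_gt0. Qed.

Lemma measurable_coarse_power r m : measurable_fun setT (coarse_power r m).
Proof.
apply: measurable_prod => j _.
apply: (measurableT_comp (measurable_powR r)); exact: measurable_process_at.
Qed.

Lemma coarse_power_gt0 r m w : 0 < coarse_power r m w.
Proof. by apply: prodr_gt0 => j _; rewrite powR_gt0. Qed.

Lemma coarse_powerD r r' m w :
  coarse_power (r + r') m w = coarse_power r m w * coarse_power r' m w.
Proof.
rewrite -big_split; apply: eq_bigr => j _.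
by rewrite powRD// (gt_eqF (Y_gt0 _ _ _)) implybT.
Qed.

Lemma coarse_powerX q m w : coarse_power 1 m w `^ q = coarse_power q m w.
Proof.
rewrite /coarse_power; elim: m => [|m IH]; first by rewrite !big_ord0 powR1.
rewrite !big_ord_recr/= powRM ?IH ?powR_ge0//; last exact/ltW/coarse_power_gt0.
by rewrite powRr1// ltW.
Qed.

Definition unit_powers j (ss : seq R) : seq (R * R) :=
  [seq (s * b ^+ j, 1) | s <- ss].

Lemma cascade_prod_power_product n (L0 : nat -> seq (R * R)) ss w :
  (\prod_(j < n.+1) power_product (Y j) (L0 j) w) * \prod_(s <- ss) cascade n s w =
  \prod_(j < n.+1) power_product (Y j) (L0 j ++ unit_powers j ss) w.
Proof.
rewrite exchange_big/= -big_split/=; apply: eq_bigr => j _.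
rewrite /power_product big_cat/= big_map/=; congr *%R.
by apply: eq_bigr => s _; rewrite powRr1// ltW.
Qed.

Lemma coarse_power_product r m n w : (m <= n)%N ->
  coarse_power r m w = \prod_(j < n)
    power_product (Y j) (if (j < m)%N then [:: (0, r)] else [::]) w.
Proof.
move=> mn; rewrite /coarse_power.
rewrite (big_ord_widen n (fun j => Y j 0 w `^ r))// big_mkcond.
by apply: eq_bigr => j _; rewrite /power_product; case: ifP; rewrite ?big_seq1 ?big_nil.
Qed.

Let pair_sum j (ss : seq R) : R :=
  \sum_(s <- ss) \sum_(u <- ss) rho (s * b ^+ j) (u * b ^+ j).

Lemma lognormal_exponent_unit j ss :
  lognormal_exponent rho v (unit_powers j ss) = v / 2 * (pair_sum j ss - (size ss)%:R).
Proof.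
rewrite /lognormal_exponent /unit_powers !big_map/=; congr (_ * (_ - _)).
  by apply: eq_bigr => s _; rewrite big_map; apply: eq_bigr => u _; rewrite !mul1r.
by rewrite big_const_seq count_predT iter_addr_0.
Qed.

Lemma lognormal_exponent_cons j r ss :
  lognormal_exponent rho v ((0, r) :: unit_powers j ss) =
  v / 2 * (r ^+ 2 + 2 * r * (\sum_(s <- ss) rho 0 (s * b ^+ j)) + pair_sum j ss
           - (r + (size ss)%:R)).
Proof.
set U := unit_powers j ss; set S := \sum_(s <- ss) rho 0 (s * b ^+ j).
have S1 (c : R) : \sum_(y <- U) c * y.2 * rho 0 y.1 = c * S.
  by rewrite big_map mulr_sumr; apply: eq_bigr => s _; rewrite mulr1.
have S2 (c : R) : \sum_(x <- U) x.2 * c * rho x.1 0 = c * S.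
  by rewrite big_map mulr_sumr; apply: eq_bigr => s _; rewrite mul1r rho_sym.
have := lognormal_exponent_unit j ss; rewrite /lognormal_exponent -/U.
move=> /mulfI; rewrite mulf_neq0 ?invr_eq0 ?gt_eqF// => /(_ isT) HU.
have HU2 : \sum_(x <- U) x.2 = (size ss)%:R.
  by rewrite big_map big_const_seq count_predT iter_addr_0.
have S3 : \sum_(x <- U) \sum_(y <- (0, r) :: U) x.2 * y.2 * rho x.1 y.1 =
    r * S + \sum_(x <- U) \sum_(y <- U) x.2 * y.2 * rho x.1 y.1.
  rewrite -S2 -big_split; apply: eq_bigr => x _; exact: big_cons.
rewrite HU2 in HU; rewrite big_cons S3 big_cons [X in _ - X]big_cons/= HU2 S1.
by move/addIr: HU => ->; rewrite rho_refl//; congr (_ * _); ring.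
Qed.

Let unit_powers_ge0 j ss x : (forall s, s \in ss -> 0 <= s) ->
  x \in unit_powers j ss -> 0 <= x.1.
Proof.
by move=> ss0 /mapP[s /ss0 s0 ->]/=; rewrite mulr_ge0// ltW.
Qed.

Lemma expectation_coarse_cascade r m n ss : (m <= n.+1)%N ->
  (forall s, s \in ss -> 0 <= s) ->
  (\int[P]_w (coarse_power r m w * \prod_(s <- ss) cascade n s w)%:E =
   (\prod_(j < n.+1) expR (lognormal_exponent rho v
     ((if (j < m)%N then [:: (0%R, r)] else [::]) ++ unit_powers j ss)))%:E)%E.
Proof.
move=> mn ss0.
pose L0 j : seq (R * R) := if (j < m)%N then [:: (0, r)] else [::].
under eq_integral do rewrite (coarse_power_product r _ mn) (cascade_prod_power_product n L0).
apply: (Y_lognormal n.+1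
  (L := fun j => (if (j < m)%N then [:: (0, r)] else [::]) ++ unit_powers j ss)).
move=> j x; rewrite mem_cat => /orP[|]; last exact: unit_powers_ge0.
by case: ifP => _ //; rewrite inE => /eqP ->.
Qed.

Lemma expectation_coarse_cascade1 r m n s : (m <= n.+1)%N -> 0 <= s ->
  (\int[P]_w (coarse_power r m w * cascade n s w)%:E =
   (\prod_(j < n.+1) expR (lognormal_exponent rho v
     ((if (j < m)%N then [:: (0%R, r)] else [::]) ++ unit_powers j [:: s])))%:E)%E.
Proof.
move=> mn s0; rewrite -expectation_coarse_cascade//; last first.
  by move=> u; rewrite inE => /eqP ->.
by apply: eq_integral => w _; rewrite big_seq1.
Qed.

Lemma expectation_coarse_power r m : (\int[P]_w (coarse_power r m w)%:E =
   (expR (v / 2 * (r ^+ 2 - r)) ^+ m)%:E)%E.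
Proof.
have := @expectation_coarse_cascade r m m [::] (leqnSn m).
under eq_integral do rewrite big_nil mulr1.
move=> ->; last by move=> s; rewrite in_nil.
congr EFin; rewrite big_ord_recr/= ltnn /lognormal_exponent !big_nil subrr mulr0 expR0 mulr1.
rewrite (eq_bigr (fun=> expR (v / 2 * (r ^+ 2 - r)))); last first.
  by move=> j _; rewrite ltn_ord/= !big_cons !big_nil/= rho_refl// !addr0 mulr1 expr2.
by rewrite prodr_const card_ord.
Qed.

(** On the levels after [n] only the point [s] occurs, once and with exponent one, and such a factor
    has mean one. *)
Lemma expectation_cascade_later n n' s ss : (n <= n')%N -> 0 <= s ->
  (forall u, u \in ss -> 0 <= u) ->
  (\int[P]_w (cascade n' s w * \prod_(u <- ss) cascade n u w)%:E =
   \int[P]_w (cascade n s w * \prod_(u <- ss) cascade n u w)%:E)%E.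
Proof.
move=> nn' s0 ss0.
have s1 N w : cascade N s w = \prod_(j < N.+1) power_product (Y j) (unit_powers j [:: s]) w.
  by apply: eq_bigr => j _; rewrite /power_product big_seq1/= powRr1// ltW.
pose L j : seq (R * R) := unit_powers j [:: s] ++ if (j < n.+1)%N then unit_powers j ss else [::].
have L0 j x : x \in L j -> 0 <= x.1.
  rewrite mem_cat => /orP[|]; first by apply: unit_powers_ge0 => u; rewrite inE => /eqP ->.
  by case: ifP => // _; apply: unit_powers_ge0.
have E1 w : cascade n s w * \prod_(u <- ss) cascade n u w =
    \prod_(j < n.+1) power_product (Y j) (L j) w.
  rewrite s1 (cascade_prod_power_product n (fun j => unit_powers j [:: s])); apply: eq_bigr => j _.
  by rewrite /L ltn_ord.
have E2 w : cascade n' s w * \prod_(u <- ss) cascade n u w =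
    \prod_(j < n'.+1) power_product (Y j) (L j) w.
  have -> : \prod_(u <- ss) cascade n u w =
      \prod_(j < n'.+1 | (j < n.+1)%N) power_product (Y j) (unit_powers j ss) w.
    rewrite -(big_ord_widen n'.+1 (fun j => power_product (Y j) (unit_powers j ss) w))//.
    have := @cascade_prod_power_product n (fun=> [::]) ss w.
    by rewrite big1 ?mul1r// => j _; rewrite /power_product big_nil.
  rewrite s1 [X in _ * X]big_mkcond -big_split; apply: eq_bigr => j _.
  by rewrite /L /power_product big_cat/=; case: ifP => // _; rewrite big_nil.
under eq_integral do rewrite E2; under [RHS]eq_integral do rewrite E1.
rewrite (Y_lognormal n'.+1 L0) (Y_lognormal n.+1 L0); congr EFin.
rewrite [RHS](big_ord_widen n'.+1 (fun j => expR (lognormal_exponent rho v (L j))))//.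
rewrite [RHS]big_mkcond; apply: eq_bigr => j _; case: ifPn => // jn.
rewrite /L (negbTE jn) cats0 lognormal_exponent_unit /pair_sum !big_seq1.
by rewrite rho_refl ?subrr ?mulr0 ?expR0// mulr_ge0// ltW.
Qed.

(** * Coarse levels [j < m] and fine levels [j >= m] of the segment [0, t] *)

Let xa := b^-1 `^ a0.
Let xa01 : 0 <= xa < 1.
Proof.
rewrite powR_ge0/=; have b1' : b^-1 < 1 by rewrite invf_lt1.
have := gt0_ltr_powR a00 _ _ b1'; rewrite !nnegrE powR1; apply=> //.
by rewrite invr_ge0 ltW.
Qed.

(** At level [j] the rescaled segment has length at most b^-(m-j), so the deviation of the
    correlation from 1 decays geometrically with [m - j], at ratio [xa]. *)
Let coarse_rho j m s t : t * b ^+ m <= 1 -> (j < m)%N -> 0 <= s <= t ->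
  1 - rho 0 (s * b ^+ j) <= Cs * xa ^+ (m - j).
Proof.
move=> tm jm /andP[s0 st].
have sb : s * b ^+ j <= b^-1 ^+ (m - j).
  rewrite exprVn -[leRHS]mul1r ler_pdivlMr// -mulrA -exprD subnKC ?(ltnW jm)//.
  by apply: le_trans tm; rewrite ler_wpM2r// ltW.
have sb0 : 0 <= s * b ^+ j by rewrite mulr_ge0// ltW.
have bi1 : b^-1 ^+ (m - j) <= 1 by rewrite exprn_ile1 ?invr_ge0 ?(ltW b0)// invf_le1 ?ltW.
apply: le_trans (rho_small _) _; first by rewrite sb0 (le_trans sb).
have bi0 : 0 <= b^-1 by rewrite invr_ge0 ltW.
have -> : xa ^+ (m - j) = (b^-1 ^+ (m - j)) `^ a0.
  by rewrite -powR_mulrn ?powR_ge0// -powRrM mulrC powRrM powR_mulrn.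
rewrite ler_wpM2l//; apply: ge0_ler_powR; rewrite ?nnegrE ?(ltW a00)//.
exact: exprn_ge0.
Qed.

(** If all points sat at 0 the list would act as the single entry [(0, r + size ss)], whose exponent
    is the first term. Correlations inside [ss] are bounded by 1, but the cross term has the factor
    [r] of either sign, so its deviation is estimated in absolute value. *)
Let coarse_exponent_le j m t r ss : t * b ^+ m <= 1 -> (j < m)%N ->
  (forall s, s \in ss -> 0 <= s <= t) ->
  lognormal_exponent rho v ((0, r) :: unit_powers j ss) <=
  v / 2 * ((r + (size ss)%:R) ^+ 2 - (r + (size ss)%:R)) +
  v * `|r| * (Cs * xa ^+ (m - j) * (size ss)%:R).
Proof.
move=> tm jm ss0; rewrite lognormal_exponent_cons.
set p := (size ss)%:R; set X := Cs * _ * p.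
have sb0 s : s \in ss -> 0 <= s * b ^+ j.
  by move=> /ss0 /andP[s0 _]; rewrite mulr_ge0// ltW.
have ps : pair_sum j ss <= p ^+ 2.
  rewrite expr2; apply: sum_seq_le => s /sb0 s0; rewrite -[leRHS]mul1r.
  by apply: sum_seq_le => u /sb0 u0; exact: rho1.
set S := \sum_(s <- ss) _.
have SE : p - S = \sum_(s <- ss) (1 - rho 0 (s * b ^+ j)).
  by rewrite sumrB big_const_seq count_predT iter_addr_0.
have S1 : p - S <= X.
  by rewrite SE; apply: sum_seq_le => s /ss0; exact: coarse_rho.
have S0 : 0 <= p - S.
  by rewrite SE big_seq sumr_ge0// => s /sb0 s0; rewrite subr_ge0 rho1.
have rS : r * S <= r * p + `|r| * X.
  rewrite -lerBlDl -mulrBr (le_trans (ler_norm _))// normrM distrC [`|p - S|]ger0_norm//.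
  by rewrite ler_wpM2l.
rewrite -subr_ge0.
have -> : v / 2 * ((r + p) ^+ 2 - (r + p)) + v * `|r| * X -
    v / 2 * (r ^+ 2 + 2 * r * S + pair_sum j ss - (r + p)) =
    v * (r * p + `|r| * X - r * S) + v / 2 * (p ^+ 2 - pair_sum j ss) by field.
by rewrite addr_ge0// mulr_ge0 ?subr_ge0// ?divr_ge0// ltW.
Qed.

Let coarse_sum_le m t r ss : t * b ^+ m <= 1 -> (forall s, s \in ss -> 0 <= s <= t) ->
  \prod_(j < m) expR (lognormal_exponent rho v ((0, r) :: unit_powers j ss)) <=
  expR (v / 2 * ((r + (size ss)%:R) ^+ 2 - (r + (size ss)%:R))) ^+ m *
  expR (v * `|r| * (Cs * (size ss)%:R * (1 - xa)^-1)).
Proof.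
move=> tm ss0; set E := v / 2 * _.
apply: (@le_trans _ _ (\prod_(j < m) expR (E + v * `|r| * (Cs * xa ^+ (m - j) * (size ss)%:R)))).
  apply: ler_prod => j _; rewrite expR_ge0 ler_expR /=.
  exact: coarse_exponent_le tm (ltn_ord j) ss0.
rewrite -expR_sum big_split/= sumr_const card_ord -[E *+ m]mulr_natl expRD expRM_natl.
rewrite ler_wpM2l ?exprn_ge0 ?expR_ge0// ler_expR -mulr_sumr ler_wpM2l//.
  by rewrite mulr_ge0// ltW.
under eq_bigr do rewrite mulrAC.
by rewrite -mulr_sumr ler_wpM2l ?mulr_ge0// geometric_sum_rev_le.
Qed.

(** The diagonal correlations cancel the term [- size ss]. The remaining double sum is written as a
    mean over the first index, which multiplies [v / 2] by the number of points and produces [kap];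
    convexity of the exponential then gives the mean of the stars. *)
Let fine_prod_le m N t ss kap : (0 < size ss)%N -> t * b ^+ m <= 1 ->
  (forall s, s \in ss -> 0 <= s <= t) ->
  kap = (size ss)%:R * v / 2 ->
  \prod_(i < N) expR (lognormal_exponent rho v (unit_powers (m + i) ss)) <=
  star_sum (fun x y => expR (kap * (Cl * (1 - b `^ (- al))^-1)) *
    level_kernel b (expR kap) m N x y) ss / (size ss)%:R.
Proof.
case: ss => [//|s0 ss'] _ tm; set ss := s0 :: ss' => ss0 kapE.
set p := (size ss)%:R; have p0 : p != 0 by rewrite pnatr_eq0.
pose nt (i : 'I_(size ss)) := nth 0 ss i.
pose K (a c : 'I_(size ss)) :=
  \sum_(i < N) rho (nt a * b ^+ (m + i)) (nt c * b ^+ (m + i)).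
have nt0 a : 0 <= nt a <= t by apply/ss0/mem_nth.
rewrite -expR_sum.
have -> : \sum_(i < N) lognormal_exponent rho v (unit_powers (m + i) ss) =
    (\sum_a kap * \sum_(c | c != a) K a c) / p.
  transitivity (\sum_(i < N) v / 2 * (\sum_(a < size ss) \sum_(c < size ss | c != a)
      rho (nt a * b ^+ (m + i)) (nt c * b ^+ (m + i)))).
    apply: eq_bigr => i _; rewrite lognormal_exponent_unit; congr (_ * _).
    rewrite /pair_sum (big_nth 0) big_mkord.
    transitivity (\sum_(a < size ss) (1 + \sum_(c < size ss | c != a)
        rho (nt a * b ^+ (m + i)) (nt c * b ^+ (m + i))) - p).
      congr (_ - _); apply: eq_bigr => a _.
      rewrite (big_nth 0) big_mkord (bigD1 a)//= rho_refl//.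
      by rewrite mulr_ge0//; [case/andP: (nt0 a)|exact: ltW].
    by rewrite big_split/= sumr_const card_ord addrAC subrr add0r.
  rewrite -[LHS]mulr_sumr -[in RHS]mulr_sumr exchange_big/= [RHS]mulrAC; congr (_ * _).
    by rewrite kapE -/p; field.
  by apply: eq_bigr => a _; rewrite exchange_big.
apply: le_trans (expR_mean_le _) _.
rewrite ler_wpM2r ?invr_ge0 ?ler0n//; apply: ler_sum => a _.
rewrite mulr_sumr expR_sum /star; apply: ler_prod => c _; rewrite expR_ge0/=.
have /andP[a1 a2] := nt0 a; have /andP[c1 c2] := nt0 c.
apply: (level_kernel_ge b1 al0 Cl0 rho1 rho_large) => //.
  by rewrite kapE divr_ge0// mulr_ge0// ltW.
apply: le_trans tm; rewrite ler_wpM2r ?(ltW (bX m))//.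
by rewrite ler_norml; apply/andP; split; lra.
Qed.

Lemma moment_upper_bound p r : (0 < p <= k)%N -> exists2 c : R, 0 <= c &
  forall t m n, 0 <= t -> t * b ^+ m <= 1 -> 1 < t * b ^+ m.+1 -> (m <= n.+1)%N ->
  (\int[P]_w ((coarse_power r m w)%:E * cascade_integral n t w ^+ p) <=
   (c * t ^+ p * expR (v / 2 * ((r + p%:R) ^+ 2 - (r + p%:R))) ^+ m)%:E)%E.
Proof.
move=> /andP[p0 pk].
pose kap := p%:R * v / 2; pose lam := expR kap.
have kap0 : 0 <= kap by rewrite /kap divr_ge0// mulr_ge0// ltW.
have lamb : 0 <= lam < b.
  rewrite expR_ge0/= (le_lt_trans _ b_large)// ler_expR /kap ler_wpM2r//.
  by rewrite ler_wpM2r ?ler_nat// ltW.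
pose Cf := expR (kap * (Cl * (1 - b `^ (- al))^-1)).
(* The last factor [b] comes from trading b^-m for [t]: the condition [1 < t * b ^+ m.+1] gives b^-m
   <= b t. *)
pose C1 := Cf * (2 * b * (1 - lam / b)^-1 * b).
have C10 : 0 <= C1.
  have : lam / b <= 1 by rewrite ler_pdivrMr// mul1r; apply: ltW; case/andP: lamb.
  move=> h; rewrite /C1 mulr_ge0 ?expR_ge0// !mulr_ge0 ?(ltW b0)// invr_ge0 subr_ge0//.
pose Kc := expR (v * `|r| * (Cs * p%:R * (1 - xa)^-1)).
exists (Kc * C1 ^+ p.-1) => [|t m n t0 tm tm1 mn].
  by rewrite mulr_ge0 ?expR_ge0 ?exprn_ge0.
set E := expR _.
pose N := (n.+1 - m)%N.
pose f x y := Cf * level_kernel b lam m N x y.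
have mf : measurable_fun setT (fun p : R * R => f p.1 p.2).
  by apply: measurable_funM => //; exact: measurable_level_kernel.
have f0 x y : 0 <= f x y.
  by rewrite /f mulr_ge0 ?expR_ge0// level_kernel_ge0// expR_ge0.
have mD : measurable (`[0, t]%classic : set R) by [].
have fC x : `[0, t]%classic x ->
    (\int[mu]_(y in `[0%R, t]) (f x y)%:E <= (C1 * t)%:E)%E.
  move=> _; under eq_integral do rewrite /f EFinM.
  rewrite ge0_integralZl ?lee_fin ?expR_ge0//; last 2 first.
  - apply/measurable_EFinP/measurable_funTS.
    apply: (measurable_fun_pair2 (f := fun p : R * R => level_kernel b lam m N p.1 p.2)).
    exact: measurable_level_kernel.
  - by move=> y _; rewrite lee_fin level_kernel_ge0// expR_ge0.
  apply: le_trans (lee_wpmul2l _ (integral_level_kernel_le b1 m N x mD lamb)) _.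
    by rewrite lee_fin expR_ge0.
  rewrite -EFinM lee_fin /C1 -!mulrA ler_wpM2l ?expR_ge0// ler_wpM2l//.
  rewrite ler_wpM2l ?(ltW b0)// ler_wpM2l//.
    rewrite invr_ge0 subr_ge0 ler_pdivrMr// mul1r; apply: ltW; by case/andP: lamb.
  by rewrite -[leLHS]mul1r ler_pdivrMr// -mulrA mulrCA -exprS ltW.
apply: le_trans (moment_star_le mD (measurable_cascade n) (cascade_ge0 n)
    mf f0 _ fC p0 (K := Kc * E ^+ m) _ (measurable_coarse_power r m) _ _) _.
- by rewrite mulr_ge0.
- by rewrite mulr_ge0 ?exprn_ge0 ?expR_ge0.
- by move=> w; exact/ltW/coarse_power_gt0.
- move=> ss sz ssD.
  have ss0 s : s \in ss -> 0 <= s <= t by move=> /ssD; rewrite /= in_itv.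
  rewrite expectation_coarse_cascade//; last by move=> s /ss0 /andP[].
  pose g j := expR (lognormal_exponent rho v
    ((if (j < m)%N then [:: (0%R, r)] else [::]) ++ unit_powers j ss)).
  rewrite lee_fin -(big_mkord xpredT g) (big_cat_nat (leq0n m) mn)/=.
  have -> : \prod_(m <= j < n.+1) g j =
      \prod_(i < N) expR (lognormal_exponent rho v (unit_powers (m + i) ss)).
    rewrite -{1}[m]add0n big_addn big_mkord; apply: eq_bigr => i _.
    by rewrite /g addnC ltnNge leq_addr.
  rewrite big_mkord (eq_bigr (fun j : 'I_m => expR (lognormal_exponent rho v
      ((0, r) :: unit_powers j ss)))); last by move=> j _; rewrite /g ltn_ord.
  have -> : Kc * E ^+ m / p%:R * star_sum f ss = E ^+ m * Kc * (star_sum f ss / p%:R).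
    by ring.
  apply: ler_pM.
  - by apply: prodr_ge0 => j _; exact: expR_ge0.
  - by apply: prodr_ge0 => j _; exact: expR_ge0.
  - by have := coarse_sum_le r tm ss0; rewrite sz.
  - have sz0 : (0 < size ss)%N by rewrite sz.
    by have := @fine_prod_le m N t ss kap sz0 tm ss0; rewrite sz; exact.
- have t_gt0 : 0 < t.
    by have := lt_trans ltr01 tm1; rewrite pmulr_lgt0.
  rewrite lebesgue_measure_itv/= lte_fin t_gt0 -EFinB subr0 -EFinM lee_fin.
  rewrite le_eqVlt; apply/orP; left; apply/eqP.
  rewrite exprMn -[in RHS](prednK p0) exprS; ring.
Qed.

Let mu_segment t : 0 <= t -> mu `[0%R, t]%classic = t%:E.
Proof.
move=> t0; rewrite /mu lebesgue_measure_itv/= lte_fin.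
case: ifPn => t_gt0; first by rewrite -EFinB subr0.
by congr EFin; apply/eqP; rewrite eq_le t0 leNgt t_gt0.
Qed.

(** The integral enters to the first power, so each fine level contains one factor of exponent one
    and contributes exactly 1. The coarse levels lose a total error bounded by a geometric series,
    uniformly in [m]; this gives [c]. *)
Lemma moment_lower_bound q : exists2 c : R, 0 < c &
  forall t m n, 0 <= t -> t * b ^+ m <= 1 -> (m <= n.+1)%N ->
  ((c * t * expR (v / 2 * (q ^+ 2 - q)) ^+ m)%:E <=
   \int[P]_w ((coarse_power (q - 1) m w)%:E * cascade_integral n t w))%E.
Proof.
pose r := q - 1; pose c := expR (- (v * `|r| * (Cs * (1 - xa)^-1))).
exists c => [|t m n t0 tm mn]; first exact: expR_gt0.
set E := expR _.
have mD : measurable (`[0, t]%classic : set R) by [].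
rewrite (_ : (\int[P]_w _)%E = (\int[P]_w ((coarse_power r m w)%:E *
  (\int[mu]_(s in `[0%R, t]) (cascade n s w)%:E) ^+ 1))%E)//.
rewrite (moment_succ P mD (measurable_cascade n) (cascade_ge0 n) 0
  (measurable_coarse_power r m)); last by move=> w; exact/ltW/coarse_power_gt0.
apply: (@le_trans _ _ (\int[mu]_(s in `[0%R, t]) (c * E ^+ m)%:E)%E).
  by rewrite integral_cst// [X in (_ * X)%E](mu_segment t0) -EFinM lee_fin mulrAC.
apply: ge0_le_int => s /=; first by rewrite lee_fin mulr_ge0 ?exprn_ge0 ?expR_ge0.
rewrite in_itv/= => /andP[s0 st].
under eq_integral do rewrite mule1.
rewrite (expectation_coarse_cascade1 r mn s0).
rewrite lee_fin -expR_sum /c /E -expRM_natl -expRD ler_expR.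
pose g j := lognormal_exponent rho v
  ((if (j < m)%N then [:: (0, r)] else [::]) ++ unit_powers j [:: s]).
rewrite -(big_mkord xpredT g) (big_cat_nat (leq0n m) mn)/=.
rewrite [X in _ <= _ + X]big1_seq ?addr0; last first.
  move=> j /andP[_]; rewrite mem_index_iota => /andP[mj _].
  rewrite /g ltnNge mj [~~ true]/= cat0s lognormal_exponent_unit /pair_sum !big_seq1 rho_refl ?subrr ?mulr0//.
  by rewrite mulr_ge0// ltW.
rewrite big_mkord.
apply: (@le_trans _ _ (\sum_(j < m) (v / 2 * (q ^+ 2 - q) -
    v * `|r| * (Cs * xa ^+ (m - j))))).
  rewrite big_split/= sumr_const card_ord sumrN -[X in _ <= X - _]mulr_natl addrC.
  rewrite lerD2l lerN2 -!mulr_sumr ler_wpM2l ?ler_wpM2l ?geometric_sum_rev_le//.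
  by rewrite mulr_ge0// ltW.
apply: ler_sum => j _; rewrite /g ltn_ord cat1s lognormal_exponent_cons /pair_sum !big_seq1.
have sb0 : 0 <= s * b ^+ j by rewrite mulr_ge0// ltW.
rewrite rho_refl//=.
set x := rho 0 _.
have x1 : 1 - x <= Cs * xa ^+ (m - j) by apply: coarse_rho tm _ _; rewrite ?ltn_ord ?s0.
have x0 : 0 <= 1 - x by rewrite subr_ge0 rho1.
have rx : r * (1 - x) <= `|r| * (Cs * xa ^+ (m - j)).
  by rewrite (le_trans (ler_norm _))// normrM [`|1 - x|]ger0_norm// ler_wpM2l.
rewrite -subr_ge0.
have -> : v / 2 * (r ^+ 2 + 2 * r * x + 1 - (r + 1)) -
    (v / 2 * (q ^+ 2 - q) - v * `|r| * (Cs * xa ^+ (m - j))) =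
    v * (`|r| * (Cs * xa ^+ (m - j)) - r * (1 - x)).
  by rewrite /r; field.
by rewrite mulr_ge0 ?subr_ge0// ltW.
Qed.

Lemma measurable_cascade_integral n t : measurable_fun setT (cascade_integral n t).
Proof.
have mD : measurable (`[0, t]%classic : set R) by [].
exact: (measurable_process_integral mD (measurable_cascade n) (cascade_ge0 n)).
Qed.

Lemma cascade_integral_ge0 n t w : (0 <= cascade_integral n t w)%E.
Proof. by apply: integral_ge0 => s _; rewrite lee_fin. Qed.

Lemma expectation_cascade_integral n t : 0 <= t ->
  (\int[P]_w cascade_integral n t w = t%:E)%E.
Proof.
move=> t0; have mD : measurable (`[0, t]%classic : set R) by [].
have := expectation_mul_process_integral P mD (measurable_cascade n) (cascade_ge0 n)
  (W := fun=> 1%E) (measurable_cst _) (fun _ => lee01).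
under eq_integral do rewrite mule1.
move=> ->; transitivity (\int[mu]_(s in `[0%R, t]) (cst 1 s))%E.
  apply: eq_integral => s; rewrite inE/= in_itv/= => /andP[s0 st].
  transitivity (\int[P]_w (coarse_power 0 0 w * cascade n s w)%:E)%E.
    by apply: eq_integral => w _; rewrite /coarse_power big_ord0 mul1r mule1.
  rewrite (expectation_coarse_cascade1 0 (leq0n n.+1) s0).
  congr EFin; rewrite big1// => j _; rewrite ltn0 cat0s lognormal_exponent_unit.
  rewrite /pair_sum !big_seq1 rho_refl ?subrr ?mulr0 ?expR0//.
  by rewrite mulr_ge0// ltW.
by rewrite integral_cst// mul1e [LHS](mu_segment t0).
Qed.

(** The martingale property tested against powers of the earlier mass. Expanding both sides reduces
    it to joint moments, where [expectation_cascade_later] applies. *)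
Lemma cascade_integral_martingale n n' t l : (n <= n')%N ->
  (\int[P]_w (cascade_integral n' t w * cascade_integral n t w ^+ l) =
   \int[P]_w (cascade_integral n t w ^+ l.+1))%E.
Proof.
move=> nn'; have mD : measurable (`[0, t]%classic : set R) by [].
have mX : measurable_fun setT (fun w => cascade_integral n t w ^+ l)%E.
  elim: l => [|l IH]; first exact: measurable_cst.
  under eq_fun do rewrite expeS.
  by apply: emeasurable_funM => //; exact: measurable_cascade_integral.
have X0 w : (0 <= cascade_integral n t w ^+ l)%E.
  by rewrite expe_ge0// cascade_integral_ge0.
under [RHS]eq_integral do rewrite expeS.
rewrite (expectation_mul_process_integral P mD (measurable_cascade n') (cascade_ge0 n') mX X0).
rewrite (expectation_mul_process_integral P mD (measurable_cascade n) (cascade_ge0 n) mX X0).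
apply: eq_integral => s; rewrite inE/= in_itv/= => /andP[s0 _].
have later ss : size ss = l -> (forall u, u \in ss -> `[0, t]%classic u) ->
    (\int[P]_w (cascade n' s w * \prod_(u <- ss) cascade n u w)%:E =
     \int[P]_w (cascade n s w * \prod_(u <- ss) cascade n u w)%:E)%E.
  move=> _ ssD; apply: expectation_cascade_later => // u /ssD.
  by rewrite /= in_itv/= => /andP[].
exact: (moment_eq mD (measurable_cascade n) (cascade_ge0 n) (measurable_cascade_at n' s)
  (cascade_ge0 n' s) (measurable_cascade_at n s) (cascade_ge0 n s) later).
Qed.

(** * Real-valued masses and their limits *)

Definition cascade_mass n t w : R := fine (cascade_integral n t w).

Lemma measurable_cascade_mass n t : measurable_fun setT (cascade_mass n t).
Proof.
apply: measurableT_comp; first exact: fine_measurable.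
exact: measurable_cascade_integral.
Qed.

Lemma cascade_mass_ge0 n t w : 0 <= cascade_mass n t w.
Proof. exact/fine_ge0/cascade_integral_ge0. Qed.

Lemma cascade_mass_ae n t : 0 <= t ->
  {ae P, forall w, (cascade_mass n t w)%:E = cascade_integral n t w}.
Proof.
move=> t0.
have : P.-integrable setT (cascade_integral n t).
  apply/integrableP; split; first exact: measurable_cascade_integral.
  under eq_integral do rewrite gee0_abs ?cascade_integral_ge0//.
  by rewrite expectation_cascade_integral// ltry.
move=> /integrable_ae -/(_ measurableT); apply: filterS => w /(_ I) h.
by rewrite fineK.
Qed.

Let measurable_expe (f : Omega -> \bar R) l : measurable_fun setT f ->
  measurable_fun setT (fun w => f w ^+ l)%E.
Proof.
move=> mf; elim: l => [|l IH]; first exact: measurable_cst.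
by under eq_fun do rewrite expeS; exact: emeasurable_funM.
Qed.

Let expectation_massX (Z : Omega -> R) n t p : 0 <= t ->
  measurable_fun setT Z -> (forall w, 0 <= Z w) ->
  (\int[P]_w (Z w * cascade_mass n t w ^+ p)%:E =
   \int[P]_w ((Z w)%:E * cascade_integral n t w ^+ p))%E.
Proof.
move=> t0 mZ Z0; apply: ge0_ae_eq_integral => //.
- apply/measurable_EFinP; apply: measurable_funM => //.
  by apply: measurable_funX; exact: measurable_cascade_mass.
- apply: emeasurable_funM; first exact/measurable_EFinP.
  by apply: measurable_expe; exact: measurable_cascade_integral.
- by move=> w _; rewrite lee_fin mulr_ge0// exprn_ge0// cascade_mass_ge0.
- by move=> w _; rewrite mule_ge0 ?lee_fin// expe_ge0// cascade_integral_ge0.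
move: (cascade_mass_ae n t0); apply: filterS => w <- _.
by rewrite EFinM EFin_expe.
Qed.

Lemma expectation_cascade_mass n t : 0 <= t ->
  (\int[P]_w (cascade_mass n t w)%:E = t%:E)%E.
Proof.
move=> t0; rewrite -(expectation_cascade_integral n t0).
have := @expectation_massX (fun=> 1) n t 1 t0 (measurable_cst _) (fun=> ler01).
under eq_integral do rewrite mul1r expr1.
by move=> ->; under eq_integral do rewrite mul1e.
Qed.

Lemma expectation_cascade_massM n n' t l : 0 <= t -> (n <= n')%N ->
  (\int[P]_w (cascade_mass n' t w * cascade_mass n t w ^+ l)%:E =
   \int[P]_w (cascade_mass n t w ^+ l.+1)%:E)%E.
Proof.
move=> t0 nn'.
transitivity (\int[P]_w (cascade_integral n' t w * cascade_integral n t w ^+ l))%E.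
  apply: ge0_ae_eq_integral => //.
  - apply/measurable_EFinP; apply: measurable_funM; first exact: measurable_cascade_mass.
    by apply: measurable_funX; exact: measurable_cascade_mass.
  - apply: emeasurable_funM; first exact: measurable_cascade_integral.
    by apply: measurable_expe; exact: measurable_cascade_integral.
  - by move=> w _; rewrite lee_fin mulr_ge0 ?exprn_ge0// cascade_mass_ge0.
  - by move=> w _; rewrite mule_ge0 ?expe_ge0// cascade_integral_ge0.
  move: (cascade_mass_ae n t0) (cascade_mass_ae n' t0); apply: filterS2 => w <- <- _.
  by rewrite EFinM EFin_expe.
rewrite cascade_integral_martingale//.
transitivity (\int[P]_w (1%:E * cascade_integral n t w ^+ l.+1))%E.
  by apply: eq_integral => w _; rewrite mul1e.
rewrite -(@expectation_massX (fun=> 1))//.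
by apply: eq_integral => w _; rewrite mul1r.
Qed.

(** [m] is the integer part of [- ln t / ln b], found as the least [n] with [1 < t * b ^+ n.+1];
    Bernoulli's inequality shows that there is one. *)
Let level_exists t : 0 < t <= 1 ->
  exists m, t * b ^+ m <= 1 /\ 1 < t * b ^+ m.+1.
Proof.
move=> /andP[t0 t1].
have bern n : 1 + n%:R * (b - 1) <= b ^+ n.
  elim: n => [|n IH]; first by rewrite mul0r addr0.
  rewrite exprS -natr1; apply: le_trans (ler_wpM2l (ltW b0) IH).
  have : 0 <= n%:R * (b - 1) * (b - 1).
    by rewrite mulr_ge0// ?mulr_ge0// subr_ge0 ltW.
  nra.
have ex : exists n, 1 < t * b ^+ n.+1.
  have tb : 0 < t * (b - 1) by rewrite mulr_gt0 ?subr_gt0.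
  exists (Num.bound (t * (b - 1))^-1); set n := Num.bound _.
  have h : (t * (b - 1))^-1 < n.+1%:R.
    apply: (@lt_trans _ _ n%:R); last by rewrite ltr_nat.
    by apply: archi_boundP; rewrite invr_ge0 ltW.
  apply: (@lt_le_trans _ _ (t * (1 + n.+1%:R * (b - 1)))); last by rewrite ler_wpM2l// ltW.
  move: h; rewrite -[_^-1]mul1r ltr_pdivrMr// => h; nra.
have [m hm minm] := ex_minnP ex; exists m; split=> //.
case: m hm minm => [|m] hm minm; first by rewrite expr0 mulr1.
by rewrite leNgt; apply/negP => /minm; rewrite ltnn.
Qed.

Let coarse0 m w : coarse_power 0 m w = 1.
Proof. by rewrite /coarse_power big1// => j _; rewrite powRr0. Qed.

Lemma cascade_mass_gap n n' t l : 0 <= t -> (2 <= l)%N -> (n <= n')%N ->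
  (\int[P]_w (cascade_mass n t w ^+ l)%:E < +oo)%E ->
  (\int[P]_w (cascade_mass n' t w ^+ l)%:E < +oo)%E ->
  (\int[P]_w (`|cascade_mass n' t w - cascade_mass n t w| ^+ l)%:E <=
   (fine (\int[P]_w (cascade_mass n' t w ^+ l)%:E) -
    fine (\int[P]_w (cascade_mass n t w ^+ l)%:E))%:E)%E.
Proof.
move=> t0 l2 nn' fn fn'.
set x := cascade_mass n t; set y := cascade_mass n' t.
have mx : measurable_fun setT x by exact: measurable_cascade_mass.
have my : measurable_fun setT y by exact: measurable_cascade_mass.
have x0 w : 0 <= x w by exact: cascade_mass_ge0.
have y0 w : 0 <= y w by exact: cascade_mass_ge0.
have mX (f : Omega -> R) p : measurable_fun setT f -> measurable_fun setT (fun w => f w ^+ p).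
  exact: measurable_funX.
have X0 (f : Omega -> R) p : (forall w, 0 <= f w) -> forall w, 0 <= f w ^+ p.
  by move=> f0 w; rewrite exprn_ge0.
have fin_numX f : (forall w, 0 <= f w) -> (\int[P]_w (f w ^+ l)%:E < +oo)%E ->
    (\int[P]_w (f w ^+ l)%:E \is a fin_num)%E.
  by move=> f0; rewrite ge0_fin_numE// integral_ge0// => w _; rewrite lee_fin X0.
have xf := fin_numX x x0 fn; have yf := fin_numX y y0 fn'.
have xy : (\int[P]_w (x w ^+ l.-1 * y w)%:E = \int[P]_w (x w ^+ l)%:E)%E.
  have := expectation_cascade_massM l.-1 t0 nn'; rewrite prednK ?(leq_trans _ l2)// => <-.
  by apply: eq_integral => w _; rewrite mulrC.
(* The negative terms of [convex_expr_gap] are moved across, so that every integrand is nonnegative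
   and the extended integrals split. By [xy] the two terms with factor [l] then cancel. *)
have main : (\int[P]_w (`|y w - x w| ^+ l + (x w ^+ l + l%:R * (x w ^+ l.-1 * y w)))%:E <=
    \int[P]_w (y w ^+ l + l%:R * x w ^+ l)%:E)%E.
  apply: ge0_int_le => w; apply/andP; split.
    by rewrite !addr_ge0 ?mulr_ge0 ?exprn_ge0.
  have := convex_expr_gap l2 (x0 w) (y0 w).
  have -> : x w ^+ l = x w ^+ l.-1 * x w by rewrite -exprSr prednK// (leq_trans _ l2).
  set D := `|_| ^+ l; set yl := y w ^+ l; set xl := x w ^+ l.-1 => h.
  by rewrite -subr_ge0; move: h; rewrite -subr_ge0; congr (0 <= _); ring.
have mxy : measurable_fun setT (fun w => x w ^+ l.-1 * y w) by apply: measurable_funM => //; exact: mX.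
have xy0 w : 0 <= x w ^+ l.-1 * y w by rewrite mulr_ge0// X0.
have mD : measurable_fun setT (fun w => `|y w - x w| ^+ l).
  by apply: mX; apply: measurableT_comp => //; exact: measurable_funB.
rewrite (ge0_int_add P (f := fun w => `|y w - x w| ^+ l)
    (g := fun w => x w ^+ l + l%:R * (x w ^+ l.-1 * y w))) in main; last 4 first.
- exact: mD.
- by move=> w; rewrite exprn_ge0.
- by apply: measurable_funD; [exact: mX|exact: measurable_funM].
- by move=> w; rewrite addr_ge0 ?X0// mulr_ge0.
rewrite (ge0_int_add P (f := fun w => x w ^+ l)
    (g := fun w => l%:R * (x w ^+ l.-1 * y w))) in main; last 4 first.
- exact: mX.
- exact: X0.
- exact: measurable_funM.
- by move=> w; rewrite mulr_ge0.
rewrite (ge0_int_add P (f := fun w => y w ^+ l)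
    (g := fun w => l%:R * x w ^+ l)) in main; last 4 first.
- exact: mX.
- exact: X0.
- by apply: measurable_funM => //; exact: mX.
- by move=> w; rewrite mulr_ge0// X0.
rewrite !(ge0_int_scale P (c := l%:R)) ?ler0n// in main; last 2 first.
- exact: mX.
- exact: X0.
rewrite xy -(fineK xf) -(fineK yf) in main; move: main.
move: (fine _) (fine _) => cx cy; rewrite -!EFinM -!EFinD -leeBrDr// -EFinB => main.
by apply: le_trans main _; rewrite lee_fin; lra.
Qed.

Hypothesis k2 : (2 <= k)%N.
Let k0 : (0 < k)%N. Proof. exact: leq_trans k2. Qed.

Let mass_moment_bound p : (0 < p <= k)%N -> exists2 c : R, 0 <= c &
  forall t m n, 0 <= t -> t * b ^+ m <= 1 -> 1 < t * b ^+ m.+1 -> (m <= n.+1)%N ->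
  (\int[P]_w (cascade_mass n t w ^+ p)%:E <=
   (c * t ^+ p * expR (v / 2 * (p%:R ^+ 2 - p%:R)) ^+ m)%:E)%E.
Proof.
move=> pk; have [c c0 H] := moment_upper_bound 0 pk.
exists c => // t m n t0 tm tm1 mn.
have := H t m n t0 tm tm1 mn; rewrite add0r; apply: le_trans.
under [leRHS]eq_integral do rewrite coarse0.
rewrite -(@expectation_massX (fun=> 1))//.
by under [leRHS]eq_integral do rewrite mul1r.
Qed.

Definition is_mass_limit t (A : Omega -> R) := [/\ measurable_fun setT A,
  (forall w, 0 <= A w) &
  forall eps : R, 0 < eps -> exists n0, forall n, (n0 <= n)%N ->
    (\int[P]_w (`|cascade_mass n t w - A w| ^+ k)%:E <= eps%:E)%E].

Lemma mass_limit_exists t : 0 <= t <= 1 -> exists A, is_mass_limit t A.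
Proof.
(* At [t = 0] no level satisfies the second condition of [level_exists]; the masses vanish there. *)
move=> /andP[t0 t1]; have [->|tn0] := eqVneq t 0.
  exists (fun=> 0); split=> // eps eps0; exists 0%N => n _.
  rewrite integral0_eq ?lee_fin ?ltW// => w _.
  rewrite /cascade_mass /cascade_integral set_itv1 integral_set1/=.
  by rewrite subr0 normr0 expr0n (gtn_eqF k0).
have t_gt0 : 0 < t by rewrite lt_neqAle eq_sym tn0.
have [m [tm tm1]] : exists m, t * b ^+ m <= 1 /\ 1 < t * b ^+ m.+1.
  by apply: level_exists; rewrite t_gt0.
have [c c0 H] := @mass_moment_bound k (introT andP (conj k0 (leqnn k))).
pose e n := fine (\int[P]_w (cascade_mass n t w ^+ k)%:E)%E.
have fin n : (m <= n)%N -> (\int[P]_w (cascade_mass n t w ^+ k)%:E < +oo)%E.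
  move=> mn; apply: le_lt_trans (H t m n t0 tm tm1 (leqW mn)) _; exact: ltry.
have eB n : (m <= n)%N -> e n <= c * t ^+ k * expR (v / 2 * (k%:R ^+ 2 - k%:R)) ^+ m.
  move=> mn; rewrite -lee_fin fineK ?H//; first exact: leqW.
  rewrite ge0_fin_numE ?fin//; apply: integral_ge0 => w _.
  by rewrite lee_fin exprn_ge0// cascade_mass_ge0.
have gap n n' : (m <= n)%N -> (n <= n')%N ->
    (\int[P]_w (`|cascade_mass n' t w - cascade_mass n t w| ^+ k)%:E <= (e n' - e n)%:E)%E.
  move=> mn nn'; apply: cascade_mass_gap => //; apply: fin => //.
  exact: leq_trans nn'.
have mm n : measurable_fun setT (cascade_mass n t) by exact: measurable_cascade_mass.
have m0 n w : 0 <= cascade_mass n t w by exact: cascade_mass_ge0.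
exists (power_limit gap eB); split.
- exact: measurable_power_limit.
- by move=> w; exact: normr_ge0.
- exact: power_limit_cvg.
Qed.

Lemma mass_limit_cvg t A q : is_mass_limit t A -> 0 < q <= k%:R ->
  forall eps : R, 0 < eps -> exists n0, forall n, (n0 <= n)%N ->
    (\int[P]_w (`|cascade_mass n t w - A w| `^ q)%:E <= eps%:E)%E.
Proof.
move=> [mA A0 cA] /andP[q0 qk] eps eps0.
have e2 : 0 < eps / 2 by rewrite divr_gt0.
(* Truncating at [x] with [x^q = eps / 2] leaves half of [eps] for the k-th moment, which is already
   small. *)
pose x := (eps / 2) `^ q^-1; have x0 : 0 < x by rewrite powR_gt0.
have xq : x `^ q = eps / 2.
  by rewrite /x -powRrM mulVf ?gt_eqF// powRr1// ltW.
pose y := x `^ (q - k%:R); have y0 : 0 < y by rewrite powR_gt0.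
have [n0 Hn] := cA _ (divr_gt0 e2 y0); exists n0 => n n0n.
have mD : measurable_fun setT (fun w => `|cascade_mass n t w - A w|).
  apply: measurableT_comp => //; apply: measurable_funB => //.
  exact: measurable_cascade_mass.
apply: (@le_trans _ _ (\int[P]_w (eps / 2 + y * `|cascade_mass n t w - A w| ^+ k)%:E)%E).
  apply: ge0_int_le => w; rewrite powR_ge0 -xq powR_le_truncated//.
  by rewrite ltW.
rewrite (ge0_int_add P (f := fun=> eps / 2)
    (g := fun w => y * `|cascade_mass n t w - A w| ^+ k)); last 4 first.
- exact: measurable_cst.
- by move=> w; exact: ltW.
- by apply: measurable_funM => //; exact: measurable_funX.
- by move=> w; rewrite mulr_ge0 ?exprn_ge0// ltW.
rewrite integral_cst//= probability_setT mule1 ge0_int_scale; last 3 first.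
- exact: ltW.
- exact: measurable_funX.
- by move=> w; rewrite exprn_ge0.
apply: (@le_trans _ _ ((eps / 2)%:E + y%:E * (eps / 2 / y)%:E)%E).
  by rewrite leeD2l// lee_wpmul2l ?Hn// lee_fin ltW.
by rewrite -EFinM -EFinD lee_fin mulrCA divff ?gt_eqF// mulr1; lra.
Qed.

Lemma mass_power_bounds q : 0 < q <= k%:R -> exists c1 c2 : R, [/\ 0 < c1, 0 < c2 &
  forall t m n, 0 < t -> t * b ^+ m <= 1 -> 1 < t * b ^+ m.+1 -> (m <= n.+1)%N ->
  let e := t `^ q * expR (v / 2 * (q ^+ 2 - q)) ^+ m in
  ((c1 * e)%:E <= \int[P]_w (cascade_mass n t w `^ q)%:E)%E /\
  (\int[P]_w (cascade_mass n t w `^ q)%:E <= (c2 * e)%:E)%E].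
Proof.
move=> /andP[q0 qk].
have kk : (0 < k <= k)%N by rewrite k0 leqnn.
have k2' : (0 < 2 <= k)%N by [].
have [Ck Ck0 Hk] := moment_upper_bound (q - k%:R) kk.
have [C2 C20 H2] := moment_upper_bound (q - 2) k2'.
have [cl cl0 Hl] := moment_lower_bound q.
(* [ep] and [La] are chosen so that the two error terms in [le1] take at most a quarter each of the
   first moment [cl * t * Em]; half of it remains. *)
pose ep := cl / 4; pose La := 4 * C2 / cl + 1.
have epE : ep = cl / 4 by [].
have LaE : La = 4 * C2 / cl + 1 by [].
have ep0 : 0 < ep by rewrite divr_gt0.
have La0 : 0 < La by rewrite ltr_wpDl// divr_ge0 ?(ltW cl0)// mulr_ge0.
clearbody ep La.
pose c' := ep `^ (1 - q) + La `^ (1 - q).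
have c'0 : 0 < c' by rewrite addr_gt0 ?powR_gt0.
exists (cl / 2 / c'), (1 + Ck); split=> [||t m n t0 tm tm1 mn].
- by rewrite !divr_gt0.
- by rewrite ltr_pwDl.
(* The first [m] factors are nearly constant on [0, t], so [y] is compared with
   [t * G 1] through moments tilted by powers of [G 1]. *)
set Em := _ ^+ m; set y := cascade_mass n t.
have Em0 : 0 < Em by rewrite exprn_gt0// expR_gt0.
pose G r w := coarse_power r m w.
have G0 r w : 0 < G r w by exact: coarse_power_gt0.
have G0' r w : 0 <= G r w by exact: ltW.
have mG r : measurable_fun setT (G r) by exact: measurable_coarse_power.
have my : measurable_fun setT y by exact: measurable_cascade_mass.
have y0 w : 0 <= y w by exact: cascade_mass_ge0.
have GX r w : G 1 w `^ r = G r w by exact: coarse_powerX.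
have myq : measurable_fun setT (fun w => y w `^ q).
  by apply: (measurableT_comp (measurable_powR q)).
have yq0 w : 0 <= y w `^ q by exact: powR_ge0.
have intG : (\int[P]_w (G q w)%:E = Em%:E)%E by exact: expectation_coarse_power.
have intGk : (\int[P]_w (G (q - k%:R) w * y w ^+ k)%:E <= (Ck * t ^+ k * Em)%:E)%E.
  rewrite [X in (X <= _)%E](expectation_massX n k (ltW t0) (mG _) (G0' _)).
  by have := Hk t m n (ltW t0) tm tm1 mn; rewrite subrK.
have intG2 : (\int[P]_w (G (q - 2) w * y w ^+ 2)%:E <= (C2 * t ^+ 2 * Em)%:E)%E.
  rewrite [X in (X <= _)%E](expectation_massX n 2 (ltW t0) (mG _) (G0' _)).
  by have := H2 t m n (ltW t0) tm tm1 mn; rewrite subrK.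
have intG1 : ((cl * t * Em)%:E <= \int[P]_w (G (q - 1) w * y w)%:E)%E.
  apply: le_trans (Hl t m n (ltW t0) tm mn) _.
  by have := expectation_massX n 1 (ltW t0) (mG (q - 1)) (G0' (q - 1)) => <-.
split; last first.
  apply: (@le_trans _ _ (\int[P]_w (t `^ q * G q w +
      t `^ (q - k%:R) * (G (q - k%:R) w * y w ^+ k))%:E)%E).
    apply: ge0_int_le => w; rewrite yq0/=.
    have := @powR_le_truncated _ q k (t * G 1 w) (y w).
    rewrite !powRM ?(ltW t0)// !GX -mulrA; apply => //; first by rewrite (ltW q0).
    by rewrite mulr_gt0.
  rewrite (ge0_int_add P (f := fun w => t `^ q * G q w)
    (g := fun w => t `^ (q - k%:R) * (G (q - k%:R) w * y w ^+ k))); last 4 first.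
  - exact: measurable_funM.
  - by move=> w; rewrite mulr_ge0 ?powR_ge0.
  - by do 2 apply: measurable_funM => //; exact: measurable_funX.
  - by move=> w; rewrite !mulr_ge0 ?powR_ge0 ?exprn_ge0.
  rewrite !ge0_int_scale ?powR_ge0//; last 2 first.
  - by apply: measurable_funM => //; exact: measurable_funX.
  - by move=> w; rewrite mulr_ge0 ?exprn_ge0.
  rewrite intG mulrDl mul1r EFinD leeD ?EFinM//.
  apply: le_trans (lee_wpmul2l _ intGk) _; first by rewrite lee_fin powR_ge0.
  have tk : t `^ q = t `^ (q - k%:R) * t ^+ k.
    by rewrite -powR_mulrn ?(ltW t0)// -powRD ?subrK// (gt_eqF t0) implybT.
  by rewrite -!EFinM lee_fin tk le_eqVlt; apply/orP; left; apply/eqP; ring.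
have Lat0 : 0 <= (La * t)^-1 by rewrite invr_ge0 mulr_ge0// ltW.
have ept0 : 0 <= ep * t by rewrite mulr_ge0// ltW.
have ct0 : 0 <= c' * t `^ (1 - q) by rewrite mulr_ge0 ?powR_ge0// ltW.
(* This is [le_powR_truncated] for [y / G 1] between [ep * t] and [La * t], multiplied by [G q]. In
   the last term the powers of [G] cancel and the bare moment of [y] is left. *)
have le1 : (\int[P]_w (G (q - 1) w * y w)%:E <=
    (ep * t * Em)%:E + ((La * t)^-1 * (C2 * t ^+ 2 * Em))%:E +
    (c' * t `^ (1 - q))%:E * \int[P]_w (y w `^ q)%:E)%E.
  apply: (@le_trans _ _ (\int[P]_w (ep * t * G q w + ((La * t)^-1 * (G (q - 2) w * y w ^+ 2) +
      c' * t `^ (1 - q) * y w `^ q))%:E)%E).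
    apply: ge0_int_le => w; rewrite mulr_ge0//=.
    have := @le_powR_truncated _ q (y w / G 1 w) (La * t) (ep * t).
    rewrite !powRM ?(ltW t0) ?(ltW ep0) ?(ltW La0) ?invr_ge0 ?G0'//.
    rewrite -mulrDl -/c'.
    move=> /(_ (ltW q0) (mulr_gt0 ep0 t0) (mulr_gt0 La0 t0) (divr_ge0 (y0 w) (G0' 1 w))).
    move=> /(ler_wpM2l (G0' q w)).
    have Gi r : (G 1 w)^-1 `^ r = (G r w)^-1.
      have := @powRM _ (G 1 w) (G 1 w)^-1 r (G0' 1 w); rewrite invr_ge0 => /(_ (G0' 1 w)).
      rewrite divff ?gt_eqF// powR1 GX => h; apply: (@mulfI _ (G r w)); rewrite ?gt_eqF//.
      by rewrite -h divff ?gt_eqF.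
    have Gq1 : G q w = G (q - 1) w * G 1 w by rewrite /G -coarse_powerD subrK.
    have Gq2 : G q w = G (q - 2) w * G 1 w ^+ 2.
      by rewrite expr2 /G -!coarse_powerD; congr coarse_power; ring.
    rewrite Gi; have := G0 1 w; have := G0 q w; set g1 := G 1 w; set gq := G q w => gq0 g10.
    have -> : gq * (y w / g1) = G (q - 1) w * y w by rewrite /gq Gq1 -/g1; field; rewrite gt_eqF.
    move=> /le_trans; apply; rewrite le_eqVlt; apply/orP; left; apply/eqP.
    have G2E : G (q - 2) w = gq / g1 ^+ 2 by rewrite /gq Gq2 -/g1; field; rewrite gt_eqF.
    by rewrite G2E; field; rewrite !gt_eqF.
  have mG2 : measurable_fun setT (fun w => G (q - 2) w * y w ^+ 2).
    by apply: measurable_funM => //; exact: measurable_funX.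
  have G20 w : 0 <= G (q - 2) w * y w ^+ 2 by rewrite mulr_ge0 ?exprn_ge0.
  have mLG2 : measurable_fun setT (fun w => (La * t)^-1 * (G (q - 2) w * y w ^+ 2)).
    exact: measurable_funM.
  have LG20 w : 0 <= (La * t)^-1 * (G (q - 2) w * y w ^+ 2) by exact: mulr_ge0.
  have mcy : measurable_fun setT (fun w => c' * t `^ (1 - q) * y w `^ q).
    exact: measurable_funM.
  have cy0 w : 0 <= c' * t `^ (1 - q) * y w `^ q by exact: mulr_ge0.
  have meG : measurable_fun setT (fun w => ep * t * G q w) by exact: measurable_funM.
  have eG0 w : 0 <= ep * t * G q w by exact: mulr_ge0.
  have mS := measurable_funD mLG2 mcy.
  rewrite (ge0_int_add P meG eG0 mS); last by move=> w; exact: addr_ge0.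
  rewrite (ge0_int_add P mLG2 LG20 mcy cy0).
  rewrite (ge0_int_scale P ept0 (mG q) (G0' q)) (ge0_int_scale P Lat0 mG2 G20).
  rewrite (ge0_int_scale P ct0 myq yq0).
  rewrite intG addeA -EFinM leeD2r// leeD2l// [leRHS]EFinM lee_wpmul2l ?lee_fin//.
have [->|fy] := eqVneq (\int[P]_w (y w `^ q)%:E)%E +oo%E; first by rewrite leey.
have fI : (\int[P]_w (y w `^ q)%:E \is a fin_num)%E.
  by rewrite ge0_fin_numE ?ltey// integral_ge0// => w _; rewrite lee_fin.
have := le_trans intG1 le1; rewrite -(fineK fI); move: (fine _) => I.
rewrite -EFinM -!EFinD !lee_fin => h.
have tq : t = t `^ (1 - q) * t `^ q.
  by rewrite -powRD ?subrK ?powRr1 ?(ltW t0)// (gt_eqF t0) implybT.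
have C2La : C2 / La <= cl / 4.
  rewrite ler_pdivrMr// LaE; have : cl / 4 * (4 * C2 / cl + 1) = C2 + cl / 4.
    by field; rewrite gt_eqF.
  by move=> ->; rewrite lerDl divr_ge0// ltW.
have h2 : (La * t)^-1 * (C2 * t ^+ 2 * Em) = C2 / La * (t * Em).
  by field; rewrite !gt_eqF.
have h3 : C2 / La * (t * Em) <= cl / 4 * (t * Em) by rewrite ler_wpM2r// mulr_ge0// ltW.
have h4 : cl / 2 * (t * Em) <= c' * t `^ (1 - q) * I.
  rewrite h2 in h; rewrite epE in h; lra.
have T0 : 0 < t `^ (1 - q) by rewrite powR_gt0.
rewrite -(ler_pM2l c'0) -(ler_pM2l T0).
apply: le_trans (_ : cl / 2 * (t * Em) <= _).
  by rewrite [X in _ <= _ * (X * _)]tq le_eqVlt; apply/orP; left; apply/eqP; field; rewrite gt_eqF.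
by apply: (le_trans h4); rewrite mulrCA mulrA.
Qed.

Let lnb0 : 0 < ln b. Proof. exact: ln_gt0. Qed.

(** The logarithms of [e] and [s] differ by [v / 2 * (q^2 - q) * x], where [x = m + ln t / ln b]
    lies in ]-1, 0] by the choice of [m]. *)
Lemma level_scaling q t m : 0 < t -> t * b ^+ m <= 1 -> 1 < t * b ^+ m.+1 ->
  let e := t `^ q * expR (v / 2 * (q ^+ 2 - q)) ^+ m in
  let s := t `^ scaling (v / (2 * ln b)) q in
  let D := expR (v / 2 * `|q ^+ 2 - q|) in
  (D^-1 * s <= e) /\ (e <= D * s).
Proof.
move=> t0 tm tm1 e s D; pose x := m%:R + ln t / ln b.
have lnbm n : ln (t * b ^+ n) = ln t + n%:R * ln b.
  by rewrite lnM ?posrE// lnXn// mulr_natl.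
have x0 : x <= 0.
  have : ln (t * b ^+ m) <= 0 by exact: ln_le0.
  by rewrite lnbm => h; rewrite -(ler_pM2r lnb0) mul0r /x mulrDl divfK ?gt_eqF// addrC.
have x1 : -1 < x.
  have : 0 < ln (t * b ^+ m.+1) by exact: ln_gt0.
  rewrite lnbm -natr1 mulrDl mul1r => h.
  by rewrite -(ltr_pM2r lnb0) /x mulrDl divfK ?gt_eqF//; lra.
have eE : e = expR (q * ln t + m%:R * (v / 2 * (q ^+ 2 - q))).
  by rewrite expRD expRM_natl /e /powR gt_eqF.
have sE : s = expR (scaling (v / (2 * ln b)) q * ln t) by rewrite /s /powR gt_eqF.
have dE : q * ln t + m%:R * (v / 2 * (q ^+ 2 - q)) =
    scaling (v / (2 * ln b)) q * ln t + v / 2 * (q ^+ 2 - q) * x.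
  by rewrite /scaling /x; field; rewrite gt_eqF.
have dx : `|v / 2 * (q ^+ 2 - q) * x| <= v / 2 * `|q ^+ 2 - q|.
  have v2 : 0 <= v / 2 by rewrite divr_ge0// ltW.
  rewrite normrM [`|v / 2 * _|]normrM (ger0_norm v2) -[leRHS]mulr1.
  apply: ler_wpM2l; first exact: mulr_ge0.
  by rewrite ler_norml; apply/andP; split; lra.
move: dx; rewrite ler_norml => /andP[d1 d2].
by rewrite eE sE dE /D -expRN -!expRD !ler_expR; split; lra.
Qed.

Let half_moment_split t A q n : is_mass_limit t A -> 0 <= q ->
  (\int[P]_w (A w `^ q)%:E <= (2 `^ q)%:E * (\int[P]_w (cascade_mass n t w `^ q)%:E +
     \int[P]_w (`|cascade_mass n t w - A w| `^ q)%:E))%E /\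
  (\int[P]_w (cascade_mass n t w `^ q)%:E <= (2 `^ q)%:E * (\int[P]_w (A w `^ q)%:E +
     \int[P]_w (`|cascade_mass n t w - A w| `^ q)%:E))%E.
Proof.
move=> [mA A0 _] q0.
have my : measurable_fun setT (cascade_mass n t) by exact: measurable_cascade_mass.
have y0 w : 0 <= cascade_mass n t w by exact: cascade_mass_ge0.
have mq (f : Omega -> R) : measurable_fun setT f -> measurable_fun setT (fun w => f w `^ q).
  by move=> mf; apply: (measurableT_comp (measurable_powR q)).
have mD : measurable_fun setT (fun w => `|cascade_mass n t w - A w| `^ q).
  by apply: mq; apply: measurableT_comp => //; exact: measurable_funB.
have D0 w : 0 <= `|cascade_mass n t w - A w| `^ q by exact: powR_ge0.
have q20 : 0 <= 2 `^ q :> R by exact: powR_ge0.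
split.
- rewrite -(ge0_int_add P (mq _ my) (fun w => powR_ge0 _ _) mD D0).
  rewrite -(ge0_int_scale P q20 (measurable_funD (mq _ my) mD)); last first.
    by move=> w; rewrite addr_ge0 ?powR_ge0.
  by apply: ge0_int_le => w; rewrite powR_ge0 powR_le_double.
- rewrite -(ge0_int_add P (mq _ mA) (fun w => powR_ge0 _ _) mD D0).
  rewrite -(ge0_int_scale P q20 (measurable_funD (mq _ mA) mD)); last first.
    by move=> w; rewrite addr_ge0 ?powR_ge0.
  by apply: ge0_int_le => w; rewrite powR_ge0; have := powR_le_double q0 (A0 w) (y0 w); rewrite distrC.
Qed.

(** The factor [2^q] lost here and in the reverse bound is the price of an argument covering all
    positive orders; the scaling law holds up to constants and absorbs it. *)
Lemma limit_power_le t A q (B : R) n1 : is_mass_limit t A -> 0 < q <= k%:R ->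
  (forall n, (n1 <= n)%N -> (\int[P]_w (cascade_mass n t w `^ q)%:E <= B%:E)%E) ->
  (\int[P]_w (A w `^ q)%:E <= (2 `^ q * B)%:E)%E.
Proof.
move=> lA qk HB; have /andP[q0 _] := qk.
apply/lee_addgt0Pr => eps eps0.
have q2 : 0 < 2 `^ q :> R by rewrite powR_gt0.
have [n0 H0] := mass_limit_cvg lA qk (divr_gt0 eps0 q2).
have [h _] := half_moment_split (maxn n0 n1) lA (ltW q0).
apply: (le_trans h).
apply: le_trans (lee_wpmul2l _ (leeD (HB _ (leq_maxr _ _)) (H0 _ (leq_maxl _ _)))) _.
  by rewrite lee_fin ltW.
by rewrite -EFinD -EFinM lee_fin mulrDr [X in _ + X]mulrC divfK ?gt_eqF.
Qed.

Lemma limit_power_ge t A q (B : R) n1 : is_mass_limit t A -> 0 < q <= k%:R ->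
  (forall n, (n1 <= n)%N -> (B%:E <= \int[P]_w (cascade_mass n t w `^ q)%:E)%E) ->
  ((B / 2 `^ q)%:E <= \int[P]_w (A w `^ q)%:E)%E.
Proof.
move=> lA qk HB; have /andP[q0 _] := qk.
apply/lee_addgt0Pr => eps eps0.
have q2 : 0 < 2 `^ q :> R by rewrite powR_gt0.
have [n0 H0] := mass_limit_cvg lA qk eps0.
have [_ h] := half_moment_split (maxn n0 n1) lA (ltW q0).
have h1 : (B%:E <= (2 `^ q)%:E * (\int[P]_w (A w `^ q)%:E + eps%:E))%E.
  apply: (le_trans (HB _ (leq_maxr n0 n1))); apply: (le_trans h).
  by rewrite lee_wpmul2l ?lee_fin ?(ltW q2)// leeD2l// H0// leq_maxl.
have [->|fy] := eqVneq (\int[P]_w (A w `^ q)%:E)%E +oo%E; first by rewrite addye// leey.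
have fI : (\int[P]_w (A w `^ q)%:E \is a fin_num)%E.
  by rewrite ge0_fin_numE ?ltey// integral_ge0// => w _; rewrite lee_fin powR_ge0.
move: h1; rewrite -(fineK fI) -!EFinD -EFinM !lee_fin => h1.
by rewrite ler_pdivrMr// mulrC.
Qed.

Lemma limit_scaling q : 0 <= q <= k%:R -> exists c1 c2 : R, [/\ 0 < c1, c1 <= c2 &
  forall t A, 0 <= t <= 1 -> is_mass_limit t A ->
  let e := scaling (v / (2 * ln b)) q in
  ((c1 * t `^ e)%:E <= \int[P]_w (A w `^ q)%:E)%E /\
  (\int[P]_w (A w `^ q)%:E <= (c2 * t `^ e)%:E)%E].
Proof.
move=> /andP[]; rewrite le_eqVlt => /predU1P[<- _|q0 qk].
  exists 1, 1; split=> // t A _ _.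
  rewrite /scaling expr0n/= !mulr0 addr0 powRr0 mulr1.
  under eq_integral do rewrite powRr0.
  by rewrite integral_cst//= probability_setT mule1 lexx.
have qk' : 0 < q <= k%:R by rewrite q0.
have [c1 [c2 [c10 c20 H]]] := mass_power_bounds qk'.
pose D := expR (v / 2 * `|q ^+ 2 - q|); have D0 : 0 < D by exact: expR_gt0.
have q2 : 0 < 2 `^ q :> R by rewrite powR_gt0.
pose d1 := c1 / D / 2 `^ q; pose d2 := 2 `^ q * (c2 * D).
have d10 : 0 < d1 by rewrite !divr_gt0.
exists d1, (Num.max d1 d2); split; rewrite ?le_max ?lexx// => t A /andP[t0 t1] lA e.
(* A positive exponent makes t^e vanish at [t = 0], as the moments do. It is read off from the
   factorization below and [q v / 2 < ln b], which follows from [b_large]. *)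
have e0 : 0 < e.
  have : k%:R * v / 2 < ln b.
    by rewrite -ltr_expR lnK ?posrE.
  move=> h; have qv : q * (v / 2) < ln b.
    by apply: le_lt_trans h; rewrite -mulrA ler_wpM2r// divr_ge0// ltW.
  rewrite /e /scaling.
  have -> : - (v / (2 * ln b)) * q ^+ 2 + (v / (2 * ln b) + 1) * q =
      q / ln b * (v / 2 + (ln b - q * (v / 2))) by field; rewrite gt_eqF.
  by rewrite mulr_gt0 ?divr_gt0// addr_gt0 ?divr_gt0// subr_gt0.
have te0 : 0 <= t `^ e by exact: powR_ge0.
suff [h1 h2] : ((d1 * t `^ e)%:E <= \int[P]_w (A w `^ q)%:E)%E /\
    (\int[P]_w (A w `^ q)%:E <= (d2 * t `^ e)%:E)%E.
  split=> //; apply: (le_trans h2); rewrite lee_fin ler_wpM2r//.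
  by rewrite le_max lexx orbT.
have [tz|tn0] := eqVneq t 0.
  rewrite tz powR0 ?gt_eqF// !mulr0; split.
    by apply: integral_ge0 => w _; rewrite lee_fin powR_ge0.
  have := @limit_power_le t A q 0 0 lA qk'; rewrite mulr0; apply=> n _.
  rewrite integral0_eq// => w _.
  by rewrite tz /cascade_mass /cascade_integral set_itv1 integral_set1/= powR0// gt_eqF.
have t_gt0 : 0 < t by rewrite lt_neqAle eq_sym tn0.
have [m [tm tm1]] : exists m, t * b ^+ m <= 1 /\ 1 < t * b ^+ m.+1.
  by apply: level_exists; rewrite t_gt0.
have [s1 s2] := level_scaling q t_gt0 tm tm1.
split.
- apply: (@le_trans _ _ ((c1 * (t `^ q * expR (v / 2 * (q ^+ 2 - q)) ^+ m)) / 2 `^ q)%:E).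
    have -> : d1 * t `^ e = c1 * (D^-1 * t `^ e) / 2 `^ q by rewrite /d1; ring.
    rewrite lee_fin; apply: ler_wpM2r; first by rewrite invr_ge0 ltW.
    by apply: ler_wpM2l => //; exact: ltW.
  apply: (@limit_power_ge t A q _ m) => // n mn.
  by have [] := H t m n t_gt0 tm tm1 (leqW mn).
- apply: (@le_trans _ _ (2 `^ q * (c2 * (t `^ q * expR (v / 2 * (q ^+ 2 - q)) ^+ m)))%:E).
    apply: (@limit_power_le t A q _ m) => // n mn.
    by have [] := H t m n t_gt0 tm tm1 (leqW mn).
  have -> : d2 * t `^ e = 2 `^ q * (c2 * (D * t `^ e)) by rewrite /d2; ring.
  rewrite lee_fin; apply: ler_wpM2l; first exact: ltW.
  by apply: ler_wpM2l => //; exact: ltW.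
Qed.

(** * Mean and second moment of the limit *)

Lemma limit_mean t A : 0 <= t -> is_mass_limit t A ->
  (\int[P]_w (A w)%:E = t%:E)%E.
Proof.
move=> t0 lA; have [mA A0 _] := lA.
have one : 0 < (1 : R) <= k%:R by rewrite ltr01 ler1n.
have step eps : 0 < eps -> exists n,
    (\int[P]_w (`|cascade_mass n t w - A w|)%:E <= eps%:E)%E.
  move=> eps0; have [n0 H] := mass_limit_cvg lA one eps0; exists n0.
  by have := H n0 (leqnn _); under eq_integral do rewrite powRr1//.
have my n : measurable_fun setT (cascade_mass n t) by exact: measurable_cascade_mass.
have y0 n w : 0 <= cascade_mass n t w by exact: cascade_mass_ge0.
have mD n : measurable_fun setT (fun w => `|cascade_mass n t w - A w|).
  by apply: measurableT_comp => //; exact: measurable_funB.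
apply/eqP; rewrite eq_le; apply/andP; split; apply/lee_addgt0Pr => eps /step[n Hn].
- rewrite -(expectation_cascade_mass n t0).
  apply: (@le_trans _ _ (\int[P]_w (cascade_mass n t w + `|cascade_mass n t w - A w|)%:E)%E).
    apply: ge0_int_le => w; rewrite A0/= -lerBlDl distrC; exact: ler_norm.
  by rewrite (ge0_int_add P (my n) (y0 n) (mD n)) ?leeD2l// => w; exact: normr_ge0.
- rewrite -(expectation_cascade_mass n t0).
  apply: (@le_trans _ _ (\int[P]_w (A w + `|cascade_mass n t w - A w|)%:E)%E).
    apply: ge0_int_le => w; rewrite y0/= -lerBlDl; exact: ler_norm.
  by rewrite (ge0_int_add P mA A0 (mD n)) ?leeD2l// => w; exact: normr_ge0.
Qed.

Lemma first_mass_second_moment t : 0 <= t ->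
  (\int[P]_w (cascade_mass 0 t w ^+ 2)%:E =
   \int[mu]_(s in `[0%R, t]) \int[mu]_(u in `[0%R, t]) (expR (v * rho s u))%:E)%E.
Proof.
move=> t0; have mD : measurable (`[0, t]%classic : set R) by [].
transitivity (\int[P]_w ((1 : R)%:E * cascade_integral 0 t w ^+ 2))%E.
  rewrite -(@expectation_massX (fun=> 1))//.
  by apply: eq_integral => w _; rewrite mul1r.
rewrite (moment_succ P mD (measurable_cascade 0) (cascade_ge0 0) 1 (measurable_cst _) (fun=> ler01)).
apply: eq_integral => s; rewrite inE/= in_itv/= => /andP[s0 _].
have m1 : measurable_fun setT (fun w => 1 * cascade 0 s w).
  by apply: measurable_funM => //; exact: measurable_cascade_at.
have p1 w : 0 <= 1 * cascade 0 s w by rewrite mulr_ge0.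
rewrite (moment_succ P mD (measurable_cascade 0) (cascade_ge0 0) 0 m1 p1).
apply: eq_integral => u; rewrite inE/= in_itv/= => /andP[u0 _].
transitivity (\int[P]_w (coarse_power 0 0 w * \prod_(x <- [:: s; u]) cascade 0 x w)%:E)%E.
  by apply: eq_integral => w _; rewrite mule1 big_cons big_seq1 coarse0 mulrA.
rewrite expectation_coarse_cascade//; last first.
  by move=> x; rewrite !inE => /orP[] /eqP ->.
congr EFin; rewrite big_ord1 ltn0 cat0s lognormal_exponent_unit /pair_sum.
rewrite !big_cons !big_nil/= !expr0 !mulr1 !addr0 !rho_refl// (rho_sym u s).
by congr expR; field.
Qed.

(** Second moments increase with [n] by [cascade_mass_gap]. The passage to the limit must not lose a
    constant factor here, so x^2 <= (1 + de) y^2 + (1 + 1/de) (x - y)^2 is used with [de] tending to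
    0. *)
Lemma limit_second_moment t A : 0 <= t <= 1 -> is_mass_limit t A ->
  (\int[P]_w (A w ^+ 2)%:E < +oo)%E /\
  (\int[P]_w (cascade_mass 0 t w ^+ 2)%:E <= \int[P]_w (A w ^+ 2)%:E)%E.
Proof.
move=> /andP[t0 t1] lA; have [mA A0 _] := lA.
have sqE (f : Omega -> R) : (forall w, 0 <= f w) ->
    (\int[P]_w (f w `^ 2%:R)%:E = \int[P]_w (f w ^+ 2)%:E)%E.
  by move=> f0; apply: eq_integral => w _; rewrite powR_mulrn.
have [tz|tn0] := eqVneq t 0.
  have m00 w : cascade_mass 0 t w = 0.
    by rewrite tz /cascade_mass /cascade_integral set_itv1 integral_set1.
  rewrite [X in (X <= _)%E]integral0_eq; last by move=> w _; rewrite m00 expr0n.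
  split; last by apply: integral_ge0 => w _; rewrite lee_fin exprn_ge0.
  have two : 0 < (2%:R : R) <= k%:R by rewrite ltr0n ler_nat.
  rewrite -(sqE A A0).
  apply: le_lt_trans (@limit_power_le t A 2%:R 0 0 lA two _) _; last exact: ltry.
  move=> n _; rewrite integral0_eq// => w _.
  by rewrite tz /cascade_mass /cascade_integral set_itv1 integral_set1/= powR0// pnatr_eq0.
have t_gt0 : 0 < t by rewrite lt_neqAle eq_sym tn0.
have two : 0 < (2%:R : R) <= k%:R by rewrite ltr0n ler_nat.
have [m [tm tm1]] : exists m, t * b ^+ m <= 1 /\ 1 < t * b ^+ m.+1.
  by apply: level_exists; rewrite t_gt0.
have k2' : (0 < 2 <= k)%N by [].
have [c c0 H] := mass_moment_bound k2'.
have finA : (\int[P]_w (A w ^+ 2)%:E < +oo)%E.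
  rewrite -(sqE A A0); apply: le_lt_trans (limit_power_le (B := c * t ^+ 2 *
    expR (v / 2 * (2%:R ^+ 2 - 2%:R)) ^+ m) (n1 := m) lA two _) _; last exact: ltry.
  move=> n mn; rewrite (sqE _ (cascade_mass_ge0 n t)).
  exact: H t0 tm tm1 (leqW mn).
split=> //.
have my n : measurable_fun setT (cascade_mass n t) by exact: measurable_cascade_mass.
have y0 n w : 0 <= cascade_mass n t w by exact: cascade_mass_ge0.
have finn n : (m <= n)%N -> (\int[P]_w (cascade_mass n t w ^+ 2)%:E < +oo)%E.
  by move=> mn; apply: le_lt_trans (H t m n t0 tm tm1 (leqW mn)) _; exact: ltry.
have fin0 : (\int[P]_w (cascade_mass 0 t w ^+ 2)%:E < +oo)%E.
  rewrite first_mass_second_moment//.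
  apply: (@le_lt_trans _ _ (\int[mu]_(s in `[0%R, t]) \int[mu]_(u in `[0%R, t]) (expR v)%:E)%E).
    apply: ge0_le_int => s /=; rewrite in_itv/= => /andP[s0 _].
      by apply: integral_ge0 => u _; rewrite lee_fin expR_ge0.
    apply: ge0_le_int => u /=; rewrite in_itv/= lee_fin => /andP[u0 _].
      exact: expR_ge0.
    by rewrite ler_expR ler_piMr ?rho1// ltW.
  under eq_integral do rewrite integral_cst//= [X in (_ * X)%E](mu_segment t0) -EFinM.
  by rewrite integral_cst//= [X in (_ * X)%E](mu_segment t0) -EFinM ltry.
have mono n : (m <= n)%N ->
    (\int[P]_w (cascade_mass 0 t w ^+ 2)%:E <= \int[P]_w (cascade_mass n t w ^+ 2)%:E)%E.
  move=> mn; have h := cascade_mass_gap t0 (leqnn 2) (leq0n n) fin0 (finn n mn).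
  have : (0 <= (fine (\int[P]_w (cascade_mass n t w ^+ 2)%:E) -
      fine (\int[P]_w (cascade_mass 0 t w ^+ 2)%:E))%:E)%E.
    by apply: le_trans h; apply: integral_ge0 => w _; rewrite lee_fin exprn_ge0.
  have fn p : (\int[P]_w (cascade_mass p t w ^+ 2)%:E < +oo)%E ->
      (\int[P]_w (cascade_mass p t w ^+ 2)%:E \is a fin_num)%E.
    by move=> fp; rewrite ge0_fin_numE// integral_ge0// => w _; rewrite lee_fin exprn_ge0.
  by rewrite lee_fin subr_ge0 -lee_fin !fineK ?fn// finn.
apply/lee_addgt0Pr => eps eps0.
have fA : (\int[P]_w (A w ^+ 2)%:E \is a fin_num)%E.
  by rewrite ge0_fin_numE// integral_ge0// => w _; rewrite lee_fin exprn_ge0.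
pose S := fine (\int[P]_w (A w ^+ 2)%:E)%E.
have S0 : 0 <= S by apply/fine_ge0/integral_ge0 => w _; rewrite lee_fin exprn_ge0.
have SE : (\int[P]_w (A w ^+ 2)%:E)%E = S%:E by rewrite fineK.
(* This makes [de * S] at most half of [eps]; the other half pays for the distance between the mass
   and the limit. *)
pose de := eps / 2 / (S + 1).
have de0 : 0 < de by rewrite !divr_gt0// ltr_wpDl.
have di0 : 0 < 1 + de^-1 by rewrite addr_gt0// invr_gt0.
have [n0 H0] := mass_limit_cvg lA two (divr_gt0 (divr_gt0 eps0 (ltr0n _ 2)) di0).
pose n := maxn m n0.
apply: (le_trans (mono n (leq_maxl _ _))).
have mA2 : measurable_fun setT (fun w => A w ^+ 2) by exact: measurable_funX.
have mD2 : measurable_fun setT (fun w => `|cascade_mass n t w - A w| ^+ 2).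
  by apply: measurable_funX; apply: measurableT_comp => //; exact: measurable_funB.
have A20 w : 0 <= A w ^+ 2 by rewrite exprn_ge0.
have D20 w : 0 <= `|cascade_mass n t w - A w| ^+ 2 by rewrite exprn_ge0.
apply: (@le_trans _ _ (\int[P]_w ((1 + de) * A w ^+ 2 +
    (1 + de^-1) * `|cascade_mass n t w - A w| ^+ 2)%:E)%E).
  apply: ge0_int_le => w; rewrite exprn_ge0//= real_normK ?num_real//.
  move: (cascade_mass n t w) (A w) => x y.
  have : 0 <= de * (y - de^-1 * (x - y)) ^+ 2 by rewrite mulr_ge0 ?sqr_ge0// ltW.
  have -> : de * (y - de^-1 * (x - y)) ^+ 2 =
      (1 + de) * y ^+ 2 + (1 + de^-1) * (x - y) ^+ 2 - x ^+ 2.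
    by field; rewrite gt_eqF.
  by rewrite subr_ge0.
rewrite (ge0_int_add P (f := fun w => (1 + de) * A w ^+ 2)
  (g := fun w => (1 + de^-1) * `|cascade_mass n t w - A w| ^+ 2)); last 4 first.
- exact: measurable_funM.
- by move=> w; rewrite mulr_ge0// addr_ge0// ltW.
- exact: measurable_funM.
- by move=> w; rewrite mulr_ge0// ltW.
rewrite (ge0_int_scale P _ mA2 A20); last by rewrite addr_ge0// ltW.
rewrite (ge0_int_scale P (ltW di0) mD2 D20).
have Hn : (\int[P]_w (`|cascade_mass n t w - A w| ^+ 2)%:E <=
    (eps / 2 / (1 + de^-1))%:E)%E.
  by rewrite -(sqE (fun w => `|cascade_mass n t w - A w|)) ?H0 ?leq_maxr.
apply: le_trans (leeD2l _ (lee_wpmul2l _ Hn)) _; first by rewrite lee_fin ltW.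
rewrite SE -!EFinM -!EFinD lee_fin mulrDl mul1r -addrA lerD2l.
rewrite [X in _ + X]mulrC divfK ?gt_eqF//.
have : de * S <= eps / 2.
  rewrite /de mulrAC ler_pdivrMr ?ltr_wpDl// ler_wpM2l ?divr_ge0 ?(ltW eps0)// lerDl//.
lra.
Qed.

End cascade_moments.

(** * Gaussian laws and independent copies *)

Section layer_cake.
Context d (T : measurableType d) (R : realType).
Variable m : {sigma_finite_measure set T -> \bar R}.
Implicit Types f Z : T -> R.
Local Notation mu := (@lebesgue_measure R).

(** Passes from events to functions: the density of the normal law and the independence of the
    layers are both given on sets. The weight [Z] carries the factors not yet decomposed. *)
Lemma layer_cake Z f : measurable_fun setT Z -> (forall w, 0 <= Z w) ->
  measurable_fun setT f -> (forall w, 0 <= f w) ->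
  (\int[m]_w (Z w * f w)%:E = \int[mu]_(x in `[0%R, +oo[)
     \int[m]_w (Z w * \1_[set w | (x < f w)%R] w)%:E)%E.
Proof.
move=> mZ Z0 mf f0.
pose A := [set p : R * T | p.1 < f p.2].
have mA : measurable A.
  have /(_ measurableT [set true]) : measurable_fun setT (fun p : R * T => p.1 < f p.2).
    apply: measurable_fun_ltr => //.
    by apply: (measurableT_comp mf); exact: measurable_snd.
  by rewrite setTI; exact.
pose h (p : R * T) : \bar R := (Z p.2 * \1_A p)%:E.
have mh : measurable_fun setT h.
  apply/measurable_EFinP; apply: measurable_funM; last exact: measurable_indic.
  by apply: (measurableT_comp mZ); exact: measurable_snd.
have h0 x y : `[0, +oo[%classic x -> setT y -> (0 <= h (x, y))%E.
  by move=> _ _; rewrite lee_fin mulr_ge0.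
have mD : measurable (`[0, +oo[%classic : set R) by [].
have := tonelli_in mu m mD measurableT mh h0; rewrite /h/= => H.
rewrite (_ : (\int[mu]_(x in _) _)%E =
  (\int[mu]_(x in `[0%R, +oo[) \int[m]_y (Z y * \1_A (x, y))%:E)%E); last first.
  by apply: eq_integral => x _.
rewrite H; apply: eq_integral => w _.
under eq_integral do rewrite EFinM.
have mi : measurable_fun (`[0, +oo[%classic : set R) (fun x => (\1_A (x, w) : R)%:E).
  apply/measurable_EFinP/measurable_funTS.
  by apply: (measurable_fun_pair1 (f := \1_A : R * T -> R)); exact: measurable_indic.
rewrite ge0_integralZl ?lee_fin//.
rewrite EFinM; congr (_ * _)%E.
have mB : measurable [set x | x < f w] by rewrite -set_itvNyo; exact: measurable_itv.
transitivity (\int[mu]_(x in `[0%R, +oo[) (\1_[set x | (x < f w)%R] x)%:E)%E; last first.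
  by apply: eq_integral => x _.
rewrite integral_indic//.
have -> : [set x | x < f w] `&` `[0, +oo[ = `[0, f w[%classic.
  apply/seteqP; split=> x /=; rewrite !in_itv/= andbT; first by move=> [-> ->].
  by move=> /andP[-> ->].
suff H2 : mu `[0, f w[%classic = (f w)%:E by exact: (esym H2).
rewrite lebesgue_measure_itv/= lte_fin; case: ifPn; first by rewrite -EFinB subr0.
by move=> h1; congr EFin; apply/eqP; rewrite eq_le f0 leNgt h1.
Qed.

End layer_cake.

Section laws.
Context d (Omega : measurableType d) (R : realType) (P : probability Omega R).
Context dT (T : measurableType dT).

Lemma ge0_integral_law (U : Omega -> T) (nu : {measure set T -> \bar R}) (f : T -> R) :
  measurable_fun setT U -> (forall B, measurable B -> P (U @^-1` B) = nu B) ->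
  measurable_fun setT f -> (forall x, 0 <= f x) ->
  (\int[P]_w (f (U w))%:E = \int[nu]_x (f x)%:E)%E.
Proof.
move=> mU law mf f0.
pose mfU := isMeasurableFun.Build _ _ _ _ U mU.
pose X : {RV P >-> T} := HB.pack U mfU.
have mfe : measurable_fun setT (fun x => (f x)%:E) by exact/measurable_EFinP.
have f0e x : (0 <= (f x)%:E)%E by rewrite lee_fin.
transitivity (\int[distribution P X]_x (f x)%:E)%E.
  by rewrite (ge0_integral_distribution X mfe f0e).
by apply: eq_measure_integral => B mB _; exact: law.
Qed.

Context d' (Omega' : measurableType d') (P' : probability Omega' R).

Lemma ge0_integral_same_law (U : Omega -> T) (U' : Omega' -> T) (f : T -> R) :
  measurable_fun setT U -> measurable_fun setT U' ->
  (forall B, measurable B -> P (U @^-1` B) = P' (U' @^-1` B)) ->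
  measurable_fun setT f -> (forall x, 0 <= f x) ->
  (\int[P]_w (f (U w))%:E = \int[P']_w (f (U' w))%:E)%E.
Proof.
move=> mU mU' law mf f0.
pose mfU := isMeasurableFun.Build _ _ _ _ U' mU'.
pose X : {RV P' >-> T} := HB.pack U' mfU.
have mfe : measurable_fun setT (fun x => (f x)%:E) by exact/measurable_EFinP.
have f0e x : (0 <= (f x)%:E)%E by rewrite lee_fin.
transitivity (\int[distribution P' X]_x (f x)%:E)%E.
  exact: (@ge0_integral_law U (distribution P' X)).
by rewrite (ge0_integral_distribution X mfe f0e).
Qed.

End laws.

Section gaussian_moments.
Context {R : realType}.
Local Notation mu := (@lebesgue_measure R).

Lemma integral_normal_prob (mean s : R) (f : R -> R) : s != 0 ->
  measurable_fun setT f -> (forall x, 0 <= f x) ->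
  (\int[normal_prob mean s]_x (f x)%:E =
   \int[mu]_x (normal_pdf mean s x * f x)%:E)%E.
Proof.
move=> s0 mf f0.
have mp := measurable_normal_pdf mean s.
have p0 := normal_pdf_ge0 mean s.
rewrite (layer_cake mu mp p0 mf f0).
have := layer_cake (normal_prob mean s) (measurable_cst (1 : R)) (fun=> ler01) mf f0.
under eq_integral do rewrite mul1r.
move=> ->; apply: eq_integral => x _.
have mB : measurable [set w | x < f w].
  have /(_ measurableT [set true]) : measurable_fun setT (fun w => x < f w).
    exact: measurable_fun_ltr.
  by rewrite setTI; exact.
under eq_integral do rewrite mul1r.
rewrite integral_indic// setIT /normal_prob [LHS]integral_mkcond.
apply: eq_integral => w _; rewrite patchE indicE.
by case: ifPn => h; rewrite ?mulr1 ?mulr0.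
Qed.

Lemma normal_prob_expR (mean s l : R) : s != 0 ->
  (\int[normal_prob mean s]_x (expR (l * x))%:E =
   (expR (l * mean + l ^+ 2 * s ^+ 2 / 2))%:E)%E.
Proof.
move=> s0.
have mf : measurable_fun setT (fun x : R => expR (l * x)).
  by apply: measurableT_comp => //; exact: measurable_funM.
rewrite (integral_normal_prob mean s0 mf (fun x => expR_ge0 _)).
set c := expR (_ + _).
transitivity (\int[mu]_x (c * normal_pdf (mean + l * s ^+ 2) s x)%:E)%E.
  apply: eq_integral => x _; congr EFin; rewrite !normal_pdfE// /normal_fun /c.
  rewrite [RHS]mulrCA -[LHS]mulrA -!expRD; congr (_ * expR _).
  by field.
rewrite (ge0_int_scale mu (expR_ge0 _) (measurable_normal_pdf _ _) (normal_pdf_ge0 _ _)).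
by rewrite integral_normal_pdf mule1.
Qed.

(** The tilted density is again normal, with standard deviation [s / sqrt (1 + l s^2)], up to the
    ratio of the peaks. Negative [l] is allowed, and both signs are used. *)
Lemma normal_prob_expR_sqr (s l : R) : s != 0 -> 0 < 1 + l * s ^+ 2 ->
  (\int[normal_prob 0 s]_x (expR (- (l * x ^+ 2 / 2)))%:E =
   ((Num.sqrt (1 + l * s ^+ 2))^-1)%:E)%E.
Proof.
move=> s0 l0.
have mf : measurable_fun setT (fun x : R => expR (- (l * x ^+ 2 / 2))).
  apply: measurableT_comp => //; apply: measurableT_comp => //.
  by apply: measurable_funM => //; apply: measurable_funM => //; exact: measurable_funX.
rewrite (integral_normal_prob 0 s0 mf (fun x => expR_ge0 _)).
set q := Num.sqrt _; have q0 : 0 < q by rewrite sqrtr_gt0.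
have q2 : q ^+ 2 = 1 + l * s ^+ 2 by rewrite sqr_sqrtr// ltW.
pose s' := s / q.
have s'0 : s' != 0 by rewrite mulf_neq0// invr_eq0 gt_eqF.
transitivity (\int[mu]_x (q^-1 * normal_pdf 0 s' x)%:E)%E.
  apply: eq_integral => x _; congr EFin; rewrite !normal_pdfE// /normal_fun.
  have -> : normal_peak s' = q * normal_peak s.
    have e : s' ^+ 2 * pi *+ 2 = q^-1 ^+ 2 * (s ^+ 2 * pi *+ 2).
      by rewrite /s'; ring.
    rewrite /normal_peak e sqrtrM ?sqr_ge0// sqrtr_sqr gtr0_norm ?invr_gt0//.
    by rewrite invfM invrK.
  rewrite !mulrA mulVf ?gt_eqF// mul1r -[LHS]mulrA -expRD; congr (_ * expR _).
  by rewrite /s' exprMn exprVn q2; field; rewrite s0 gt_eqF.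
rewrite (ge0_int_scale mu _ (measurable_normal_pdf _ _) (normal_pdf_ge0 _ _)).
  by rewrite integral_normal_pdf mule1.
by rewrite invr_ge0 ltW.
Qed.

Context d (Omega : measurableType d) (P : probability Omega R).

(** [gaussian_rv] supplies a law with unknown parameters, which have to be matched with the known
    mean 0 and second moment [V]. Known exponential integrals of the law and the inequality e^x >= 1
    + x achieve this. *)
Lemma gaussian_laplace (U : Omega -> R) (V : R) : gaussian_rv P U ->
  P.-integrable setT (EFin \o U) -> (\int[P]_w (U w)%:E = 0)%E ->
  (\int[P]_w (U w ^+ 2)%:E = V%:E)%E ->
  (\int[P]_w (expR (U w))%:E = (expR (V / 2))%:E)%E.
Proof.
move=> [mU [mean [s law]]] iU EU EV.
have push (f : R -> R) : measurable_fun setT f -> (forall x, 0 <= f x) ->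
    (\int[P]_w (f (U w))%:E =
     if (s == 0)%R then (f mean)%:E else \int[normal_prob mean s]_x (f x)%:E)%E.
  move=> mf f0.
  case: ifPn => s0.
    rewrite (ge0_integral_law mU (nu := dirac mean) _ mf f0).
      by rewrite integral_dirac ?diracT ?mul1e//; exact/measurable_EFinP.
    by move=> B mB; have := law B mB; rewrite s0.
  have mU' : measurable_fun setT (U : Omega -> measurableTypeR R) by exact: mU.
  have mf' : measurable_fun setT (f : measurableTypeR R -> R) by exact: mf.
  apply: (ge0_integral_law mU' _ mf' f0) => B mB.
  by have := law B mB; rewrite (negbTE s0).
have mexp l : measurable_fun setT (fun x : R => expR (l * x)).
  by apply: measurableT_comp => //; exact: measurable_funM.
have laplace l : (\int[P]_w (expR (l * U w))%:E = (expR (l * mean + l ^+ 2 * s ^+ 2 / 2))%:E)%E.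
  rewrite (push _ (mexp l) (fun x => expR_ge0 _)); case: ifPn => [/eqP ->|s0].
    by rewrite expr0n/= mulr0 mul0r addr0.
  exact: normal_prob_expR.
(* [E exp(l U) >= 1 + l E U = 1] for both signs of [l] forces the parameter [mean] of
   the law to vanish. *)
have laplace_ge l : 0 <= l * mean + l ^+ 2 * s ^+ 2 / 2.
  rewrite -ler_expR expR0 -lee_fin -laplace.
  have -> : (1%:E = \int[P]_w (1 + l * U w)%:E)%E.
    under eq_integral do rewrite EFinD EFinM.
    rewrite integralD//=; last 2 first.
    - exact: finite_measure_integrable_cst.
    - exact: (integrableZl measurableT _ iU).
    by rewrite integral_cst//= probability_setT mule1 integralZl// EU mule0 adde0.
  apply: le_integral => //.
  - under eq_fun do rewrite EFinD EFinM.
    apply: integrableD => //; first exact: finite_measure_integrable_cst.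
    exact: (integrableZl measurableT _ iU).
  - apply/integrableP; split.
      by apply/measurable_EFinP; apply: measurableT_comp => //; exact: measurable_funM.
    under eq_integral do rewrite gee0_abs ?lee_fin ?expR_ge0//.
    by rewrite laplace ltry.
  - by move=> w _; rewrite lee_fin expR_ge1Dx.
have mean0 : mean = 0.
  apply/eqP; apply: contraT => mn0.
  have m2 : 0 < mean ^+ 2 by rewrite exprn_even_gt0.
  have s1 : 0 < s ^+ 2 + 1 by rewrite ltr_wpDl// sqr_ge0.
  have := laplace_ge (- mean / (s ^+ 2 + 1)).
  have -> : - mean / (s ^+ 2 + 1) * mean + (- mean / (s ^+ 2 + 1)) ^+ 2 * s ^+ 2 / 2 =
      - (mean ^+ 2 * (s ^+ 2 / 2 + 1) / (s ^+ 2 + 1) ^+ 2) by field; rewrite gt_eqF.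
  rewrite oppr_ge0 leNgt divr_gt0 ?exprn_gt0//.
  by rewrite mulr_gt0// ltr_wpDl// divr_ge0// sqr_ge0.
suff -> : V = s ^+ 2.
  have := laplace 1; rewrite mean0 mul1r expr1n mul1r add0r => <-.
  by apply: eq_integral => w _; rewrite mul1r.
have msq : measurable_fun setT (fun x : R => x ^+ 2) by exact: measurable_funX.
have [s0|s0] := eqVneq s 0.
  have := push _ msq (fun x => sqr_ge0 x); rewrite EV s0 eqxx mean0 => -[->].
  by rewrite expr0n.
have s2 : 0 < s ^+ 2 by rewrite exprn_even_gt0.
have V0 : 0 <= V.
  by rewrite -lee_fin -EV; apply: integral_ge0 => w _; rewrite lee_fin sqr_ge0.
(* Likewise [E exp(- l U^2 / 2) >= 1 - l V / 2] for small [l] of both signs identifies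
   [s ^+ 2] with [V]. *)
have key l : 0 < 1 + l * s ^+ 2 -> 1 - l * V / 2 <= (Num.sqrt (1 + l * s ^+ 2))^-1.
  have mE : measurable_fun setT (fun x : R => expR (- (l * x ^+ 2 / 2))).
    apply: measurableT_comp => //; apply: measurableT_comp => //.
    by apply: measurable_funM => //; exact: measurable_funM.
  move=> l0; rewrite -lee_fin -(normal_prob_expR_sqr s0 l0) -[X in normal_prob X]mean0.
  have := push _ mE (fun x => expR_ge0 _); rewrite (negbTE s0) => <-.
  have iU2 : P.-integrable setT (fun w => (U w ^+ 2)%:E).
    apply/integrableP; split; first by apply/measurable_EFinP; exact: measurable_funX.
    by under eq_integral do rewrite gee0_abs ?lee_fin ?sqr_ge0//; rewrite EV ltry.
  have -> : ((1 - l * V / 2)%:E = \int[P]_w (1 - l / 2 * U w ^+ 2)%:E)%E.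
    under eq_integral do rewrite EFinB EFinM.
    rewrite integralB//=; last 2 first.
    - exact: finite_measure_integrable_cst.
    - exact: (integrableZl measurableT _ iU2).
    rewrite integral_cst//= probability_setT mule1 integralZl// EV -EFinM -EFinB.
    by congr EFin; ring.
  apply: le_integral => //.
  - under eq_fun do rewrite EFinB EFinM.
    apply: integrableB => //; first exact: finite_measure_integrable_cst.
    exact: (integrableZl measurableT _ iU2).
  - apply/integrableP; split.
      by apply/measurable_EFinP; exact: (measurableT_comp mE).
    under eq_integral do rewrite gee0_abs ?lee_fin ?expR_ge0//.
    have := push _ mE (fun x => expR_ge0 _); rewrite (negbTE s0) => ->.
    by rewrite mean0 normal_prob_expR_sqr// ltry.
  - move=> w _; rewrite lee_fin -[l / 2 * _]mulrAC; exact: expR_ge1Dx.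
pose r := V / s ^+ 2; have r0 : 0 <= r by rewrite divr_ge0// ltW.
(* To first order in [x] the left side is [1 + x (1 - r)]. Being at most 1 for small [x] of both
   signs forces [r = 1]. *)
have key2 x : -1 < x < 1 -> x * r < 2 -> (1 + x) * (1 - x * r / 2) ^+ 2 <= 1.
  move=> /andP[x1 x2] xr.
  have xs : x / s ^+ 2 * s ^+ 2 = x by rewrite divfK// gt_eqF.
  have x0 : 0 < 1 + x by lra.
  have := key (x / s ^+ 2); rewrite xs => /(_ x0).
  have -> : x / s ^+ 2 * V = x * r by rewrite /r mulrAC mulrA.
  set q := Num.sqrt _ => h; have q0 : 0 < q by rewrite sqrtr_gt0.
  have q2 : q ^+ 2 = 1 + x by rewrite sqr_sqrtr// ltW.
  have a0 : 0 <= 1 - x * r / 2 by lra.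
  rewrite -q2 -exprMn expr_le1//; last by rewrite mulr_ge0// ltW.
  by move: h; rewrite -[q^-1]mul1r ler_pdivlMr// mulrC.
suff r1 : r = 1 by rewrite -[LHS](@divfK _ (s ^+ 2)) ?gt_eqF// -/r r1 mul1r.
apply/eqP; rewrite eq_le; apply/andP; split; rewrite leNgt; apply/negP => hr.
(* With this [y] the higher-order terms take at most half of the first-order term [r - 1]. *)
- pose y := (r - 1) / (2 * (r + r ^+ 2)).
  have d0 : 0 < 2 * (r + r ^+ 2) by rewrite mulr_gt0// addr_gt0 ?exprn_gt0//; lra.
  have y0 : 0 < y by rewrite divr_gt0// subr_gt0.
  have yd : y * (r + r ^+ 2) = (r - 1) / 2.
    by apply: (@mulIf _ 2) => //; rewrite -mulrA [_ * 2]mulrC /y !divfK ?gt_eqF.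
  have y1 : y < 1 by rewrite ltr_pdivrMr// mul1r; nra.
  have xr : - y * r < 2 by nra.
  have := key2 (- y); rewrite ltrN2 y1 => /(_ _ xr) h.
  have {h} : (1 + - y) * (1 - - y * r / 2) ^+ 2 <= 1 by apply: h; rewrite /=; lra.
  have -> : (1 + - y) * (1 - - y * r / 2) ^+ 2 =
    1 + y * ((r - 1) - y * r + y * r ^+ 2 / 4 - y ^+ 2 * r ^+ 2 / 4) by field.
  rewrite gerDl pmulr_rle0// => h.
  have : 0 <= y * (1 - y) * r ^+ 2 by apply: mulr_ge0; [apply: mulr_ge0; lra|exact: sqr_ge0].
  have : 0 <= y * r ^+ 2 by rewrite mulr_ge0 ?sqr_ge0// ltW.
  have : y * (r + r ^+ 2) = y * r + y * r ^+ 2 by ring.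
  have : y * (1 - y) * r ^+ 2 = y * r ^+ 2 - y ^+ 2 * r ^+ 2 by ring.
  lra.
- pose y := (1 - r) / 2; have y0 : 0 < y by rewrite divr_gt0// subr_gt0.
  have y1 : -1 < y < 1 by apply/andP; split; rewrite /y; lra.
  have yr : y * r < 2 by rewrite /y; nra.
  have := key2 y y1 yr.
  have -> : (1 + y) * (1 - y * r / 2) ^+ 2 =
    1 + y * ((1 - r) - y * r + y * r ^+ 2 / 4 + y ^+ 2 * r ^+ 2 / 4) by field.
  rewrite gerDl pmulr_rle0// => h.
  have : 0 <= y * r ^+ 2 by rewrite mulr_ge0 ?sqr_ge0// ltW.
  have : 0 <= y ^+ 2 * r ^+ 2 by apply: mulr_ge0; exact: sqr_ge0.
  have : y * r <= y by rewrite ger_pMr// ltW.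
  have : y = (1 - r) / 2 by [].
  lra.
Qed.

End gaussian_moments.

Section independence.
Context d (Omega : measurableType d) (R : realType) (P : probability Omega R).
Variable X_ : nat -> R -> Omega -> R.
Hypothesis indep : independent_processes P X_.
Variable Z : nat -> Omega -> R.
Hypothesis mZ : forall j, measurable_fun setT (Z j).
Hypothesis Z0 : forall j w, 0 <= Z j w.
Hypothesis sZ : forall j (B : set R), measurable B -> process_sigma (X_ j) (Z j @^-1` B).
Local Notation mu := (@lebesgue_measure R).

Let gt_set j x : set Omega := [set w | x < Z j w].

Let gt_setE j x : gt_set j x = Z j @^-1` `]x, +oo[%classic.
Proof. by apply/seteqP; split=> w; rewrite /gt_set /= in_itv/= andbT. Qed.

Let measurable_gt j x : measurable (gt_set j x).
Proof. by rewrite gt_setE -[_ @^-1` _]setTI; exact: mZ. Qed.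

Let sigma_gt j x : process_sigma (X_ j) (gt_set j x).
Proof. by rewrite gt_setE; exact: sZ. Qed.

Let measurable_tail j :
  measurable_fun (`[0, +oo[%classic : set R) (fun x => P (gt_set j x)).
Proof.
pose A := [set p : R * Omega | p.1 < Z j p.2].
have mA : measurable A.
  have /(_ measurableT [set true]) : measurable_fun setT (fun p : R * Omega => p.1 < Z j p.2).
    apply: measurable_fun_ltr => //.
    by apply: (measurableT_comp (mZ j)); exact: measurable_snd.
  by rewrite setTI; exact.
have mh : measurable_fun setT (fun p : R * Omega => (\1_A p : R)%:E).
  by apply/measurable_EFinP; exact: measurable_indic.
have h0 x y : `[0, +oo[%classic x -> setT y -> (0 <= (fun p : R * Omega => (\1_A p : R)%:E) (x, y))%E.
  by move=> _ _; rewrite lee_fin.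
have mD : measurable (`[0, +oo[%classic : set R) by [].
have := measurable_int1 P mD measurableT mh h0.
apply: eq_measurable_fun => x _.
rewrite -[RHS](_ : (\int[P]_w (\1_(gt_set j x) w : R)%:E)%E = _)//.
by rewrite integral_indic// setIT.
Qed.

Let int_tail j : (\int[P]_w (Z j w)%:E = \int[mu]_(x in `[0%R, +oo[) P (gt_set j x))%E.
Proof.
have := layer_cake P (measurable_cst (1 : R)) (fun=> ler01) (mZ j) (Z0 j).
under eq_integral do rewrite mul1r.
move=> ->; apply: eq_integral => x _; under eq_integral do rewrite mul1r.
by rewrite integral_indic// ?setIT//; exact: measurable_gt.
Qed.

(** Hybrid form of independence: functions for the layers below [i], events for layers of index at
    least [i]. In the induction step the layer cake formula replaces [Z i] by the events [x < Z i],
    which join the events of [J]. *)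
Let claim i : forall (J : seq nat) (E : nat -> set Omega), uniq J ->
  (forall j, j \in J -> [/\ (i <= j)%N, measurable (E j) & process_sigma (X_ j) (E j)]) ->
  (\int[P]_w ((\prod_(j < i) Z j w) * \1_(\bigcap_(j in [set` J]) E j) w)%:E =
   (\prod_(j < i) \int[P]_w (Z j w)%:E) * \prod_(j <- J) P (E j))%E.
Proof.
elim: i => [|i IH] J E uJ HE.
  have mI : measurable (\bigcap_(j in [set` J]) E j).
    by apply: fin_bigcap_measurable => // j /= /HE[].
  under eq_integral do rewrite big_ord0 mul1r.
  rewrite big_ord0 mul1e integral_indic// setIT; apply: indep => // j /HE[]//.
have mI : measurable (\bigcap_(j in [set` J]) E j).
  by apply: fin_bigcap_measurable => // j /= /HE[].
pose Q w := (\prod_(j < i) Z j w) * \1_(\bigcap_(j in [set` J]) E j) w.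
have mQ : measurable_fun setT Q.
  by apply: measurable_funM; [exact: measurable_prod|exact: measurable_indic].
have Q0 w : 0 <= Q w by rewrite mulr_ge0// prodr_ge0.
transitivity (\int[P]_w (Q w * Z i w)%:E)%E.
  by apply: eq_integral => w _; rewrite big_ord_recr/= mulrAC.
rewrite (layer_cake P mQ Q0 (mZ i) (Z0 i)) big_ord_recr/= -muleA (int_tail i).
set c := (\prod_(j < i) _)%E; set e := (\prod_(j <- J) _)%E.
have c0 : (0 <= c)%E.
  by apply: prode_ge0 => j _; apply: integral_ge0 => w _; rewrite lee_fin.
have e0 : (0 <= e)%E by apply: prode_ge0.
rewrite [X in (c * X)%E]muleC muleA.
rewrite -ge0_integralZl//; last 2 first.
- exact: measurable_tail.
- by rewrite mule_ge0.
apply: eq_integral => x _.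
pose E' j := if j == i then gt_set i x else E j.
have iJ : i \notin J by apply/negP => /HE[]; rewrite ltnn.
have E'J j : j \in J -> E' j = E j.
  by move=> jJ; rewrite /E'; case: eqP => // ji; rewrite ji (negbTE iJ) in jJ.
have := IH (i :: J) E'; rewrite /= iJ uJ => /(_ isT) {}IH.
rewrite (_ : (\int[P]_w _)%E = (\int[P]_w ((\prod_(j < i) Z j w) *
    \1_(\bigcap_(j in [set` i :: J]) E' j) w)%:E)%E).
  rewrite IH.
    rewrite big_cons {1}/E' eqxx (_ : (\prod_(j <- J) P (E' j))%E = e).
      by rewrite [X in (c * X)%E]muleC muleA.
    by rewrite /e big_seq [RHS]big_seq; apply: eq_bigr => j jJ; rewrite E'J.
  move=> j; rewrite inE => /predU1P[->|jJ].
    by rewrite /E' eqxx; split.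
  by rewrite E'J//; have [ij mE sE] := HE _ jJ; split=> //; exact: ltnW.
apply: eq_integral => w _; rewrite /Q -mulrA; congr (_ * _)%:E.
have -> : \bigcap_(j in [set` i :: J]) E' j = (\bigcap_(j in [set` J]) E j) `&` gt_set i x.
  apply/seteqP; split=> u /=.
    move=> h; split; last by have := h i; rewrite /= inE eqxx /E' eqxx; exact.
    by move=> j /= jJ; rewrite -E'J//; apply: h; rewrite /= inE jJ orbT.
  move=> [h1 h2] j /=; rewrite inE => /predU1P[->|jJ]; first by rewrite /E' eqxx.
  by rewrite E'J//; exact: h1.
by rewrite indicI.
Qed.

Lemma expectation_prod_independent n :
  (\int[P]_w (\prod_(j < n) Z j w)%:E = \prod_(j < n) \int[P]_w (Z j w)%:E)%E.
Proof.
have := @claim n [::] (fun=> setT) isT; rewrite big_nil mule1 => <- //.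
apply: eq_integral => w _; congr (_%:E).
rewrite (_ : \bigcap_(j in _) _ = setT) ?indicT ?mulr1//.
by apply/seteqP; split=> u // _ j.
Qed.

End independence.

Section processes.
Context d (Omega : measurableType d) (R : realType) (P : probability Omega R).
Implicit Types X : R -> Omega -> R.

Let time_domain : set (R * Omega) := `[0, +oo[%classic `*` setT.

Let measurable_patch X : measurable_process X ->
  measurable_fun setT ((fun p : R * Omega => X p.1 p.2) \_ time_domain).
Proof.
by move=> mX; apply/(measurable_restrictT _ _).1 => //; exact: measurableX.
Qed.

Let patch_time X s w : 0 <= s ->
  ((fun p : R * Omega => X p.1 p.2) \_ time_domain) (s, w) = X s w.
Proof. by move=> s0; rewrite patchE mem_set//; split=> //=; rewrite in_itv/= s0. Qed.

Lemma measurable_process_time X t : measurable_process X -> 0 <= t ->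
  measurable_fun setT (X t).
Proof.
move=> /measurable_patch mX t0.
rewrite (_ : X t = fun w => ((fun p : R * Omega => X p.1 p.2) \_ time_domain) (t, w)).
  exact: (measurable_fun_pair2 (f := (fun p : R * Omega => X p.1 p.2) \_ time_domain)).
by apply/funext => w; rewrite patch_time.
Qed.

(** The copies of the process are positive only almost surely, and measurable only
    on nonnegative times. *)
Definition positive_version X (s : R) (w : Omega) : R :=
  if (0 <= s) && (0 < X s w) then X s w else 1.

Lemma positive_version_gt0 X s w : 0 < positive_version X s w.
Proof. by rewrite /positive_version; case: ifP => // /andP[]. Qed.

(** Not the usual positive part: values that are not positive are sent to 1, so that all real powers
    stay positive. *)
Definition positive_part (x : R) : R := if 0 < x then x else 1.

Let measurable_positive_part : measurable_fun setT positive_part.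
Proof. by apply: measurable_fun_ifT => //; exact: measurable_fun_ltr. Qed.

Let positive_versionE X s w : 0 <= s -> positive_version X s w = positive_part (X s w).
Proof. by move=> s0; rewrite /positive_version s0. Qed.

Lemma measurable_positive_version X : measurable_process X ->
  measurable_fun setT (fun p : R * Omega => positive_version X p.1 p.2).
Proof.
move=> mX.
have mXD := measurable_patch mX.
have mind : measurable_fun setT (fun p : R * Omega => 0 <= p.1).
  by apply: measurable_fun_ler.
rewrite (_ : (fun p => _) = (fun p : R * Omega => if 0 <= p.1 then
    positive_part (((fun p => X p.1 p.2) \_ time_domain) p) else 1)).
  by apply: measurable_fun_ifT => //; exact: (measurableT_comp measurable_positive_part mXD).
apply/funext => -[s w]/=; rewrite /positive_version; case: (leP 0 s) => s0//=.
by rewrite patch_time.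
Qed.

Lemma process_sigma_power_product X L (B : set R) :
  (forall x, x \in L -> 0 <= x.1) -> measurable B ->
  process_sigma X ((power_product (positive_version X) L) @^-1` B).
Proof.
move=> L0 mB.
(* [Omega] is regarded as a measurable space for the sigma-algebra of the process, which turns
   membership in [process_sigma] into ordinary measurability. *)
pose G : set (set Omega) :=
  \bigcup_(t in `[0, +oo[) preimage_set_system setT (X t) measurable.
have mXs t : 0 <= t -> measurable_fun setT (X t : g_sigma_algebraType G -> R).
  move=> t0 _ C mC; apply: sub_sigma_algebra; exists t; first by rewrite /= in_itv/= t0.
  by exists C.
have mPs : measurable_fun setT
    (power_product (positive_version X) L : g_sigma_algebraType G -> R).
  rewrite /power_product; elim: L L0 => [|x L IH] L0.
    by under eq_fun do rewrite big_nil; exact: measurable_cst.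
  under eq_fun do rewrite big_cons; apply: measurable_funM; last first.
    by apply: IH => y yL; apply: L0; rewrite inE yL orbT.
  apply: (measurableT_comp (measurable_powR x.2)).
  have x0 : 0 <= x.1 by apply: L0; rewrite inE eqxx.
  have := measurableT_comp measurable_positive_part (mXs _ x0).
  by apply: eq_measurable_fun => w _; rewrite /= positive_versionE.
by have := mPs measurableT B mB; rewrite setTI.
Qed.

Lemma measurable_power_product X L : measurable_process X ->
  measurable_fun setT (power_product (positive_version X) L).
Proof.
move=> mX; apply: measurable_prod => x _.
apply: (measurableT_comp (measurable_powR x.2)).
apply: (measurable_fun_pair2 (f := fun p : R * Omega => positive_version X p.1 p.2)).
exact: measurable_positive_version.
Qed.

Context d' (Omega' : measurableType d') (P' : probability Omega' R).

Lemma same_fdd_power_product X (Y : R -> Omega' -> R) L :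
  (forall t, 0 <= t -> measurable_fun setT (X t)) ->
  (forall t, 0 <= t -> measurable_fun setT (Y t)) ->
  same_fdd P X P' Y -> (forall x, x \in L -> 0 <= x.1) ->
  (\int[P]_w (\prod_(x <- L) positive_part (X x.1 w) `^ x.2)%:E =
   \int[P']_w (\prod_(x <- L) positive_part (Y x.1 w) `^ x.2)%:E)%E.
Proof.
move=> mX mY fdd L0.
pose n := size L.
pose ts : n.-tuple R := [tuple (nth (0, 0) L i).1 | i < n].
have ts0 i : 0 <= tnth ts i by rewrite tnth_mktuple; apply/L0/mem_nth.
pose phi (x : n.-tuple R) : R :=
  \prod_(i < n) positive_part (tnth x i) `^ (nth (0, 0) L i).2.
have mphi : measurable_fun setT phi.
  apply: measurable_prod => i _; apply: (measurableT_comp (measurable_powR _)).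
  by apply: (measurableT_comp measurable_positive_part); exact: measurable_tnth.
have phi0 x : 0 <= phi x by apply: prodr_ge0 => i _; exact: powR_ge0.
pose U w := [tuple X (tnth ts i) w | i < n].
pose U' w := [tuple Y (tnth ts i) w | i < n].
have mU : measurable_fun setT U.
  apply/measurable_fun_tnthP => i; rewrite (_ : _ \o _ = X (tnth ts i)); first exact: mX.
  by apply/funext => w /=; rewrite tnth_mktuple.
have mU' : measurable_fun setT U'.
  apply/measurable_fun_tnthP => i; rewrite (_ : _ \o _ = Y (tnth ts i)); first exact: mY.
  by apply/funext => w /=; rewrite tnth_mktuple.
have law B : measurable B -> P (U @^-1` B) = P' (U' @^-1` B) by exact: fdd.
transitivity (\int[P]_w (phi (U w))%:E)%E.
  apply: eq_integral => w _; congr EFin; rewrite (big_nth (0, 0)) big_mkord.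
  by apply: eq_bigr => i _; rewrite !tnth_mktuple.
rewrite (ge0_integral_same_law mU mU' law mphi phi0).
apply: eq_integral => w _; congr EFin; rewrite [RHS](big_nth (0, 0)) big_mkord.
by apply: eq_bigr => i _; rewrite !tnth_mktuple.
Qed.

End processes.

(** * Correlation functions *)

Section gaussian_correlation.
Context d (Omega : measurableType d) (R : realType) (P : probability Omega R).
Variables (X : R -> Omega -> R) (sX : R).
Hypothesis X_measurable : measurable_process X.
Hypothesis X_gaussian : gaussian_process P X.
Hypothesis X_mean : zero_mean_process P X.
Hypothesis sX_gt0 : 0 < sX.
Hypothesis X_variance : forall t : R, 0 <= t -> 'V_P[X t]%E = (sX ^+ 2)%:E.

Let v := sX ^+ 2.
Let v0 : 0 < v. Proof. by rewrite exprn_gt0. Qed.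
Let rho s u := correlation P (X s) (X u).

Let mX t : 0 <= t -> measurable_fun setT (X t).
Proof. exact: measurable_process_time. Qed.

Let covE s u : 0 <= s -> 0 <= u ->
  (covariance P (X s) (X u) = \int[P]_w (X s w * X u w)%:E)%E.
Proof.
move=> s0 u0; rewrite unlock !X_mean//= unlock.
by apply: eq_integral => w _; congr EFin; rewrite -[LHS]/((X s w - 0) * (X u w - 0)) !subr0.
Qed.

Let second_moment t : 0 <= t -> (\int[P]_w (X t w ^+ 2)%:E = v%:E)%E.
Proof.
move=> t0; rewrite -(X_variance t0) /variance covE//.
Qed.

Let integrable_prod s u : 0 <= s -> 0 <= u ->
  P.-integrable setT (fun w => (X s w * X u w)%:E).
Proof.
move=> s0 u0; apply/integrableP; split.
  by apply/measurable_EFinP; apply: measurable_funM; exact: mX.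
apply: (@le_lt_trans _ _ (\int[P]_w (X s w ^+ 2 + X u w ^+ 2)%:E)%E).
  apply: ge0_le_int => w _; first exact: abse_ge0.
  rewrite abse_EFin lee_fin ler_norml; apply/andP; split; nra.
rewrite (ge0_int_add P (f := fun w => X s w ^+ 2) (g := fun w => X u w ^+ 2)).
- by rewrite !second_moment// ltry.
- by apply: measurable_funX; exact: mX.
- by move=> w; exact: sqr_ge0.
- by apply: measurable_funX; exact: mX.
- by move=> w; exact: sqr_ge0.
Qed.

Let integrable_X t : 0 <= t -> P.-integrable setT (fun w => (X t w)%:E).
Proof.
move=> t0; apply/integrableP; split; first by apply/measurable_EFinP; exact: mX.
apply: (@le_lt_trans _ _ (\int[P]_w (1 + X t w ^+ 2)%:E)%E).
  apply: ge0_le_int => w _; first exact: abse_ge0.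
  rewrite abse_EFin lee_fin ler_norml; apply/andP; split; nra.
rewrite (ge0_int_add P (f := fun=> 1) (g := fun w => X t w ^+ 2)).
- by rewrite second_moment// integral_cst//= probability_setT mule1 ltry.
- exact: measurable_cst.
- by [].
- by apply: measurable_funX; exact: mX.
- by move=> w; exact: sqr_ge0.
Qed.

Lemma integral_process_prod s u : 0 <= s -> 0 <= u ->
  (\int[P]_w (X s w * X u w)%:E = (v * rho s u)%:E)%E.
Proof.
move=> s0 u0; rewrite /rho /correlation !X_variance//= -expr2 sqrtr_sqr.
rewrite ger0_norm ?(ltW v0)// mulrC divfK ?gt_eqF// covE// fineK//.
exact: integrable_fin_num (integrable_prod s0 u0).
Qed.

Lemma correlation_refl s : 0 <= s -> rho s s = 1.
Proof.
move=> s0; have := second_moment s0; rewrite integral_process_prod// => -[] h.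
by apply: (@mulfI _ v); rewrite ?gt_eqF// mulr1.
Qed.

Lemma correlation_sym s u : rho s u = rho u s.
Proof. by rewrite /rho /correlation covarianceC [X in Num.sqrt X]mulrC. Qed.

(** Expansion of E (X_s - c X_u)^2 >= 0; the signs [c = 1] and [c = -1] give the two bounds on the
    correlation. *)
Let correlation_norm_le s u (c : R) : 0 <= s -> 0 <= u -> `|c| = 1 -> c * rho s u <= 1.
Proof.
move=> s0 u0 c1.
have c2 : c ^+ 2 = 1 by rewrite -real_normK ?num_real// c1 expr1n.
have : (0 <= \int[P]_w (X s w ^+ 2 + X u w ^+ 2 - 2 * c * (X s w * X u w))%:E)%E.
  apply: integral_ge0 => w _; rewrite lee_fin.
  have -> : X s w ^+ 2 + X u w ^+ 2 - 2 * c * (X s w * X u w) = (X s w - c * X u w) ^+ 2.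
    by rewrite sqrrB exprMn c2 mul1r; ring.
  exact: sqr_ge0.
have i2 : P.-integrable setT (fun w => ((2 * c)%:E * (X s w * X u w)%:E)%E).
  by apply: (integrableZl measurableT); exact: integrable_prod.
have iss : P.-integrable setT (fun w => (X s w ^+ 2)%:E) by exact: integrable_prod.
have iuu : P.-integrable setT (fun w => (X u w ^+ 2)%:E) by exact: integrable_prod.
rewrite (_ : (\int[P]_w _ = \int[P]_w ((X s w ^+ 2)%:E + (X u w ^+ 2)%:E -
    (2 * c)%:E * (X s w * X u w)%:E))%E) //.
rewrite (integralB measurableT (integrableD measurableT iss iuu) i2).
rewrite (integralD measurableT iss iuu) integralZl//; last exact: integrable_prod.
rewrite !second_moment// integral_process_prod// -EFinM.
rewrite -[X in (0 <= X)%E]/((v + v - 2 * c * (v * rho s u))%:E) lee_fin => h.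
rewrite -(ler_pM2l v0); nra.
Qed.

Lemma correlation_le1 s u : 0 <= s -> 0 <= u -> rho s u <= 1.
Proof.
by move=> s0 u0; have := correlation_norm_le s0 u0 (normr1 R); rewrite mul1r.
Qed.

Lemma correlation_geN1 s u : 0 <= s -> 0 <= u -> -1 <= rho s u.
Proof.
move=> s0 u0; have := @correlation_norm_le s u (-1) s0 u0.
by rewrite normrN1 mulN1r lerNl => /(_ erefl).
Qed.

(** By polarization [rho 0 |tau|] is an affine function of E (X_0 + X_|tau|)^2, whose integrand is
    nonnegative, so Tonelli's theorem gives measurability in [tau]. *)
Lemma measurable_correlation : measurable_fun setT (fun tau : R => rho 0 `|tau|).
Proof.
pose I (tau : R) : \bar R := (\int[P]_w ((X 0 w + X `|tau| w) ^+ 2)%:E)%E.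
have rhoE tau : rho 0 `|tau| = (2 * v)^-1 * fine (I tau) - 1.
  have T0 := normr_ge0 tau.
  have i1 : P.-integrable setT (fun w => (X 0 w ^+ 2)%:E) by exact: integrable_prod.
  have i2 : P.-integrable setT (fun w => (X `|tau| w ^+ 2)%:E) by exact: integrable_prod.
  have i3 : P.-integrable setT (fun w => (2%:E * (X 0 w * X `|tau| w)%:E)%E).
    by apply: (integrableZl measurableT); exact: integrable_prod.
  have -> : I tau = (\int[P]_w ((X 0 w ^+ 2)%:E + (X `|tau| w ^+ 2)%:E +
      2%:E * (X 0 w * X `|tau| w)%:E))%E.
    by apply: eq_integral => w _; congr EFin; rewrite -[RHS]/(X 0 w ^+ 2 +
      X `|tau| w ^+ 2 + 2 * (X 0 w * X `|tau| w)); ring.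
  rewrite (integralD measurableT (integrableD measurableT i1 i2) i3).
  rewrite (integralD measurableT i1 i2) integralZl//; last exact: integrable_prod.
  rewrite !second_moment// integral_process_prod//.
  rewrite -[fine _]/(v + v + 2 * (v * rho 0 `|tau|)).
  by field; rewrite gt_eqF.
rewrite (_ : (fun tau => _) = fun tau => (2 * v)^-1 * fine (I tau) - 1); last first.
  by apply/funext => tau; rewrite rhoE.
apply: measurable_funB => //; apply: measurable_funM => //.
apply: measurableT_comp; first exact: fine_measurable.
have mXn : measurable_fun setT (fun p : R * Omega => X `|p.1| p.2).
  have mN : measurable_fun setT (fun p : R * Omega => (`|p.1|, p.2)).
    by apply: measurable_fun_pair => //; exact: measurableT_comp.
  have mD : measurable ((`[0, +oo[%classic : set R) `*` [set: Omega]) by exact: measurableX.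
  have sub : (fun p : R * Omega => (`|p.1|, p.2)) @` setT `<=`
      (`[0, +oo[%classic : set R) `*` [set: Omega].
    by move=> _ [p _ <-]; split=> //=; rewrite in_itv/= normr_ge0.
  exact: (measurable_comp mD sub X_measurable mN).
have mS : measurable_fun setT (fun p : R * Omega => ((X 0 p.2 + X `|p.1| p.2) ^+ 2)%:E).
  apply/measurable_EFinP; apply: measurable_funX; apply: measurable_funD => //.
  by apply: measurableT_comp => //; exact: mX.
apply: (measurable_int1 P measurableT measurableT mS) => x y _ _.
by rewrite lee_fin sqr_ge0.
Qed.

(** The product is a constant times [expR (U w)], where [U] is a linear combination of values of
    [X], hence Gaussian and centred, with variance [V]. *)
Lemma lognormal_power_product (L : seq (R * R)) : (forall x, x \in L -> 0 <= x.1) ->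
  (\int[P]_w (\prod_(x <- L) positive_part (expR (X x.1 w - v / 2)) `^ x.2)%:E =
   (expR (lognormal_exponent rho v L))%:E)%E.
Proof.
move=> L0.
pose n := size L.
pose t i := (nth (0, 0) L i).1; pose c i := (nth (0, 0) L i).2.
have t0 (i : 'I_n) : 0 <= t i by apply/L0/mem_nth.
pose U w := \sum_(i < n) c i * X (t i) w.
have gU : gaussian_rv P U.
  have := @X_gaussian n [tuple t i | i < n] (fun i => c i).
  rewrite (_ : (fun w => _) = U); first by apply=> i; rewrite tnth_mktuple.
  by apply/funext => w; apply: eq_bigr => i _; rewrite tnth_mktuple.
have UE w : (\prod_(x <- L) positive_part (expR (X x.1 w - v / 2)) `^ x.2) =
    expR (- (v / 2 * \sum_(x <- L) x.2)) * expR (U w).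
  rewrite -expRD /U !(big_nth (0, 0)) !big_mkord.
  rewrite mulr_sumr -sumrN -big_split/= expR_sum; apply: eq_bigr => i _.
  by rewrite /positive_part expR_gt0 -expRM; congr expR; rewrite /c /t; ring.
under eq_integral do rewrite UE.
have mU : measurable_fun setT U.
  by apply: measurable_sum => i; apply: measurable_funM => //; exact: mX.
rewrite ge0_int_scale ?expR_ge0//; last by apply: measurableT_comp.
pose V := \sum_(i < n) \sum_(j < n) c i * c j * (v * rho (t i) (t j)).
rewrite (@gaussian_laplace _ _ _ P U V gU).
- rewrite -EFinM -expRD; congr (expR _)%:E.
  rewrite /lognormal_exponent mulrBr addrC; congr (_ - _).
  rewrite /V !(big_nth (0, 0)) !big_mkord mulr_suml mulr_sumr; apply: eq_bigr => i _.
  rewrite (big_nth (0, 0)) big_mkord mulr_suml mulr_sumr; apply: eq_bigr => j _.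
  by rewrite /c /t; field.
- rewrite (_ : EFin \o U = (fun w => \sum_(i < n) (c i)%:E * (X (t i) w)%:E)%E).
    by apply: integrable_sum => // i _; apply: integrableZl => //; exact: integrable_X.
  by apply/funext => w /=; rewrite -sumEFin.
- under eq_integral do rewrite -sumEFin.
  rewrite integral_sum//; last first.
    by move=> i; under eq_fun do rewrite EFinM; apply: (integrableZl measurableT); exact: integrable_X.
  rewrite big1// => i _; under eq_integral do rewrite EFinM.
  rewrite integralZl//; last exact: integrable_X.
  by have := X_mean (t0 i); rewrite unlock => ->; rewrite mule0.
- have U2 w : U w ^+ 2 = \sum_(p : 'I_n * 'I_n) c p.1 * c p.2 * (X (t p.1) w * X (t p.2) w).
    rewrite expr2 /U mulr_suml -(pair_bigA _ (fun i j : 'I_n => c i * c j * (X (t i) w * X (t j) w)))/=.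
    apply: eq_bigr => i _; rewrite mulr_sumr; apply: eq_bigr => j _; ring.
  under eq_integral do rewrite U2 -sumEFin.
  rewrite integral_sum//; last first.
    move=> p; under eq_fun do rewrite EFinM.
    by apply: (integrableZl measurableT); exact: integrable_prod.
  rewrite /V (pair_bigA _ (fun i j : 'I_n => c i * c j * (v * rho (t i) (t j))))/= -sumEFin.
  apply: eq_bigr => p _; under eq_integral do rewrite EFinM.
  rewrite integralZl//; last exact: integrable_prod.
  by rewrite integral_process_prod// -EFinM.
Qed.

End gaussian_correlation.

Section correlation_bounds.
Context d (Omega : measurableType d) (R : realType) (P : probability Omega R).
Variables (X : R -> Omega -> R) (sX C alpha a0 : R).
Hypothesis X_measurable : measurable_process X.
Hypothesis X_mean : zero_mean_process P X.
Hypothesis sX_gt0 : 0 < sX.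
Hypothesis X_variance : forall t : R, 0 <= t -> 'V_P[X t]%E = (sX ^+ 2)%:E.
Hypotheses (C_gt0 : 0 < C) (alpha_gt0 : 0 < alpha) (a0_gt0 : 0 < a0).
Let rho s u := correlation P (X s) (X u).

(** Below the threshold [M'] the correlation is at most 1, and 1 is at most M'^alpha times the
    required power of the distance; this is the second summand of the constant. *)
Lemma correlation_le_power :
  (\forall tau \near +oo%R, forall t : R, 0 <= t ->
     correlation P (X t) (X (t + tau)) <= C * tau `^ (- alpha)) ->
  exists2 Cl, 0 < Cl & forall s u, 0 <= s -> 0 <= u -> s != u ->
    rho s u <= Cl * `|s - u| `^ (- alpha).
Proof.
move=> [M [_ HM]]; pose M' := Num.max M 1.
have M'0 : 0 < M' by rewrite lt_max ltr01 orbT.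
have Cl0 : 0 < C + M' `^ alpha by rewrite ltr_wpDr ?powR_ge0.
exists (C + M' `^ alpha) => //.
have main s u : 0 <= s -> s < u -> rho s u <= (C + M' `^ alpha) * (u - s) `^ (- alpha).
  move=> s0 su; have D0 : 0 < u - s by rewrite subr_gt0.
  case: (ltP M (u - s)) => [MD|DM].
    have := HM _ MD s s0; rewrite subrKC => /le_trans; apply.
    by rewrite ler_wpM2r ?powR_ge0// lerDl powR_ge0.
  apply: (le_trans (correlation_le1 X_measurable X_mean sX_gt0 X_variance s0 (ltW (le_lt_trans s0 su)))).
  rewrite powRN -ler_pdivrMr ?invr_gt0 ?powR_gt0// invrK mul1r.
  apply: (@le_trans _ _ (M' `^ alpha)); last by rewrite lerDr ltW.
  by apply: ge0_ler_powR; rewrite ?nnegrE ?(ltW alpha_gt0) ?(ltW D0) ?(ltW M'0)// le_max DM.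
move=> s u s0 u0; case: (ltgtP s u) => // su _.
  by rewrite distrC gtr0_norm ?subr_gt0//; exact: main.
by rewrite gtr0_norm ?subr_gt0// /rho (correlation_sym P X s u); exact: main.
Qed.

(** At distances of at least [del] the deviation is at most 2, which is bounded by 2 (s / del)^a0;
    this explains the added term in the constant. *)
Lemma correlation_ge_power :
  (\forall tau \near (0 : R), forall t : R, 0 <= t -> 0 <= t + tau ->
     1 - correlation P (X t) (X (t + tau)) <= C * `|tau| `^ a0) ->
  exists2 Cs, 0 < Cs & forall s, 0 <= s <= 1 -> 1 - rho 0 s <= Cs * s `^ a0.
Proof.
move=> /nbhs_ballP[del /= del0 Hd].
exists (C + 2 * del `^ (- a0)); first by rewrite ltr_wpDr// mulr_ge0 ?powR_ge0.
move=> s /andP[s0 s1]; case: (ltP s del) => sd.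
  have := Hd s; rewrite /ball/= sub0r normrN ger0_norm// => /(_ sd 0 (lexx _)).
  rewrite add0r => /(_ s0) /le_trans; apply.
  by rewrite ler_wpM2r ?powR_ge0// lerDl mulr_ge0 ?powR_ge0.
have := correlation_geN1 X_measurable X_mean sX_gt0 X_variance (lexx 0) s0.
rewrite -/(rho 0 s) => h.
have : 1 <= del `^ (- a0) * s `^ a0.
  rewrite powRN mulrC ler_pdivlMr ?powR_gt0// mul1r.
  by apply: ge0_ler_powR; rewrite ?nnegrE ?(ltW a0_gt0) ?(ltW del0).
have : 0 <= C * s `^ a0 by rewrite mulr_ge0 ?powR_ge0// ltW.
nra.
Qed.

End correlation_bounds.

(** * Moments of the independent copies *)

Section copies.
Context d0 (Omega0 : measurableType d0) (R : realType) (P0 : probability Omega0 R).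
Context d (Omega : measurableType d) (P : probability Omega R).
Variables (X : R -> Omega0 -> R) (sX : R) (Lam : nat -> R -> Omega -> R).
Hypothesis X_measurable : measurable_process X.
Hypothesis X_gaussian : gaussian_process P0 X.
Hypothesis X_mean : zero_mean_process P0 X.
Hypothesis sX_gt0 : 0 < sX.
Hypothesis X_variance : forall t : R, 0 <= t -> 'V_P0[X t]%E = (sX ^+ 2)%:E.
Hypothesis Lam_copy : forall j : nat,
  process_copy P0 (fun t w => expR (X t w - sX ^+ 2 / 2)) P (Lam j).

Let mLam j : measurable_process (Lam j). Proof. by have [] := Lam_copy j. Qed.

(** Equality of one-dimensional laws transfers the positivity of an exponential, as a null event for
    each fixed time. *)
Lemma copy_positive j s : 0 <= s -> P [set w | Lam j s w <= 0] = 0%E.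
Proof.
move=> s0; have [_ _ fdd] := Lam_copy j.
have := fdd 1%N [tuple s] _ [set x | tnth x ord0 <= 0].
have -> : [set w | [set x : 1.-tuple R | tnth x ord0 <= 0]
    [tuple Lam j (tnth [tuple s] i) w | i < 1]] = [set w | Lam j s w <= 0].
  by apply/seteqP; split=> w /=; rewrite tnth_mktuple.
have -> : [set w | [set x : 1.-tuple R | tnth x ord0 <= 0]
    [tuple expR (X (tnth [tuple s] i) w - sX ^+ 2 / 2) | i < 1]] = set0.
  by apply/seteqP; split=> w //=; rewrite tnth_mktuple leNgt expR_gt0.
rewrite measure0 => <- //; first by move=> i; rewrite ord1.
rewrite (_ : mkset _ = (fun x : 1.-tuple R => tnth x ord0) @^-1` `]-oo, 0]%classic).
  by rewrite -[_ @^-1` _]setTI; exact: measurable_tnth.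
by apply/seteqP; split=> x /=; rewrite in_itv/=.
Qed.

Hypothesis Lam_indep : independent_processes P Lam.

Lemma copies_lognormal_family :
  lognormal_family P (fun j => positive_version (Lam j))
    (fun s u => correlation P0 (X s) (X u)) (sX ^+ 2).
Proof.
move=> n L L0.
pose Z j := power_product (positive_version (Lam j)) (L j).
rewrite (expectation_prod_independent Lam_indep (Z := Z)).
- rewrite -prodEFin; apply: eq_bigr => j _.
  rewrite -(lognormal_power_product X_measurable X_gaussian X_mean sX_gt0 X_variance (L0 j)).
  have [_ _ fdd] := Lam_copy j.
  rewrite (same_fdd_power_product _ _ fdd (L0 j)).
  + apply: eq_integral => w _; congr EFin; rewrite /Z /power_product !big_seq.
    apply: eq_bigr => x xL; rewrite /positive_version /positive_part.
    by rewrite (L0 j).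
  + move=> t t0; apply: measurableT_comp => //; apply: measurable_funB => //.
    exact: measurable_process_time.
  + by move=> t; exact: measurable_process_time.
- by move=> j; exact: measurable_power_product.
- by move=> j w; apply: prodr_ge0 => x _; exact: powR_ge0.
- by move=> j B mB; apply: process_sigma_power_product => //; exact: L0.
Qed.

End copies.

(** * The integrated products as cascade masses *)

Section cascade_of_positive_versions.
Context d (Omega : measurableType d) (R : realType) (P : probability Omega R).
Variables (Lam : nat -> R -> Omega -> R) (b : R).
Hypothesis mLam : forall j, measurable_process (Lam j).
Hypothesis Lam_pos : forall j s, 0 <= s -> P [set w | Lam j s w <= 0] = 0%E.
Hypothesis b0 : 0 < b.
Let mu := @lebesgue_measure R.
Let Y j := positive_version (Lam j).
Let time_domain : set (R * Omega) := `[0, +oo[%classic `*` setT.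

Let G n (p : R * Omega) : R :=
  \prod_(j < n.+1) ((fun q : R * Omega => Lam j q.1 q.2) \_ time_domain) (p.1 * b ^+ j, p.2).

Let GE n s w : 0 <= s -> G n (s, w) = \prod_(j < n.+1) Lam j (s * b ^+ j) w.
Proof.
move=> s0; apply: eq_bigr => j _; rewrite patchE mem_set//; split=> //=.
by rewrite in_itv/= andbT mulr_ge0// exprn_ge0// ltW.
Qed.

Let mG n : measurable_fun setT (G n).
Proof.
apply: measurable_prod => j _.
have mg : measurable_fun setT (fun p : R * Omega => (p.1 * b ^+ j, p.2)).
  by apply: measurable_fun_pair => //; apply: measurable_funM.
apply: (measurableT_comp _ mg); apply/(measurable_restrictT _ _).1; first exact: measurableX.
exact: mLam.
Qed.

Let mH n : measurable_fun setT (fun p : R * Omega => cascade Y b n p.1 p.2).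
Proof. by apply: measurable_cascade => j; exact: measurable_positive_version. Qed.

Let multifractal_productE n t w : multifractal_product Lam b n t w =
  fine (\int[mu]_(s in `[0%R, t]) (G n (s, w))%:E)%E.
Proof.
congr fine; apply: eq_integral => s; rewrite inE/= in_itv/= => /andP[s0 _].
by rewrite GE.
Qed.

(** [G] may be negative on a null set, so its positive and negative parts are integrated
    separately. *)
Lemma measurable_multifractal_product n t :
  measurable_fun setT (multifractal_product Lam b n t).
Proof.
rewrite (_ : multifractal_product _ _ _ _ = fun w =>
    fine (\int[mu]_(s in `[0%R, t]) (G n (s, w))%:E)%E).
  apply: measurableT_comp; first exact: fine_measurable.
  have mI (f : R * Omega -> \bar R) : measurable_fun setT f -> (forall p, (0 <= f p)%E) ->
      measurable_fun setT (fun w => \int[mu]_(s in `[0%R, t]) f (s, w))%E.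
    by move=> mf f0; apply: measurable_int2.
  have mGE : measurable_fun setT (EFin \o G n) by exact/measurable_EFinP.
  rewrite (_ : (fun w => _) = (fun w => \int[mu]_(s in `[0%R, t]) (EFin \o G n)^\+ (s, w) -
      \int[mu]_(s in `[0%R, t]) (EFin \o G n)^\- (s, w))%E).
    apply: emeasurable_funB; apply: mI => //; [exact: measurable_funepos|exact: measurable_funeneg].
  apply/funext => w; rewrite integralE; congr (_ - _)%E.
    by apply: eq_integral => s _; rewrite !funeposE.
  by apply: eq_integral => s _; rewrite !funenegE.
by apply/funext => w; exact: multifractal_productE.
Qed.

(** For fixed [s] the two integrands agree almost surely, as only countably many layers matter.
    Tonelli's theorem for [D] exchanges the quantifiers: almost surely they agree for almost every
    [s]. *)
Lemma multifractal_product_ae n t :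
  {ae P, forall w, multifractal_product Lam b n t w = cascade_mass Y b n t w}.
Proof.
pose D (p : R * Omega) : \bar R := (`|G n p - cascade Y b n p.1 p.2|)%:E.
have mD : measurable_fun setT D.
  apply/measurable_EFinP; apply: measurableT_comp => //; apply: measurable_funB; first exact: mG.
  exact: mH.
have D0 p : (0 <= D p)%E by rewrite lee_fin.
have D_ae s : 0 <= s -> (\int[P]_w D (s, w) = 0)%E.
  move=> s0; have mDs : measurable_fun setT (fun w => D (s, w)).
    exact: (measurable_fun_pair2 (f := D)).
  rewrite -[RHS](@integral0 _ _ _ P setT); apply: ae_eq_integral => //.
  have : {ae P, forall w, forall j : nat, 0 < Lam j (s * b ^+ j) w}.
    apply: ae_foralln => j; have sb0 : 0 <= s * b ^+ j by rewrite mulr_ge0// exprn_ge0// ltW.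
    exists [set w | Lam j (s * b ^+ j) w <= 0]; split.
    - rewrite (_ : mkset _ = Lam j (s * b ^+ j) @^-1` `]-oo, 0]%classic).
        by rewrite -[_ @^-1` _]setTI; exact: measurable_process_time.
      by apply/seteqP; split=> x /=; rewrite in_itv/=.
    - exact: Lam_pos.
    - by move=> w /= /negP; rewrite -leNgt.
  apply: filterS => w h _; rewrite /D/= GE// /cascade.
  rewrite [X in _ - X](eq_bigr (fun j : 'I_n.+1 => Lam j (s * b ^+ j) w)).
    by rewrite subrr normr0.
  move=> j _.
  by rewrite /Y /positive_version h mulr_ge0// ?exprn_ge0// ltW.
have : (\int[P]_w \int[mu]_(s in `[0%R, t]) D (s, w) = 0)%E.
  rewrite -(tonelli_in mu P)//; apply: integral0_eq => s /=.
  by rewrite in_itv/= => /andP[s0 _]; exact: D_ae.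
have mI : measurable_fun setT (fun w => \int[mu]_(s in `[0%R, t]) D (s, w))%E.
  exact: measurable_int2.
move=> I0; have /(ae_eq_integral_abs P measurableT mI) : 
    (\int[P]_w `| \int[mu]_(s in `[0%R, t]) D (s, w)| = 0)%E.
  by rewrite -[RHS]I0; apply: eq_integral => w _; rewrite gee0_abs// integral_ge0.
apply: filterS => w /(_ I) h.
rewrite multifractal_productE; congr fine.
have mGw : measurable_fun `[0, t] (fun s => (G n (s, w))%:E).
  apply: measurable_funTS; apply/measurable_EFinP.
  exact: (measurable_fun_pair1 (f := G n)).
have mHw : measurable_fun `[0, t] (fun s => (cascade Y b n s w)%:E).
  apply: measurable_funTS; apply/measurable_EFinP.
  exact: (measurable_fun_pair1 (f := fun p : R * Omega => cascade Y b n p.1 p.2)).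
apply: ae_eq_integral => //.
have mDw : measurable_fun `[0, t] (fun s => D (s, w)).
  by apply: measurable_funTS; exact: (measurable_fun_pair1 (f := D)).
have /(ae_eq_integral_abs mu _ mDw) : (\int[mu]_(s in `[0%R, t]) `|D (s, w)| = 0)%E.
  by rewrite -[RHS]h; apply: eq_integral => s _; rewrite gee0_abs.
move=> /(_ (measurable_itv _)); apply: filterS => s /[apply] /= -[/eqP].
by rewrite normr_eq0 subr_eq0 => /eqP ->.
Qed.

End cascade_of_positive_versions.

(** * Integrals of the correlation over squares *)

Section affine_substitution.
Context (R : realType).
Local Notation mu := (@lebesgue_measure R).
Implicit Types (c a : R).

Let affine c a (x : R) : measurableTypeR R := c * x + a.

Let measurable_affine c a : measurable_fun setT (affine c a : measurableTypeR R -> _).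
Proof.
by rewrite /affine; apply: (@measurable_funD _ _ R setT).
Qed.

Let affine_preimage_mu c a x y : c != 0 -> x <= y ->
  (`|c|%:E * mu (affine c a @^-1` `]x, y]%classic) = (y - x)%:E)%E.
Proof.
move=> c0 xy; case: (ltgtP c 0) => [cn|cp|]; last by move/eqP; rewrite (negbTE c0).
- rewrite (_ : _ @^-1` _ = `[(y - a) / c, (x - a) / c[%classic).
    rewrite lebesgue_measure_itv/= lte_fin ltr_ndivrMr// divfK// ltrD2r ltr0_norm//.
    case: ltgtP xy => // [xy _|-> _]; last by rewrite mule0 subrr.
    by rewrite -EFinB -EFinM; congr EFin; field.
  apply/seteqP; split=> z; rewrite /affine /= !in_itv/= ler_ndivrMr// ltr_ndivlMr//;
    by rewrite [z * c]mulrC ltrBlDr lerBrDr andbC.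
- rewrite (_ : _ @^-1` _ = `](x - a) / c, (y - a) / c]%classic).
    rewrite lebesgue_measure_itv/= lte_fin ltr_pdivlMr// divfK ?gt_eqF// ltrD2r gtr0_norm//.
    case: ltgtP xy => // [xy _|-> _]; last by rewrite mule0 subrr.
    by rewrite -EFinB -EFinM; congr EFin; field.
  apply/seteqP; split=> z; rewrite /affine /= !in_itv/= ler_pdivlMr// ltr_pdivrMr//;
    by rewrite [z * c]mulrC ltrBlDr lerBrDr.
Qed.

(** Lebesgue measure is identified with the scaled image measure by its values on half-open
    intervals. Positive [c] serves the rescaling of squares, [c = -1] the reflections. *)
Lemma ge0_integral_affine c a (D : set R) (f : R -> \bar R) : c != 0 -> measurable D ->
  measurable_fun D f -> (forall x, D x -> 0 <= f x)%E ->
  (\int[mu]_(x in D) f x =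
   `|c|%:E * \int[mu]_(x in (fun x => (c * x + a)%R) @^-1` D) f (c * x + a)%R)%E.
Proof.
move=> c0 mD mf f0.
have k0 : 0 <= `|c| by []. pose k := NngNum k0.
have mu_affine A : measurable A -> mu A = mscale k (pushforward mu (affine c a)) A.
  move=> mA; apply: (@lebesgue_measure_unique _ (mscale k (pushforward mu (affine c a)))) => //.
  move=> _ [[x y] _] <- /=; case: (leP x y) => xy; last first.
    by rewrite set_itv_ge ?bnd_simp -?leNgt ?ltW// !measure0.
  transitivity ((y - x)%:E); last by rewrite -(affine_preimage_mu a c0 xy).
  rewrite [LHS]lebesgue_measure_itv/= lte_fin EFinB.
  by move: xy; rewrite le_eqVlt => /predU1P[->|->//]; rewrite ltxx -EFinB subrr.
rewrite (eq_measure_integral (mscale k (pushforward mu (affine c a)))).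
  rewrite ge0_integral_mscale//; congr (_ * _)%E.
  by rewrite ge0_integral_pushforward// => y /[!inE] /f0.
by move=> A mA _; exact: mu_affine.
Qed.

End affine_substitution.

Section square_integrals.
Context (R : realType).
Local Notation mu := (@lebesgue_measure R).
Variables (g : R -> R).
Hypothesis mg : measurable_fun setT g.
Hypothesis g0 : forall x, 0 <= g x.
Hypothesis g_even : forall x, g (- x) = g x.

Let mgE : measurable_fun setT (fun x => (g x)%:E). Proof. exact/measurable_EFinP. Qed.
Let g0E x : (0 <= (g x)%:E)%E. Proof. by rewrite lee_fin. Qed.

Lemma integral_square_scale (t : R) : 0 < t ->
  (\int[mu]_(s in `[0%R, t]) \int[mu]_(u in `[0%R, t]) (g (s - u))%:E =
   (t ^+ 2)%:E * \int[mu]_(s in `[0%R, 1%R]) \int[mu]_(u in `[0%R, 1%R]) (g (t * (s - u)))%:E)%E.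
Proof.
move=> t0; have tn0 : t != 0 by rewrite gt_eqF.
have pre : (fun x => t * x + 0) @^-1` `[0, t]%classic = `[0, 1]%classic.
  apply/seteqP; split=> x /=; rewrite !in_itv/= addr0 pmulr_rge0//;
    by rewrite ger_pMr.
have mg2 : measurable_fun setT (fun p : R * R => (g (p.1 - p.2))%:E).
  by apply: (measurableT_comp mgE); exact: measurable_funB.
have mg2t : measurable_fun setT (fun p : R * R => (g (t * (p.1 - p.2)))%:E).
  by apply: (measurableT_comp mgE); apply: measurable_funM => //; exact: measurable_funB.
rewrite [LHS](@ge0_integral_affine _ t 0 _ _ tn0 (measurable_itv _)
  (measurable_int1 mu (measurable_itv _) (measurable_itv _) mg2 (fun _ _ _ _ => g0E _))); last first.
  by move=> s _; exact: integral_ge0.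
rewrite gtr0_norm; last exact: t0.
rewrite pre expr2 EFinM -muleA; congr (_ * _)%E.
have inner := measurable_int1 mu (measurable_itv `[0, 1]) (measurable_itv `[0, 1])
  mg2t (fun _ _ _ _ => g0E _).
rewrite -[RHS](ge0_integralZl mu (measurable_itv _) inner); last 2 first.
- by move=> s _; exact: integral_ge0.
- by rewrite lee_fin ltW.
apply: eq_integral => s _; rewrite (@ge0_integral_affine _ (t) 0)//.
  rewrite gtr0_norm// pre; congr (_ * _)%E; apply: eq_integral => u _.
  by rewrite !addr0 mulrBr.
apply: measurable_funTS.
exact: (measurable_fun_pair2 (f := fun p : R * R => (g (p.1 - p.2))%:E)).
Qed.

(** In the variable [x = s - u], the admissible [s] for given [x] form the interval from [max 0 x]
    to [min t (x + t)], of length [t - |x|]. Evenness folds the two halves together. *)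
Lemma integral_square_triangle (t : R) : 0 <= t ->
  (\int[mu]_(s in `[0%R, t]) \int[mu]_(u in `[0%R, t]) (g (s - u))%:E =
   2%:E * \int[mu]_(u in `[0%R, t]) ((t - u) * g u)%:E)%E.
Proof.
move=> t0.
pose K (p : R * R) : R := if p.1 - t <= p.2 <= p.1 then g p.2 else 0.
have mK : measurable_fun setT (fun p => (K p)%:E).
  apply/measurable_EFinP; apply: measurable_fun_ifT => //.
    apply: measurable_and; apply: measurable_fun_ler => //; exact: measurable_funB.
  exact: (measurableT_comp mg measurable_snd).
have K0 p : (0 <= (K p)%:E)%E by rewrite lee_fin /K; case: ifP.
transitivity (\int[mu]_(s in `[0%R, t]) \int[mu]_(x in `[(- t)%R, t]) (K (s, x))%:E)%E.
  apply: eq_integral => s /[!inE]/=; rewrite in_itv/= => /andP[s0 st].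
  transitivity (\int[mu]_(x in `[(s - t)%R, s]) (g x)%:E)%E.
    rewrite [RHS](@ge0_integral_affine _ (-1) s)//; last exact: measurable_funTS.
    rewrite normrN1 mul1e (_ : _ @^-1` _ = `[0, t]%classic).
      by apply: eq_integral => u _; rewrite mulN1r addrC.
    by apply/seteqP; split=> x /=; rewrite !in_itv/= mulN1r => /andP[? ?]; apply/andP; split; lra.
  rewrite [LHS]integral_mkcond [RHS]integral_mkcond; apply: eq_integral => x _.
  rewrite !patchE !mem_setE /K !in_itv/=; case: ifP => /= h.
    by rewrite ifT//; move/andP: h => [? ?]; apply/andP; split; lra.
  by case: ifP.
rewrite [LHS](tonelli_in mu mu (measurable_itv _) (measurable_itv _) mK (fun _ _ _ _ => K0 _)).
have inner x : `[-t, t]%classic x ->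
    (\int[mu]_(s in `[0%R, t]) (K (s, x))%:E = ((t - `|x|) * g x)%:E)%E.
  rewrite /= in_itv/= => /andP[x1 x2].
  transitivity (\int[mu]_(s in `[(Num.max 0 x)%R, (Num.min t (x + t))%R]) (g x)%:E)%E.
    rewrite [LHS]integral_mkcond [RHS]integral_mkcond; apply: eq_integral => s _.
    rewrite !patchE !mem_setE /K !in_itv/= ge_max le_min lerBlDr.
    by case: (0 <= s); case: (s <= t); case: (x <= s); case: (s <= x + t).
  rewrite integral_cst//= lebesgue_measure_itv/= lte_fin muleC; case: (leP 0 x) => x0.
    rewrite (@min_l _ _ t (x + t)) ?lerDr//.
    case: ltP => xt; first by rewrite -EFinB -EFinM ger0_norm.
    by rewrite ger0_norm// (_ : t - x = 0) ?mul0r ?mul0e//; apply/eqP; rewrite subr_eq0 eq_le xt x2.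
  rewrite (@min_r _ _ t (x + t)) ?gerDr ?(ltW x0)//.
  rewrite ltr0_norm// opprK [x + t]addrC; case: ltP => xt; first by rewrite -EFinB subr0 -EFinM.
  by rewrite (_ : t + x = 0) ?mul0r ?mul0e//; apply/eqP; rewrite eq_le xt -lerBlDl sub0r.
transitivity (\int[mu]_(x in `[(- t)%R, t]) ((t - `|x|) * g x)%:E)%E.
  by apply: eq_integral => x /[!inE] /inner.
have mT : measurable_fun setT (fun x : R => ((t - `|x|) * g x)%:E).
  apply/measurable_EFinP; apply: measurable_funM => //.
  by apply: measurable_funB => //; exact: measurableT_comp.
have T0 x : `[-t, t]%classic x -> (0 <= ((t - `|x|) * g x)%:E)%E.
  by rewrite /= in_itv/= -ler_norml => h; rewrite lee_fin mulr_ge0 ?subr_ge0.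
rewrite (_ : `[-t, t]%classic = `[-t, 0[%classic `|` `[0, t]%classic); last first.
  by rewrite -itv_bndbnd_setU ?bnd_simp ?oppr_le0.
have sub0 : (`[-t, 0[ `<=` `[-t, t])%classic.
  by apply: subset_itvl; rewrite bnd_simp.
have sub1 : (`[0, t] `<=` `[-t, t])%classic.
  by apply: subset_itvr; rewrite bnd_simp oppr_le0.
rewrite ge0_integral_setU//=; last 3 first.
- exact: measurable_funTS.
- by move=> x [/sub0|/sub1]; exact: T0.
- apply/disj_setPS => x [/=]; rewrite !in_itv/= => /andP[_ x0] /andP[x1 _].
  by have := lt_le_trans x0 x1; rewrite ltxx.
rewrite integral_itv_bndo_bndc; last exact: measurable_funTS.
have sub2 : (`[-t, 0] `<=` `[-t, t])%classic.
  by apply: subset_itvl; rewrite bnd_simp.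
rewrite (@ge0_integral_affine _ (-1) 0)//; last 2 first.
- exact: measurable_funTS.
- by move=> x /sub2; exact: T0.
rewrite normrN1 mul1e (_ : _ @^-1` _ = `[0, t]%classic); last first.
  by apply/seteqP; split=> x /=; rewrite !in_itv/= mulN1r => /andP[? ?]; apply/andP; split; lra.
have twice (x : \bar R) : (2%:E * x = x + x)%E by rewrite (_ : 2%:E = 1 + 1)%E// ge0_muleDl// mul1e.
rewrite twice; congr (_ + _)%E; apply: eq_integral => x /[!inE]/=; rewrite in_itv/= => /andP[x0 _].
  by rewrite addr0 mulN1r normrN g_even ger0_norm.
by rewrite ger0_norm.
Qed.

End square_integrals.

Section correlation_integrals.
Context (R : realType).
Local Notation mu := (@lebesgue_measure R).

Let mu_itv (t : R) : 0 <= t -> mu `[0, t] = t%:E.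
Proof.
move=> t0; rewrite [LHS]lebesgue_measure_itv/= lte_fin sube0.
by move: t0; rewrite le_eqVlt => /predU1P[<-|->//]; rewrite ltxx.
Qed.

Let integrable_bounded (t M : R) (f : R -> R) : 0 <= t -> measurable_fun `[0, t] f ->
  (forall x, 0 <= x <= t -> `|f x| <= M) -> mu.-integrable `[0, t] (EFin \o f).
Proof.
move=> t0 mf fM; apply: measurable_bounded_integrable => //.
  by rewrite [X in (X < _)%E]mu_itv// ltry.
exists M; split; first exact: num_real.
move=> N MN x; rewrite /= in_itv/= => xt; apply: le_trans (fM x xt) (ltW MN).
Qed.

Let Rintegral_sub1 (t : R) (h : R -> R) : 0 <= t -> measurable_fun `[0, t] h ->
  (forall x, 0 <= x <= t -> 0 <= h x <= 2) ->
  \int[mu]_(s in `[0, t]) (h s - 1) = \int[mu]_(s in `[0, t]) h s - t.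
Proof.
move=> t0 mh h2; rewrite RintegralB//.
- by rewrite Rintegral_cst// mul1r; congr (_ - _); rewrite [X in fine X]mu_itv.
- by apply: (@integrable_bounded t 2) => // x xt; rewrite ger0_norm; case/andP: (h2 _ xt).
- by apply: (@integrable_bounded t 1) => // x _; rewrite normr1.
Qed.

Let affine_int (t c a : R) (h : R -> \bar R) : 0 <= t -> 0 <= c -> 0 <= a ->
  measurable_fun `[0, t] h -> (forall s, (0 <= h s)%E) ->
  (\int[mu]_(s in `[0%R, t]) (c%:E + a%:E * h s) =
   (c * t)%:E + a%:E * \int[mu]_(s in `[0%R, t]) h s)%E.
Proof.
move=> t0 c0 a0 mh h0; rewrite ge0_integralD//.
- by rewrite integral_cst// [X in (_ * X)%E]mu_itv// -EFinM ge0_integralZl.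
- by move=> s _; rewrite mule_ge0.
- exact: measurable_funeM.
Qed.

Variables (g : R -> R) (v : R).
Hypothesis mg : measurable_fun setT g.
Hypothesis g02 : forall x, 0 <= g x <= 2.
Hypothesis v0 : 0 <= v.

Let g0 x : 0 <= g x. Proof. by case/andP: (g02 x). Qed.

(** [g] stands for [1 + rho], which keeps the integrands nonnegative. *)
Definition square_integral (t : R) : \bar R :=
  (\int[mu]_(s in `[0%R, t]) \int[mu]_(u in `[0%R, t]) (g (s - u))%:E)%E.

Let inner (c t s : R) := (\int[mu]_(u in `[0%R, t]) (g (c * (s - u)))%:E)%E.

Let mg2 c : measurable_fun setT (fun p : R * R => g (c * (p.1 - p.2))).
Proof.
by apply: (measurableT_comp mg); apply: measurable_funM => //; exact: measurable_funB.
Qed.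

Let minner (c t : R) : measurable_fun `[0, t] (inner c t).
Proof.
have m2 : measurable_fun setT (fun p : R * R => (g (c * (p.1 - p.2)))%:E).
  exact/measurable_EFinP.
apply: (measurable_int1 mu (measurable_itv _) (measurable_itv _) m2) => x y _ _.
by rewrite lee_fin.
Qed.

Let inner0 c t s : (0 <= inner c t s)%E.
Proof. by apply: integral_ge0 => u _; rewrite lee_fin. Qed.

Let inner_le c t s : 0 <= t -> (inner c t s <= (2 * t)%:E)%E.
Proof.
move=> t0; apply: (@le_trans _ _ (\int[mu]_(u in `[0%R, t]) (cst 2%:E u))%E).
  by apply: ge0_le_int => u _; rewrite lee_fin; case/andP: (g02 (c * (s - u))).
by rewrite integral_cst// [X in (_ * X)%E]mu_itv.
Qed.

Let inner1 t s : inner 1 t s = (\int[mu]_(u in `[0%R, t]) (g (s - u))%:E)%E.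
Proof. by apply: eq_integral => u _; rewrite mul1r. Qed.

Lemma square_integral_fin t : 0 <= t -> square_integral t \is a fin_num.
Proof.
move=> t0; rewrite ge0_fin_numE; last first.
  by apply: integral_ge0 => s _; rewrite -inner1.
apply: (@le_lt_trans _ _ (\int[mu]_(s in `[0%R, t]) (cst (2 * t)%:E s))%E).
  by apply: ge0_le_int => s _; rewrite -inner1//; exact: inner_le.
by rewrite integral_cst// [X in (_ * X)%E]mu_itv// ltry.
Qed.

Lemma exp_square_integral_ge t : 0 <= t ->
  ((t ^+ 2 + v * (fine (square_integral t) - t ^+ 2))%:E <=
   \int[mu]_(s in `[0%R, t]) \int[mu]_(u in `[0%R, t]) (expR (v * (g (s - u) - 1)))%:E)%E.
Proof.
move=> t0.
pose E (s : R) := (\int[mu]_(u in `[0%R, t]) (expR (v * (g (s - u) - 1)))%:E)%E.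
have mE2 : measurable_fun setT (fun p : R * R => (expR (v * (g (p.1 - p.2) - 1)))%:E).
  apply/measurable_EFinP; apply: measurableT_comp => //; apply: measurable_funM => //.
  apply: measurable_funB => //; have := mg2 1.
  by under eq_fun do rewrite mul1r.
have mE : measurable_fun `[0, t] E.
  apply: (measurable_int1 mu (measurable_itv _) (measurable_itv _) mE2) => x y _ _.
  by rewrite lee_fin expR_ge0.
have E0 s : (0 <= E s)%E by apply: integral_ge0 => u _; rewrite lee_fin expR_ge0.
(* The tangent inequality is written as 1 + v g <= v + exp(v (g - 1)), which keeps both integrands
   nonnegative. *)
have step s : (t%:E + v%:E * inner 1 t s <= (v * t)%:E + 1%:E * E s)%E.
  have m1 : measurable_fun `[0, t] (fun u => (g (1 * (s - u)))%:E).
    apply: measurable_funTS; apply/measurable_EFinP.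
    exact: (measurable_fun_pair2 (f := fun p : R * R => g (1 * (p.1 - p.2)))).
  have m2 : measurable_fun `[0, t] (fun u => (expR (v * (g (s - u) - 1)))%:E).
    apply: measurable_funTS.
    exact: (measurable_fun_pair2 (f := fun p : R * R => (expR (v * (g (p.1 - p.2) - 1)))%:E)).
  rewrite -[t in t%:E]mul1r -!affine_int//.
  - apply: ge0_le_int => u _; first by rewrite -EFinM -EFinD lee_fin addr_ge0// mulr_ge0.
    rewrite mul1r mul1e -EFinM -!EFinD lee_fin.
    have := expR_ge1Dx (v * (g (s - u) - 1)); nra.
  - by move=> u; rewrite lee_fin ?expR_ge0.
have : (\int[mu]_(s in `[0%R, t]) (t%:E + v%:E * inner 1 t s) <=
    \int[mu]_(s in `[0%R, t]) ((v * t)%:E + 1%:E * E s))%E.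
  by apply: ge0_le_int => s _; rewrite ?step// adde_ge0 ?lee_fin// mule_ge0 ?lee_fin.
rewrite !affine_int//; last by rewrite mulr_ge0.
rewrite mul1e -/(E _); under [X in (_ * X)%E]eq_integral do rewrite inner1.
rewrite -/(square_integral t) -(fineK (square_integral_fin t0)) -EFinM -EFinD.
case: (\int[mu]_(s in `[0%R, t]) E s)%E => [x| |].
- by rewrite -EFinD !lee_fin; nra.
- by move=> _; rewrite leey.
- by rewrite addeNy leeNy_eq.
Qed.

Hypothesis g_even : forall x, g (- x) = g x.

(** The triangle identity for the constant 1 is subtracted from that for [g]. The value of [f] at 0
    is left free, where a quotient by a power of [u] is degenerate; one point does not affect the
    integral. *)
Lemma triangle_Rintegral (f : R -> R) t : 0 < t ->
  (forall u, 0 < u <= t -> f u = g u - 1) ->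
  2 * t * v * \int[mu]_(u in `[0, t]) ((1 - u / t) * f u) =
  v * (fine (square_integral t) - t ^+ 2).
Proof.
move=> t0 fE; have tn0 : t != 0 by rewrite gt_eqF.
have mw (h : R -> R) : measurable_fun setT h ->
    measurable_fun setT (fun u : R => (t - u) * h u).
  by move=> mh; apply: measurable_funM => //; exact: measurable_funB.
have mfg : measurable_fun setT (fun u : R => (1 - u / t) * (g u - 1)).
  apply: measurable_funM; last exact: measurable_funB.
  by apply: measurable_funB => //; exact: measurable_funM.
have bw (h : R -> R) : measurable_fun setT h -> (forall x, 0 <= h x <= 2) ->
    mu.-integrable `[0, t] (EFin \o (fun u : R => (t - u) * h u)).
  move=> mh h02; apply: (@integrable_bounded t (2 * t)); rewrite ?ltW//.
    by apply: measurable_funTS; exact: mw.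
  move=> x /andP[x0 xt]; have /andP[h0 h2] := h02 x.
  by rewrite ger0_norm; nra.
have tri (h : R -> R) : measurable_fun setT h -> (forall x, 0 <= h x <= 2) ->
    (forall x, h (- x) = h x) ->
    2 * \int[mu]_(u in `[0, t]) ((t - u) * h u) =
    fine (\int[mu]_(s in `[0%R, t]) \int[mu]_(u in `[0%R, t]) (h (s - u))%:E)%E.
  move=> mh h02 he; rewrite integral_square_triangle ?(ltW t0)//.
    by rewrite fineM//; exact: integrable_fin_num (bw _ mh h02).
  by move=> x; case/andP: (h02 x).
have one : 2 * \int[mu]_(u in `[0, t]) ((t - u) * 1) = t ^+ 2.
  rewrite (tri (fun=> 1))//; last by move=> x; rewrite ler01 ler1n.
  under eq_integral do rewrite integral_cst// [X in (_ * X)%E]mu_itv ?(ltW t0)// mul1e.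
  by rewrite integral_cst// [X in (_ * X)%E]mu_itv ?(ltW t0)// -EFinM.
have -> : \int[mu]_(u in `[0, t]) ((1 - u / t) * f u) =
    \int[mu]_(u in `[0, t]) ((1 - u / t) * (g u - 1)).
  have eqf : {in `]0, t]%classic, (fun u : R => (1 - u / t) * (g u - 1)) =1
      (fun u => (1 - u / t) * f u)}.
    by move=> u /[!inE]/=; rewrite in_itv/= => ut; rewrite fE.
  rewrite /Rintegral; congr fine; rewrite -!integral_itv_obnd_cbnd.
  - by apply: eq_integral => u ut; rewrite eqf.
  - by apply/measurable_EFinP; exact: measurable_funTS.
  - apply/measurable_EFinP; apply: (eq_measurable_fun _ eqf); exact: measurable_funTS.
rewrite (_ : \int[mu]_(u in _) _ =
    \int[mu]_(u in `[0, t]) (t^-1 * ((t - u) * g u - (t - u) * 1))); last first.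
  by apply: eq_Rintegral => u _; field.
have b1 : forall x : R, 0 <= (1 : R) <= 2 by move=> x; rewrite ler01 ler1n.
have I1 := bw (fun=> 1) (measurable_cst _) b1.
rewrite RintegralZl//; last exact: (integrableB _ (bw g mg g02) I1).
rewrite RintegralB//; last exact: bw.
rewrite /square_integral -(tri g)// -one.
set a := Rintegral _ _ _; set b := Rintegral _ _ _.
by field.
Qed.

(** [F] is left free on the diagonal: for each [u] the single point [w = u] is removed from the
    inner integral. Rescaling then turns the unit square into the square of side [t]. *)
Lemma square_Rintegral (F : R -> R -> R) c t : 0 < t ->
  (forall u w, 0 <= u <= 1 -> 0 <= w <= 1 -> u != w -> F u w = c * (g (t * (u - w)) - 1)) ->
  t ^+ 2 * \int[mu]_(u in `[0, 1]) \int[mu]_(w in `[0, 1]) F u w =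
  c * (fine (square_integral t) - t ^+ 2).
Proof.
move=> t0 FE.
have inner_fin u : inner t 1 u \is a fin_num.
  rewrite ge0_fin_numE//; apply: le_lt_trans (ltry 2); have := inner_le t u ler01.
  by rewrite mulr1.
have m1 u : measurable_fun setT (fun w : R => g (t * (u - w))).
  exact: (measurable_fun_pair2 (f := fun p : R * R => g (t * (p.1 - p.2)))).
have innerE u : 0 <= u <= 1 ->
    \int[mu]_(w in `[0, 1]) F u w = c * (fine (inner t 1 u) - 1).
  move=> u01.
  have mD : measurable (`[0, 1]%classic `\ u : set R) by exact: measurableD.
  have m2 : measurable_fun setT (fun w : R => c * (g (t * (u - w)) - 1)).
    by apply: measurable_funM => //; exact: measurable_funB.
  have eqF : {in `[0, 1]%classic `\ u, (fun w : R => c * (g (t * (u - w)) - 1)) =1 F u}.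
    move=> w /[!inE] -[/=]; rewrite in_itv/= => w01 /eqP wu.
    by rewrite FE// eq_sym.
  have -> : \int[mu]_(w in `[0, 1]) F u w =
      \int[mu]_(w in `[0, 1]) (c * (g (t * (u - w)) - 1)).
    rewrite /Rintegral; congr fine.
    rewrite -!(@integral_setD1 R _ u `[0, 1]%classic)//.
    - by apply: eq_integral => w wD; rewrite eqF.
    - by apply/measurable_EFinP; exact: measurable_funTS.
    - apply/measurable_EFinP; apply: (eq_measurable_fun _ eqF); exact: measurable_funTS.
  rewrite RintegralZl//; last first.
    apply: (@integrable_bounded 1 1) => //.
      by apply: measurable_funTS; exact: measurable_funB.
    move=> x _; have /andP[a1 a2] := g02 (t * (u - x)).
    by rewrite ler_norml; apply/andP; split; lra.
  by rewrite Rintegral_sub1//; exact: measurable_funTS.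
have -> : \int[mu]_(u in `[0, 1]) \int[mu]_(w in `[0, 1]) F u w =
    \int[mu]_(u in `[0, 1]) (c * (fine (inner t 1 u) - 1)).
  by apply: eq_Rintegral => u /[!inE]/=; rewrite in_itv/= => /innerE.
have f02 u : 0 <= u <= 1 -> 0 <= fine (inner t 1 u) <= 2.
  move=> _; rewrite fine_ge0//= -lee_fin fineK//; have := inner_le t u ler01.
  by rewrite mulr1.
have mf : measurable_fun (`[0, 1]%classic : set R) (fun u => fine (inner t 1 u)).
  by apply: measurableT_comp; [exact: fine_measurable|exact: minner].
rewrite RintegralZl//; last first.
  apply: (@integrable_bounded 1 1) => //; first exact: measurable_funB.
  move=> x /f02/andP[a1 a2].
  by rewrite ler_norml; apply/andP; split; lra.
rewrite Rintegral_sub1// /square_integral integral_square_scale//.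
have -> : \int[mu]_(u in `[0, 1]) fine (inner t 1 u) = fine (\int[mu]_(u in `[0%R, 1%R]) inner t 1 u)%E.
  by congr fine; apply: eq_integral => u _; rewrite fineK.
have fin2 : (\int[mu]_(u in `[0%R, 1%R]) inner t 1 u)%E \is a fin_num.
  rewrite ge0_fin_numE; last exact: integral_ge0.
  apply: (@le_lt_trans _ _ (\int[mu]_(s in `[0%R, 1%R]) (cst 2%:E s))%E).
    by apply: ge0_le_int => s _ //; rewrite /= -[2]mulr1 inner_le.
  by rewrite integral_cst// [X in (_ * X)%E]mu_itv// ltry.
rewrite fineM//; set a := fine (\int[mu]_(u in `[0%R, 1%R]) inner t 1 u)%E.
by rewrite -[LHS]/(t ^+ 2 * (c * (a - 1))) -[RHS]/(c * (t ^+ 2 * a - t ^+ 2)); ring.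
Qed.

End correlation_integrals.

(** * The limit process and its variance *)

Lemma ereal_cvg0 (R : realType) (u : nat -> \bar R) : (forall n, (0 <= u n)%E) ->
  (forall eps : R, 0 < eps -> exists n0, forall n, (n0 <= n)%N -> (u n <= eps%:E)%E) ->
  u n @[n --> \oo] --> 0%E.
Proof.
move=> u0 uP; apply/fine_cvgP; split.
  have [n0 H] := uP 1 ltr01; exists n0 => // n /= /H un.
  by rewrite ge0_fin_numE// (le_lt_trans un) ?ltry.
apply/cvgrPdist_le => eps eps0; have [n0 H] := uP _ eps0; exists n0 => // n /= /H un.
have fn : u n \is a fin_num by rewrite ge0_fin_numE// (le_lt_trans un) ?ltry.
by rewrite sub0r normrN ger0_norm ?fine_ge0// -lee_fin fineK.
Qed.

(** The expansion of the square is rearranged into an equality between sums of nonnegative terms,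
    which also covers an infinite second moment. *)
Lemma variance_ge (d : measure_display) (Omega : measurableType d) (R : realType)
    (P : probability Omega R) (A : Omega -> R) (m x : R) :
  measurable_fun setT A -> (forall w, 0 <= A w) -> 0 <= m ->
  (\int[P]_w (A w)%:E = m%:E)%E -> ((m ^+ 2 + x)%:E <= \int[P]_w (A w ^+ 2)%:E)%E ->
  (x%:E <= 'V_P[A])%E.
Proof.
move=> mA A0 m0 EA hx.
have EA' : ('E_P[A] = m%:E)%E by rewrite unlock.
have VE : ('V_P[A] = \int[P]_w ((A w - m) ^+ 2)%:E)%E.
  by rewrite /variance unlock EA' unlock.
have : (\int[P]_w ((A w - m) ^+ 2 + 2 * m * A w)%:E = \int[P]_w (A w ^+ 2 + m ^+ 2)%:E)%E.
  by apply: eq_integral => w _; congr EFin; ring.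
have mD : measurable_fun setT (fun w => (A w - m) ^+ 2).
  by apply: measurable_funX; exact: measurable_funB.
have mA2 : measurable_fun setT (fun w => A w ^+ 2) by exact: measurable_funX.
have m20 : 0 <= 2 * m by rewrite mulr_ge0.
rewrite (ge0_int_add P mD (fun w => sqr_ge0 _)); last 2 first.
- exact: measurable_funM.
- by move=> w; rewrite mulr_ge0.
rewrite (ge0_int_add P mA2 (fun w => sqr_ge0 _)) ?sqr_ge0//.
rewrite ge0_int_scale// EA integral_cst//= probability_setT mule1 -VE -EFinM.
move: hx; case: (\int[P]_w _)%E => [y| |]; case: ('V_P[A])%E => [V| |] //=; rewrite ?leey//.
by rewrite lee_fin => hx -[h]; rewrite lee_fin; nra.
Qed.

Theorem theorem4 (R : realType)
  (d0 : measure_display) (Omega0 : measurableType d0) (P0 : probability Omega0 R)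
  (X : R -> Omega0 -> R) (sX C alpha a0 b : R) (qstar : nat)
  (d : measure_display) (Omega : measurableType d) (P : probability Omega R)
  (Lam : nat -> R -> Omega -> R)
  (X_measurable : measurable_process X)
  (X_separable : separable_process P0 X)
  (X_gaussian : gaussian_process P0 X)
  (X_stationary : stationary_process P0 X)
  (X_mean : zero_mean_process P0 X)
  (sX_gt0 : 0 < sX)
  (X_variance : forall t : R, 0 <= t -> 'V_P0[X t]%E = (sX ^+ 2)%:E)
  (C_gt0 : 0 < C) (alpha_gt0 : 0 < alpha) (a0_gt0 : 0 < a0)
  (corr_large : \forall tau \near +oo%R, forall t : R, 0 <= t ->
     correlation P0 (X t) (X (t + tau)) <= C * tau `^ (- alpha))
  (corr_small : \forall tau \near (0 : R), forall t : R, 0 <= t -> 0 <= t + tau ->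
     1 - correlation P0 (X t) (X (t + tau)) <= C * `|tau| `^ a0)
  (Lam_copy : forall j : nat,
     process_copy P0 (fun t w => expR (X t w - sX ^+ 2 / 2)) P (Lam j))
  (Lam_indep : independent_processes P Lam)
  (qstar_ge2 : (2 <= qstar)%N)
  (b_large : expR (qstar%:R * sX ^+ 2 / 2) < b) :
  exists A : R -> Omega -> R,
    [/\ forall t : R, 0 <= t <= 1 -> measurable_fun [set: Omega] (A t),
        forall q t : R, 0 < q <= qstar%:R -> 0 <= t <= 1 ->
          'E_P[fun w => (`|multifractal_product Lam b n t w - A t w| `^ q)%R]%E
            @[n --> \oo] --> 0%E,
        forall q : R, 0 <= q <= qstar%:R ->
          exists c1 c2 : R, [/\ 0 < c1, c1 <= c2 &
            forall t : R, 0 <= t <= 1 ->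
              let e := scaling (sX ^+ 2 / (2 * ln b)) q in
              ((c1 * t `^ e)%:E <= 'E_P[fun w => (A t w `^ q)%R])%E /\
              ('E_P[fun w => (A t w `^ q)%R] <= (c2 * t `^ e)%:E)%E] &
        forall (alpha' : R) (L : R -> R), 0 < alpha' ->
          (forall t tau : R, 0 <= t -> 0 < tau ->
             correlation P0 (X t) (X (t + tau)) = L tau / `|tau| `^ alpha') ->
          slowly_varying L ->
          (forall M : R, [bounded L x | x in `[0, M]]) ->
          forall t : R, 0 < t <= 1 ->
            (alpha' < 1 ->
               ((t `^ (2 - alpha') * sX ^+ 2 *
                 \int[lebesgue_measure]_(u in `[0%R, 1%R])
                   \int[lebesgue_measure]_(w in `[0%R, 1%R])
                     (L (t * `|u - w|) / `|u - w| `^ alpha'))%:E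
                <= 'V_P[A t])%E) /\
            (1 <= alpha' ->
               ((2 * t * sX ^+ 2 *
                 \int[lebesgue_measure]_(u in `[0%R, t])
                   ((1 - u / t) * (L u / `|u| `^ alpha')))%:E
                <= 'V_P[A t])%E)].
Proof.
set v := sX ^+ 2.
have v0 : 0 < v by rewrite exprn_gt0.
pose rho s u := correlation P0 (X s) (X u).
have [Cl Cl0 rho_large] :=
  correlation_le_power X_measurable X_mean sX_gt0 X_variance C_gt0 alpha_gt0 corr_large.
have [Cs Cs0 rho_small] :=
  correlation_ge_power X_measurable X_mean sX_gt0 X_variance C_gt0 a0_gt0 corr_small.
have rho1 := correlation_le1 X_measurable X_mean sX_gt0 X_variance.
have rhoN1 := correlation_geN1 X_measurable X_mean sX_gt0 X_variance.
have rho_refl := correlation_refl X_measurable X_mean sX_gt0 X_variance.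
have rho_sym := correlation_sym P0 X.
have b1 : 1 < b.
  by apply: le_lt_trans b_large; rewrite -expR0 ler_expR divr_ge0 ?mulr_ge0// ltW.
have b0 : 0 < b by exact: lt_trans b1.
pose Y j := positive_version (Lam j).
have mLam j : measurable_process (Lam j) by have [] := Lam_copy j.
have mY j : measurable_fun setT (fun p : R * Omega => Y j p.1 p.2).
  exact: measurable_positive_version.
have Y_gt0 j s w : 0 < Y j s w by exact: positive_version_gt0.
have YL : lognormal_family P Y rho v.
  exact: (copies_lognormal_family X_measurable X_gaussian X_mean sX_gt0 X_variance).
have LamY n t := multifractal_product_ae mLam (copy_positive Lam_copy) b0 n t.
(* Choice asks for a statement about every real [t]; outside the unit interval the implication is
   void and the zero variable serves. *)
have /choice[A HA] : forall t, exists A, 0 <= t <= 1 -> is_mass_limit P Y b qstar t A.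
  move=> t; case: (boolP (0 <= t <= 1)) => t01; last by exists (fun=> 0).
  by have [A HA] := mass_limit_exists mY Y_gt0 YL v0 b1 alpha_gt0 a0_gt0 (ltW Cl0) (ltW Cs0)
    b_large rho1 rho_refl rho_sym rho_small rho_large qstar_ge2 t01; exists A.
exists A; split.
- by move=> t /HA[].
- move=> q t qk t01; have [mA A0 _] := HA t t01.
  have E (n : nat) : ('E_P[fun w => (`|multifractal_product Lam b n t w - A t w| `^ q)%R] =
      \int[P]_w (`|cascade_mass Y b n t w - A t w| `^ q)%:E)%E.
    rewrite unlock; apply: ge0_ae_eq_integral => //.
    + apply/measurable_EFinP; apply: (measurableT_comp (measurable_powR q)).
      apply: measurableT_comp => //; apply: measurable_funB => //.
      exact: measurable_multifractal_product.
    + apply/measurable_EFinP; apply: (measurableT_comp (measurable_powR q)).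
      apply: measurableT_comp => //; apply: measurable_funB => //.
      exact: measurable_cascade_mass.
    + by apply: filterS (LamY n t) => w /= -> _.
  apply: ereal_cvg0 => [n|eps eps0].
    by rewrite E integral_ge0// => w _; rewrite lee_fin powR_ge0.
  have [n0 H] := mass_limit_cvg mY Y_gt0 (HA t t01) qk eps0.
  by exists n0 => n nn; rewrite E; exact: H.
- move=> q qk; have [c1 [c2 [c10 c12 H]]] := limit_scaling mY Y_gt0 YL v0 b1 alpha_gt0 a0_gt0
    (ltW Cl0) (ltW Cs0) b_large rho1 rho_refl rho_sym rho_small rho_large qstar_ge2 qk.
  exists c1, c2; split=> // t t01 e.
  by have := H t (A t) t01 (HA t t01); rewrite !unlock.
move=> alpha' L alpha'0 corrE _ _ t /andP[t0 t1].
have t01 : 0 <= t <= 1 by rewrite (ltW t0).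
pose g (x : R) := 1 + rho 0 `|x|.
have mg : measurable_fun setT g.
  apply: measurable_funD => //.
  exact: (measurable_correlation X_measurable X_mean sX_gt0 X_variance).
have g02 x : 0 <= g x <= 2.
  have := rho1 0 `|x| (lexx _) (normr_ge0 _); have := rhoN1 0 `|x| (lexx _) (normr_ge0 _).
  by rewrite /g -/(rho 0 `|x|) => h1 h2; apply/andP; split; lra.
have g_even x : g (- x) = g x by rewrite /g normrN.
have g_pos x : 0 < x -> g x - 1 = L x / x `^ alpha'.
  move=> x0; rewrite /g gtr0_norm// addrC addKr -[in RHS](gtr0_norm x0).
  by have := corrE 0 x (lexx _) x0; rewrite add0r gtr0_norm.
(* [corrE] makes the correlation depend on the distance alone, so it is compared with its values
   from time 0, the argument of [g]; the diagonal follows from [rho_refl]. *)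
have rhoE s u : 0 <= s -> 0 <= u -> rho s u = g (s - u) - 1.
  have main s' u' : 0 <= s' -> s' < u' -> rho s' u' = g (s' - u') - 1.
    move=> s0 su; have D0 : 0 < u' - s' by rewrite subr_gt0.
    rewrite -g_even opprB g_pos//.
    by have := corrE s' (u' - s') s0 D0; rewrite subrKC gtr0_norm.
  move=> s0 u0; case: (ltgtP s u) => su; first exact: main.
    by rewrite /rho rho_sym -g_even opprB; exact: main.
  by rewrite su subrr /g normr0 /rho !rho_refl// addrK.
have [mA A0 _] := HA t t01.
have var_ge : ((v * (fine (square_integral g t) - t ^+ 2))%:E <= 'V_P[A t])%E.
  apply: (@variance_ge _ _ _ _ _ t) => //.
  - exact: ltW.
  - exact: (limit_mean mY Y_gt0 YL b1 rho_refl qstar_ge2 (ltW t0) (HA t t01)).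
  have [_] := limit_second_moment mY Y_gt0 YL v0 b1 alpha_gt0 a0_gt0 (ltW Cl0) (ltW Cs0)
    b_large rho1 rho_refl rho_sym rho_small rho_large qstar_ge2 t01 (HA t t01).
  apply: le_trans.
  rewrite (first_mass_second_moment mY Y_gt0 YL b1 rho_refl rho_sym (ltW t0)).
  apply: (le_trans (exp_square_integral_ge mg g02 (ltW v0) (ltW t0))).
  rewrite le_eqVlt; apply/orP; left; apply/eqP.
  apply: eq_integral => s /[!inE]/=; rewrite in_itv/= => /andP[s0 _].
  apply: eq_integral => u /[!inE]/=; rewrite in_itv/= => /andP[u0 _].
  by rewrite rhoE.
(* Both announced bounds are equal to the left side of [var_ge]; only the changes of variables
   differ. *)
split=> _; apply: le_trans var_ge; rewrite lee_fin le_eqVlt; apply/orP; left; apply/eqP.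
- have FE u w : 0 <= u <= 1 -> 0 <= w <= 1 -> u != w ->
      L (t * `|u - w|) / `|u - w| `^ alpha' = t `^ alpha' * (g (t * (u - w)) - 1).
    move=> _ _ uw; have D0 : 0 < `|u - w| by rewrite normr_gt0 subr_eq0.
    have -> : g (t * (u - w)) = g (t * `|u - w|).
      by rewrite /g !normrM normr_id.
    rewrite g_pos ?mulr_gt0// powRM ?(ltW t0) ?(ltW D0)//.
    by field; rewrite !gt_eqF// ?powR_gt0.
  have ta : t `^ (2 - alpha') * t `^ alpha' = t ^+ 2.
    by rewrite -powR_mulrn ?(ltW t0)// -powRD ?subrK// (gt_eqF t0) implybT.
  have := square_Rintegral mg g02 t0 FE.
  set I := Rintegral _ _ _; set J := fine _ => H.
  apply: (@mulfI _ (t `^ alpha')); first by rewrite gt_eqF ?powR_gt0.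
  transitivity (v * (t ^+ 2 * I)); first by rewrite -ta; ring.
  by rewrite H; ring.
- rewrite -(@triangle_Rintegral _ g v mg g02 g_even (fun u => L u / `|u| `^ alpha') t)//.
  by move=> u /andP[u0 _]; rewrite gtr0_norm// g_pos.
Qed.
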